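(* Let $0<T<\infty$, $1\le m<\infty$, $0\le\kappa<\infty$, $\gamma\ge1$, $0<\alpha_j<1$, $\alpha=\min_{1\le j\le m}\alpha_j$. Let $u$ and $v(t)=e^{\kappa t}u(t)$ be the exact solutions described in the context, let $V^n$, $0\le n\le N$, be given by $$\delta_tV^{1/2}+AV^1+\sum_{j=1}^mI^{(\alpha_j)}B_jV^{1/2}-\kappa V^1=g^{1/2},$$ $$\delta_tV^{n-1/2}+AV^{n-1/2}+\sum_{j=1}^mI^{(\alpha_j)}B_jV^{n-1/2}-\kappa V^{n-1/2}=g^{n-1/2},\quad 2\le n\le N,\qquad V^0=u_0,$$ and let $U^n=e^{-\kappa t_n}V^n$. Assume that: (a) the time levels satisfy, with constants $C_\gamma,c_\gamma>0$ independent of $k$: $k_n\le C_\gamma k\min\{1,t_n^{1-1/\gamma}\}$ for $n\ge1$; $t_1=k_1\ge c_\gamma k^\gamma$ and $t_n\le C_\gamma t_{n-1}$ for $n\ge2$; and $0\le k_{n+1}-k_n\le C_\gamma k^2\min\{1,t_n^{1-2/\gamma}\}$ for $n\ge2$; (b) for $0<t\le T$, $t\|Av''(t)\|+\|v''(t)\|+\|Av'(t)\|\le Ct^{\alpha-1}$ and $t\|Au''(t)\|+\|u''(t)\|+\|Au'(t)\|\le Ce^{-\kappa t}t^{\alpha-1}$; (c) for $0<t\le T$, $t\|g'(t)\|+t^2\|g''(t)\|\le Ct^\alpha$. Then there is a constant $C_{\alpha,\kappa,\gamma,T,m}>0$, independent of the step sizes, such that $$\max_{1\le n\le N}\|V^n-v(t_n)\|\le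 C_{\alpha,\kappa,\gamma,T,m}\,\Xi(k,\alpha,\gamma,T),\qquad \max_{1\le n\le N}\|U^n-u(t_n)\|\le C_{\alpha,\kappa,\gamma,T,m}\,\Xi(k,\alpha,\gamma,T),$$ where $$\Xi(k,\alpha,\gamma,T)=\begin{cases}k^{\gamma(\alpha+1)},&1\le\gamma<2/(\alpha+1),\\ k^2\log(t_N/t_1),&\gamma=2/(\alpha+1),\\ k^2,&\gamma>2/(\alpha+1).\end{cases}$$
   Context: $\mathbf H$ is a Hilbert space with inner product $(\cdot,\cdot)$ and norm $\|\cdot\|$. $A$ is a self-adjoint positive-definite linear operator, not necessarily bounded, with compact inverse, defined on a dense subspace $D(A)\subset\mathbf H$; $\|w\|_q=\|A^{q/2}w\|$. Each $B_j$ ($1\le j\le m$) is a self-adjoint linear operator in $\mathbf H$ with $D(B_j)\supset D(A)$, and $|(B_jw,v)|\le C\|w\|_q\|v\|_\vartheta$ for $\vartheta=0,1,2$, $\vartheta+q=2$. Continuous problem: $u'(t)+Au(t)+\sum_{j=1}^m\int_0^t\beta_j(t-s)B_ju(s)\,ds=f(t)$ for $t>0$, $u(0)=u_0$, with $\beta_j(t)=e^{-\kappa t}t^{\alpha_j-1}/\Gamma(\alpha_j)$. With $v(t)=e^{\kappa t}u(t)$ and $g(t)=e^{\kappa t}f(t)$, $v$ solves $v'(t)+Av(t)+\sum_{j=1}^m\int_0^t\omega_{\alpha_j}(t-s)B_jv(s)\,ds-\kappa v(t)=g(t)$, $v(0)=u_0$, where $\omega_{\alpha_j}(t)=t^{\alpha_j-1}/\Gamma(\alpha_j)$.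 Time levels: $0=t_0<t_1<\dots<t_N=T$, $k_n=t_n-t_{n-1}$, $t_{n-1/2}=\tfrac12(t_n+t_{n-1})$; $k>0$ is a mesh parameter (for example $t_n=(nk)^\gamma$, $k=T^{1/\gamma}/N$). For a sequence $(\mathcal V^n)$: $\delta_t\mathcal V^{n-1/2}=(\mathcal V^n-\mathcal V^{n-1})/k_n$, $\mathcal V^{n-1/2}=\tfrac12(\mathcal V^n+\mathcal V^{n-1})$. The discrete fractional integral is $$I^{(\alpha_j)}\mathcal V^{n-1/2}=w^{(j)}_{n1}\mathcal V^1k_1+\sum_{p=2}^nw^{(j)}_{np}\mathcal V^{p-1/2}k_p,\qquad w^{(j)}_{np}=\frac1{k_nk_p}\int_{t_{n-1}}^{t_n}\int_{t_{p-1}}^{\min\{t,t_p\}}\omega_{\alpha_j}(t-\vartheta)\,d\vartheta\,dt,$$ and $I^{(\alpha_j)}B_j\mathcal V^{n-1/2}$ is this formula applied to the sequence $(B_j\mathcal V^n)$. The elements $g^{n-1/2}\in\mathbf H$ are approximations of $\frac1{k_n}\int_{t_{n-1}}^{t_n}g(t)\,dt$ satisfying $\|g^{1/2}k_1-\int_{t_0}^{t_1}g(t)\,dt\|\le C\int_{t_0}^{t_1}t\|g'(t)\|\,dt$ and $\|g^{n-1/2}k_n-\int_{t_{n-1}}^{t_n}g(t)\,dt\|\le Ck_n^2\int_{t_{n-1}}^{t_n}\|g''(t)\|\,dt$ for $n\ge2$. $C$ denotes a generic positive constant independent of the step sizes.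
   Formalization: The bounds are proved for all sufficiently small mesh parameters 0 < k ≤ k_0, with k_0 > 0 depending only on the same data as the constant; for coarse meshes the claim is false (e.g. A=1, B_j=0, κ=2, k_1=T=1 leaves V^1 undetermined). *)

(* Defs.v *)
From HB Require Import structures.
From mathcomp Require Import all_boot all_order all_algebra sesquilinear.
From mathcomp Require Import all_classical all_reals all_analysis.

Set Implicit Arguments.
Unset Strict Implicit.
Unset Printing Implicit Defensive.

Import Order.TTheory GRing.Theory Num.Theory.
Import numFieldNormedType.Exports.

Local Open Scope classical_set_scope.
Local Open Scope ring_scope.

(* A Hilbert space is a complete normed space [H] whose norm comes from an
   inner product [ip : {dot H for idfun}], i.e. [hilbert_norm ip].  Real
   scalars lose no generality: a complex Hilbert space is a real one for the
   real part of its inner product, with the same self-adjoint operators. *)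
Definition hilbert_norm (R : realType) (H : completeNormedModType R)
    (ip : {dot H for idfun}) : Prop :=
  forall x : H, ip x x = `|x| ^+ 2.

(* Unbounded operator: [app] is total, but carries no information outside the
   subspace [dom]. *)
Record linop (R : realType) (H : lmodType R) := Linop {
  dom : set H;
  app :> H -> H;
  dom0 : dom 0;
  dom_linear : forall (a : R) (x y : H), dom x -> dom y -> dom (a *: x + y);
  app_linear : forall (a : R) (x y : H),
    dom x -> dom y -> app (a *: x + y) = a *: app x + app y }.

Section Operators.
Variables (R : realType) (H : completeNormedModType R).
Variable ip : {dot H for idfun}.
Implicit Types (A S B : linop H).

Definition densely_defined A : Prop := closure (dom A) = setT.

(* [(v, w)] is in the graph of the adjoint of [A]. *)
Definition adjoint_graph A (v w : H) : Prop :=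
  forall u, dom A u -> ip (A u) v = ip u w.

Definition self_adjoint A : Prop :=
  densely_defined A /\
  forall v w, adjoint_graph A v w <-> (dom A v /\ A v = w).

Definition positive_definite A : Prop :=
  forall w, dom A w -> w != 0 -> 0 < ip (A w) w.

Definition has_compact_inverse A : Prop :=
  exists K : H -> H,
    [/\ forall x, dom A (K x) /\ A (K x) = x,
        forall w, dom A w -> K (A w) = w &
        compact (closure (K @` ball (0 : H) 1))].

(* [S] is the (unique) nonnegative self-adjoint square root of [A], that is
   [A^(1/2)]; the last clause says that [S \o S] and [A] have the same graph,
   hence the same domain. *)
Definition is_sqrt_op S A : Prop :=
  [/\ self_adjoint S,
      forall w, dom S w -> 0 <= ip (S w) w &
      forall w z, (dom A w /\ A w = z) <->
                  [/\ dom S w, dom S (S w) & S (S w) = z]].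

(* With [S] standing for [A^(1/2)]: the domain of [A^(q/2)], and the norm
   [w |-> || A^(q/2) w ||] on it. *)
Definition dom_half S (q : nat) (w : H) : Prop :=
  forall i : nat, (i < q)%N -> dom S (iter i S w).

Definition qnorm S (q : nat) (w : H) : R := `|iter q S w|.

Definition form_bound A S B (C : R) : Prop :=
  forall (q theta : nat) (w v : H), (theta + q = 2)%N ->
    dom A w -> dom_half S theta v ->
    `|ip (B w) v| <= C * qnorm S q w * qnorm S theta v.

End Operators.

Section BochnerIntegral.
Variables (R : realType) (H : completeNormedModType R).
Local Notation mu := (@lebesgue_measure R).

Record step_fun := StepFun {
  npieces : nat;
  piece : 'I_npieces -> set R;
  height : 'I_npieces -> H;
  piece_measurable : forall i, measurable (piece i);
  piece_finite : forall i, (mu (piece i) < +oo)%E }.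

Definition step_val (s : step_fun) (t : R) : H :=
  \sum_(i < npieces s) (\1_(piece i) t : R) *: height i.

Definition step_integral (D : set R) (s : step_fun) : H :=
  \sum_(i < npieces s) fine (mu (D `&` piece i)) *: height i.

Definition is_bochner (D : set R) (F : R -> H) (x : H) : Prop :=
  exists s : nat -> step_fun,
    [/\ forall t, D t -> step_val (s n) t @[n --> \oo] --> F t,
        (\int[mu]_(t in D) (`|F t - step_val (s n) t|)%:E)%E @[n --> \oo]
          --> 0%E &
        step_integral D (s n) @[n --> \oo] --> x].

Definition bochner_integrable (D : set R) (F : R -> H) : Prop :=
  exists x, is_bochner D F x.

(* [0] when [F] is not Bochner integrable over [D]. *)
Definition bochner (D : set R) (F : R -> H) : H := xget 0 (is_bochner D F).

End BochnerIntegral.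

Section Kernels.
Variable R : realType.
Local Notation mu := (@lebesgue_measure R).

Definition Gamma (x : R) : R :=
  (\int[mu]_(s in `]0, +oo[) (s `^ (x - 1) * expR (- s)))%R.

Definition omega (a t : R) : R := t `^ (a - 1) / Gamma a.

Definition beta (kappa a t : R) : R := expR (- kappa * t) * omega a t.

End Kernels.

Section Continuous.
Variables (R : realType) (H : completeNormedModType R) (m : nat).
Variables (A : linop H) (B : 'I_m -> linop H) (al : 'I_m -> R).

Definition exact_solution (kappa : R) (f : R -> H) (u0 : H) (u : R -> H) :
    Prop :=
  [/\ {within `[0, +oo[, continuous u}, u 0 = u0 &
      forall t : R, 0 < t ->
        let memory j s := beta kappa (al j) (t - s) *: B j (u s) in
        [/\ derivable u t 1, dom A (u t),
            forall j, bochner_integrable `[0, t] (memory j) &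
            derive1 u t + A (u t) + \sum_(j < m) bochner `[0, t] (memory j)
              = f t]].

Definition twice_derivable (T : R) (w : R -> H) : Prop :=
  forall t : R, 0 < t <= T -> derivable w t 1 /\ derivable (derive1 w) t 1.

Definition solution_regularity (T : R) (w : R -> H) (bound : R -> R) : Prop :=
  twice_derivable T w /\
  forall t : R, 0 < t <= T ->
    [/\ dom A (derive1 w t), dom A (derive1n 2 w t) &
        t * `|A (derive1n 2 w t)| + `|derive1n 2 w t| + `|A (derive1 w t)|
          <= bound t].

Definition data_regularity (T : R) (g : R -> H) (bound : R -> R) : Prop :=
  twice_derivable T g /\
  forall t : R, 0 < t <= T ->
    t * `|derive1 g t| + t ^+ 2 * `|derive1n 2 g t| <= bound t.

End Continuous.

Section Discrete.
Variables (R : realType) (H : completeNormedModType R).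
Local Notation mu := (@lebesgue_measure R).

Definition time_levels (T : R) (N : nat) (t : nat -> R) : Prop :=
  [/\ (0 < N)%N, t 0%N = 0, t N = T &
      forall n : nat, (n < N)%N -> t n < t n.+1].

(* [tau t n] is the step size [k_n = t_n - t_(n-1)], for [n >= 1]. *)
Definition tau (t : nat -> R) (n : nat) : R := t n - t n.-1.

Definition graded_mesh (gamma Cgam cgam k : R) (N : nat) (t : nat -> R) :
    Prop :=
  [/\ forall n : nat, (1 <= n <= N)%N ->
        tau t n <= Cgam * k * Num.min 1 (t n `^ (1 - 1 / gamma)),
      cgam * k `^ gamma <= t 1%N,
      forall n : nat, (2 <= n <= N)%N -> t n <= Cgam * t n.-1 &
      forall n : nat, (2 <= n < N)%N ->
        0 <= tau t n.+1 - tau t n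
          <= Cgam * k ^+ 2 * Num.min 1 (t n `^ (1 - 2 / gamma))].

(* [dt t V n] and [avg V n] are the quantities with superscript [n - 1/2]. *)
Definition dt (t : nat -> R) (V : nat -> H) (n : nat) : H :=
  (tau t n)^-1 *: (V n - V n.-1).

Definition avg (V : nat -> H) (n : nat) : H := 2^-1 *: (V n + V n.-1).

Definition weight (a : R) (t : nat -> R) (n p : nat) : R :=
  (tau t n * tau t p)^-1 *
  (\int[mu]_(x in `[t n.-1, t n])
     \int[mu]_(s in `[t p.-1, Num.min x (t p)]) omega a (x - s))%R.

Definition frac_int (a : R) (t : nat -> R) (V : nat -> H) (n : nat) : H :=
  (weight a t n 1 * tau t 1) *: V 1%N
  + \sum_(2 <= p < n.+1) (weight a t n p * tau t p) *: avg V p.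

(* [gh n] stands for [g^(n-1/2)]. *)
Definition data_approximation (C : R) (N : nat) (t : nat -> R)
    (g : R -> H) (gh : nat -> H) : Prop :=
  [/\ forall n : nat, (1 <= n <= N)%N ->
        bochner_integrable `[t n.-1, t n] g,
      ((`|tau t 1 *: gh 1%N - bochner `[t 0%N, t 1%N] g|)%:E <=
         C%:E * \int[mu]_(s in `[t 0%N, t 1%N]) (s * `|derive1 g s|)%:E)%E &
      forall n : nat, (2 <= n <= N)%N ->
        ((`|tau t n *: gh n - bochner `[t n.-1, t n] g|)%:E <=
           (C * tau t n ^+ 2)%:E *
             \int[mu]_(s in `[t n.-1, t n]) (`|derive1n 2 g s|)%:E)%E].

Definition discrete_solution (m : nat) (A : linop H) (B : 'I_m -> linop H)
    (al : 'I_m -> R) (kappa : R) (N : nat) (t : nat -> R)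
    (gh : nat -> H) (u0 : H) (V : nat -> H) : Prop :=
  [/\ V 0%N = u0,
      forall n : nat, (1 <= n <= N)%N -> dom A (V n),
      dt t V 1 + A (V 1%N)
        + \sum_(j < m) frac_int (al j) t (fun i => B j (V i)) 1
        - kappa *: V 1%N = gh 1%N &
      forall n : nat, (2 <= n <= N)%N ->
        dt t V n + A (avg V n)
          + \sum_(j < m) frac_int (al j) t (fun i => B j (V i)) n
          - kappa *: avg V n = gh n].

(* [tN / t1] is the ratio of the last to the first time level. *)
Definition Xi (k alpha gamma t1 tN : R) : R :=
  if gamma < 2 / (alpha + 1) then k `^ (gamma * (alpha + 1))
  else if gamma == 2 / (alpha + 1) then k ^+ 2 * ln (tN / t1)
  else k ^+ 2.

End Discrete.

Definition is_min (R : realType) (m : nat) (al : 'I_m -> R) (x : R) : Prop :=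
  (forall j, x <= al j) /\ (exists j, al j = x).

(* Main.v *)
(* The error e^n = V^n - v(t_n) is tested against elements phi of D(A); the
   scalar functions (v(t), psi) with psi = phi, A phi, B_j phi are as singular as
   v at t = 0: their first two derivatives are O(t^(alpha - 1)), O(t^(alpha - 2)).

   Stability.  Taking for phi the stage value of e^n (its value at t_1 for
   n = 1, the mean over the two end points of the step for n >= 2), the form
   bound controls the memory by the A^(1/2)-norms of earlier stage values.  After
   weighting the steps by e^(-2 lam t_n), the rows and the columns of the memory
   weights sum to at most the step size: near the diagonal because the steps are
   small, away from it because lam is large.  The memory is thus absorbed, and
   max |e^n| is bounded by the sum of the residuals.

   Consistency.  In each cell v differs from its linear interpolant by
   O(k_n^2 t_n^(alpha - 2)), and the interpolant differs from the stage value by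
   its slope times the distance to the midpoint.  The latter is only first order,
   but the corresponding first moments of the kernel are k_p^3 times Peano
   coefficients that decrease along the diagonals, because the steps increase;
   summing by parts moves the difference onto the slopes and restores the second
   order.  All residuals then sum to at most a constant times
   t_1^(alpha + 1) + k^2 sum_n k_n t_n^(alpha - 2/gamma), which is O(Xi). *)
Require Import Defs.
From HB Require Import structures.
From mathcomp Require Import all_boot all_order all_algebra sesquilinear ring lra.
From mathcomp Require Import all_classical all_reals all_analysis measurable_realfun.
Import Order.TTheory GRing.Theory Num.Theory.
Import numFieldNormedType.Exports.
Local Open Scope classical_set_scope.
Local Open Scope ring_scope.

Set Implicit Arguments.
Unset Strict Implicit.
Unset Printing Implicit Defensive.

(** * Improper integrals *)

(** No sign is assumed on the memory term, so it cannot be discarded as a nonnegative quadratic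
    form. Its bound has the same strength as the dissipation; only the small mass of the kernel near
    the diagonal makes the absorption possible.

    The vector equation is never integrated. Continuity at 0 is known for v, not for A v or B_j v;
    but (v, psi) is continuous for each fixed psi, and self-adjointness moves A and B_j onto phi.
    Scalar calculus then suffices, and the density of D(A) turns scalar bounds back into norms.

    The summation by parts is the exception: the test element changes with n, so it has to act on
    vectors before any pairing. It cannot be avoided by bounding the first moments one at a time: at
    the diagonal they have size k_p^(2 + alpha_j), and their sum has order 1 + alpha_j only.

    The constant and the bound on k are chosen before the operators B_j, the exponents and the
    solution, so all kernel bounds are uniform over exponents in [alpha, 1). *)

Lemma ge0_le_integral_nonmeasurable (d : measure_display) (T : measurableType d) (R : realType)
    (mu : {measure set T -> \bar R}) (D : set T) (f g : T -> \bar R) :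
  (forall x, D x -> 0 <= f x)%E -> (forall x, D x -> f x <= g x)%E ->
  (\int[mu]_(x in D) f x <= \int[mu]_(x in D) g x)%E.
Proof.
move=> f0 fg.
have g0 x : D x -> (0 <= g x)%E by move=> Dx; exact: le_trans (f0 _ Dx) (fg _ Dx).
rewrite integral_mkcond [leRHS]integral_mkcond !ge0_integralTE; last 2 first.
- exact: erestrict_ge0.
- exact: erestrict_ge0.
(* A nonnegative integral is the supremum over simple functions below the integrand, and the left
   supremum runs over the smaller set. This serves integrands whose measurability is not
   established, such as the norm of [F t - step_val s t]. *)
apply: ereal_sup_le => _ [h hf <-].
by exists h => // x; apply: (le_trans (hf x)); exact: lee_restrict.
Qed.

Section Integration.
Context {R : realType}.
Local Notation mu := (@lebesgue_measure R).

(** The kernel blows up at an end of its interval. The formula is therefore proved on intervals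
    shrunk by [e n], and the limit is taken by monotone convergence for the integrals and by
    continuity of [F] for the increments. *)
Lemma ge0_FTC_itv (f F : R -> R) (a b : R) : a < b ->
  (forall x, a < x < b -> 0 <= f x) ->
  (forall x, a < x < b -> {for x, continuous f}) ->
  (forall x, a < x < b -> is_derive x 1 F (f x)) ->
  {within `[a, b], continuous F} ->
  (\int[mu]_(x in `[a, b]) (f x)%:E = (F b - F a)%:E)%E.
Proof.
move=> ab f0 cf dF cF.
have mf : measurable_fun `]a, b[ f.
  apply: open_continuous_measurable_fun; first exact: interval_open.
  by move=> x; rewrite inE/= in_itv/=; exact: cf.
rewrite (@integral_itv_bndoo _ a b (EFin \o f) true false); last exact/measurable_EFinP.
(* The denominator exceeds 2, so that [a + e n < b - e n] for every [n]. *)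
pose e (n : nat) : R := (b - a) / n.+3%:R.
have ba0 : 0 < b - a by rewrite subr_gt0.
have e0 n : 0 < e n by rewrite divr_gt0.
have e2 n : e n < (b - a) / 2.
  by rewrite ltr_pM2l// ltf_pV2 ?posrE// ltr_nat.
have ecvg : e n @[n --> \oo] --> (0 : R).
  rewrite -(mulr0 (b - a)); apply: cvgMr.
  by have := @cvg_harmonic R; rewrite -(cvg_shiftn 2); under eq_fun do rewrite /= addn2.
pose I (n : nat) : set R := `[a + e n, b - e n]%classic.
have mI n : measurable (I n) by exact: measurable_itv.
have IU : \bigcup_n I n = `]a, b[%classic.
  apply/seteqP; split => x /=.
    move=> [n _]; rewrite /I/= !in_itv/= => /andP[ax xb].
    by have := e0 n; move: ax xb; set z := e n => *; apply/andP; split; lra.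
  rewrite in_itv/= => /andP[ax xb].
  pose d := Num.min (x - a) (b - x).
  have d0 : 0 < d by rewrite lt_min; apply/andP; split; lra.
  have [n _ /(_ n (leqnn n))] : \forall n \near \oo, e n < d.
    exact: (cvgr_lt _ ecvg).
  rewrite lt_min => /andP[e1 e3]; exists n => //; rewrite /I/= in_itv/=.
  by move: e1 e3; set z := e n => *; apply/andP; split; lra.
have lim1 : (\int[mu]_(x in I n) (f x)%:E)%E @[n --> \oo] -->
    (\int[mu]_(x in `]a, b[) (f x)%:E)%E.
  rewrite -IU; apply: ge0_nondecreasing_set_cvg_integral => //.
  - move=> m n mn; rewrite subsetEset => x; rewrite /I/= !in_itv/=.
    have : e n <= e m by rewrite ler_pM2l// lef_pV2 ?posrE// ler_nat.
    by set z := e n; set w := e m => zw /andP[? ?]; apply/andP; split; lra.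
  - move=> n; apply/measurable_EFinP; apply: measurable_funS mf => // x.
    by move=> Ix; rewrite -IU; exists n.
  - move=> n x Ix; rewrite lee_fin; apply: f0.
    have : (\bigcup_n I n) x by exists n.
    by rewrite IU/= in_itv.
have In n : (\int[mu]_(x in I n) (f x)%:E)%E = (F (b - e n) - F (a + e n))%:E.
  have := e2 n; have := e0 n; rewrite /I; set z := e n => z0 z2.
  have sub x : a + z <= x <= b - z -> a < x < b.
    by move=> /andP[? ?]; apply/andP; split; lra.
  rewrite EFinB; apply: continuous_FTC2.
  - lra.
  - apply: continuous_in_subspaceT => x; rewrite inE/= in_itv/= => /sub; exact: cf.
  - have : {within `[a + z, b - z], continuous F}.
      by apply: continuous_subspaceW cF; apply: subset_itv; rewrite bnd_simp; lra.
    move/continuous_within_itvP => [|_ c1 c2]; first lra.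
    split=> // x; rewrite in_itv/= => /andP[x1 x2].
    have xab : a < x < b by apply: sub; rewrite !ltW.
    exact: @ex_derive _ _ _ _ _ _ _ (dF _ xab).
  - move=> x; rewrite in_itv/= => /andP[x1 x2].
    have xab : a < x < b by apply: sub; rewrite !ltW.
    by rewrite derive1E; apply: (@derive_val _ _ _ _ _ _ _ (dF _ xab)).
have lim2 : (\int[mu]_(x in I n) (f x)%:E)%E @[n --> \oo] --> (F b - F a)%:E.
  under eq_fun do rewrite In.
  apply: cvg_EFin; first by near=> n.
  have [_ c1 c2] := (continuous_within_itvP F ab).1 cF.
  apply: cvgB.
    move/cvg_at_leftP : c2 => /(_ (fun n => b - e n)); apply; split.
      by move=> n; rewrite ltrBlDr ltrDl.
    by rewrite -[X in _ --> X]subr0; apply: cvgB => //; exact: cvg_cst.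
  move/cvg_at_rightP : c1 => /(_ (fun n => a + e n)); apply; split.
    by move=> n; rewrite ltrDl.
  by rewrite -[X in _ --> X]addr0; apply: cvgD => //; exact: cvg_cst.
exact: (cvg_unique _ lim1 lim2).
Unshelve. all: by end_near. Qed.

Lemma ge0_FTC_integrable (f F : R -> R) (a b : R) : a < b ->
  (forall x, a < x < b -> 0 <= f x) ->
  (forall x, a < x < b -> {for x, continuous f}) ->
  (forall x, a < x < b -> is_derive x 1 F (f x)) ->
  {within `[a, b], continuous F} ->
  mu.-integrable `[a, b] (EFin \o f).
Proof.
move=> ab f0 cf dF cF.
have mf : measurable_fun `]a, b[ f.
  apply: open_continuous_measurable_fun; first exact: interval_open.
  by move=> x; rewrite inE/= in_itv/=; exact: cf.
apply/integrableP; split; first by apply/measurable_EFinP; exact: measurable_fun_itv_cc mf.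
have mf' : measurable_fun `]a, b[ (EFin \o f) by exact/measurable_EFinP.
rewrite (@integral_itv_bndoo _ a b _ true false); last exact: measurableT_comp.
under eq_integral => x xab.
  rewrite gee0_abs; last by move: xab; rewrite inE/= in_itv/= lee_fin => /f0.
  over.
rewrite -(@integral_itv_bndoo _ a b _ true false)//.
by rewrite (ge0_FTC_itv ab f0 cf dF cF) ltry.
Qed.

(* [g], with antiderivative [G], dominates [f]: the singularity of [f] at the
   ends of the interval need not have constant sign. *)
Lemma FTC_dominated (f F g G : R -> R) (a b : R) : a < b ->
  (forall x, a < x < b -> `|f x| <= g x) ->
  (forall x, a < x < b -> {for x, continuous f}) ->
  (forall x, a < x < b -> {for x, continuous g}) ->
  (forall x, a < x < b -> is_derive x 1 F (f x)) ->
  (forall x, a < x < b -> is_derive x 1 G (g x)) ->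
  {within `[a, b], continuous F} -> {within `[a, b], continuous G} ->
  mu.-integrable `[a, b] (EFin \o f) /\
  (\int[mu]_(x in `[a, b]) f x = F b - F a)%R.
Proof.
move=> ab fg cf cg dF dG cF cG.
have g0 x : a < x < b -> 0 <= g x by move=> /fg; apply: le_trans.
have fg0 x : a < x < b -> 0 <= (f + g) x.
  by move=> /fg; rewrite ler_norml => /andP[+ _]; rewrite -subr_ge0 opprK.
have cfg x : a < x < b -> {for x, continuous (f + g)}.
  by move=> xab; apply: continuousD; [exact: cf|exact: cg].
have dFG x : a < x < b -> is_derive x 1 (F + G) ((f + g) x).
  by move=> xab; apply: is_deriveD; [exact: dF|exact: dG].
have cFG : {within `[a, b], continuous (F + G)}.
  by move=> x; apply: continuousD; [exact: cF|exact: cG].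
have ig := ge0_FTC_integrable ab g0 cg dG cG.
have ifg := ge0_FTC_integrable ab fg0 cfg dFG cFG.
have mI : measurable (`[a, b]%classic : set R) by exact: measurable_itv.
(* [f] is the difference of [f + g] and [g], both nonnegative with continuous antiderivatives. *)
have fE : EFin \o f = (fun x => (EFin \o (f + g)%R) x - (EFin \o g) x)%E.
  by apply/funext => x /=; rewrite -EFinB addrK.
split; first by rewrite fE; exact: integrableB.
have -> : (\int[mu]_(x in `[a, b]) f x = \int[mu]_(x in `[a, b]) ((f + g)%R x - g x))%R.
  by apply: eq_Rintegral => x _ /=; rewrite addrK.
rewrite RintegralB// /Rintegral (ge0_FTC_itv ab g0 cg dG cG).
rewrite (ge0_FTC_itv ab fg0 cfg dFG cFG) /=.
rewrite -[(F + G)%R b]/(F b + G b) -[(F + G)%R a]/(F a + G a); ring.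
Qed.

End Integration.

(** * The fractional kernel and its antiderivatives *)

Section PositivePower.
Context {R : realType}.
Implicit Types (r x y : R).

(** Truncation at 0 encodes causality: antiderivatives of the kernel built from it vanish at
    negative arguments, so a cell lying before, around or after the current time is covered by one
    formula. *)
Definition pos_pow r x : R := Num.max x 0 `^ r.

Lemma pos_powE r x : 0 <= x -> pos_pow r x = x `^ r.
Proof. by move=> x0; rewrite /pos_pow max_l. Qed.

Lemma pos_pow_le0 r x : 0 < r -> x <= 0 -> pos_pow r x = 0.
Proof. by move=> r0 x0; rewrite /pos_pow max_r// powR0// gt_eqF. Qed.

Lemma pos_pow_ge0 r x : 0 <= pos_pow r x.
Proof. exact: powR_ge0. Qed.

Lemma pos_pow_homo r : 0 < r -> {homo pos_pow r : x y / x <= y}.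
Proof.
move=> r0 x y xy; apply: ge0_ler_powR; rewrite ?nnegrE ?le_max ?lexx ?orbT ?(ltW r0)//.
by case: (leP x 0) => x0; [rewrite lexx orbT|rewrite xy].
Qed.

Lemma is_derive_pos_pow_gt0 r x : 0 < x ->
  is_derive x 1 (pos_pow r) (r * x `^ (r - 1)).
Proof.
move=> x0; apply: (@near_eq_is_derive _ _ _ (fun y => y `^ r)).
- near=> y; rewrite pos_powE// ltW//; near: y; exact: lt_nbhsr.
- exact: is_derive1_powR.
Unshelve. all: by end_near. Qed.

Lemma is_derive_pos_pow_lt0 r x : 0 < r -> x < 0 -> is_derive x 1 (pos_pow r) 0.
Proof.
move=> r0 x0; apply: (@near_eq_is_derive _ _ _ (cst 0)).
- near=> y; rewrite pos_pow_le0// ltW//; near: y; exact: lt_nbhsl.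

Unshelve. all: by end_near. Qed.

Lemma continuous_pos_pow r : 0 < r -> continuous (pos_pow r).
Proof.
move=> r0 x; have [x0|x0|->] := ltgtP x 0.
- apply: differentiable_continuous; apply/derivable1_diffP.
  by have [] := is_derive_pos_pow_lt0 r0 x0.
- apply: differentiable_continuous; apply/derivable1_diffP.
  by have [] := is_derive_pos_pow_gt0 r x0.
apply/cvgrPdist_le => e e0; rewrite (pos_pow_le0 r0 (lexx 0)).
near=> y; rewrite sub0r normrN ger0_norm ?pos_pow_ge0//.
have -> : e = pos_pow r (e `^ r^-1).
  by rewrite pos_powE ?powR_ge0// -powRrM mulVf ?gt_eqF// powRr1// ltW.
apply: pos_pow_homo => //; apply: ltW; near: y; apply: lt_nbhsl.
exact: powR_gt0.
Unshelve. all: by end_near. Qed.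

(** The delicate point is 0, where the difference quotient is at most [pos_pow (r - 1)], which tends
    to 0 because [1 < r]. *)
Lemma is_derive_pos_pow r x : 1 < r ->
  is_derive x 1 (pos_pow r) (r * pos_pow (r - 1) x).
Proof.
move=> r1; have r0 : 0 < r by exact: lt_trans r1.
have r10 : 0 < r - 1 by rewrite subr_gt0.
have [x0|x0|->] := ltgtP x 0.
- by rewrite pos_pow_le0 ?(ltW x0)// mulr0; exact: is_derive_pos_pow_lt0.
- by rewrite pos_powE ?(ltW x0)//; exact: is_derive_pos_pow_gt0.
rewrite (pos_pow_le0 r10 (lexx 0)) mulr0.
have cp : pos_pow (r - 1) y @[y --> (0 : R)^'] --> (0 : R).
  rewrite -[X in _ --> X](pos_pow_le0 r10 (lexx 0)).
  by apply: cvg_within_filter; exact: continuous_pos_pow.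
suff dc : h^-1 *: (pos_pow r (h *: 1 + 0) - pos_pow r 0) @[h --> (0 : R)^'] --> (0 : R).
  by apply: DeriveDef; [apply/cvg_ex; exists 0|apply/cvg_lim].
apply/norm_cvg0P.
apply: (@squeeze_cvgr _ _ _ _ (cst 0) (pos_pow (r - 1))) => //; last exact: cvg_cst.
near=> h; rewrite normr_ge0/= (pos_pow_le0 r0 (lexx 0)).
have h0 : h != 0 by near: h; exact: nbhs_dnbhs_neq.
rewrite /GRing.scale/= mulr1 addr0 subr0 normrM normfV (ger0_norm (pos_pow_ge0 _ _)).
have [hp|hn] := leP h 0; first by rewrite !pos_pow_le0// mulr0.
rewrite !pos_powE ?(ltW hn)// gtr0_norm// powRB ?powRr1 ?(ltW hn)//.
  by rewrite mulrC.
by rewrite h0 implybT.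
Unshelve. all: by end_near. Qed.

End PositivePower.

(** * Derivation rules and mean value inequalities for real functions *)

Section RealDerivatives.
Context {R : realType}.
Implicit Types (f g : R -> R) (x y k df dg : R).

Lemma derive_add f g x df dg : is_derive x 1 f df -> is_derive x 1 g dg ->
  is_derive x 1 (fun s => f s + g s) (df + dg).
Proof. by move=> hf hg; apply: is_deriveD. Qed.

Lemma derive_sub f g x df dg : is_derive x 1 f df -> is_derive x 1 g dg ->
  is_derive x 1 (fun s => f s - g s) (df - dg).
Proof. by move=> hf hg; apply: is_deriveB. Qed.

Lemma derive_scale f x df k : is_derive x 1 f df ->
  is_derive x 1 (fun s => k * f s) (k * df).
Proof. by move=> hf; apply: is_deriveZ. Qed.

Lemma derive_mul f g x df dg : is_derive x 1 f df -> is_derive x 1 g dg ->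
  is_derive x 1 (fun s => f s * g s) (df * g x + f x * dg).
Proof.
move=> hf hg; apply: (is_derive_eq (is_deriveM hf hg)).
by rewrite /GRing.scale/= addrC mulrC.
Qed.

Lemma derive_reflect f x y df : is_derive (y - x) 1 f df ->
  is_derive x 1 (fun s => f (y - s)) (- df).
Proof.
move=> hf; have hg : is_derive x 1 (fun s => y - s) (-1).
  apply: (is_derive_eq (derive_sub (is_derive_cst y x 1) (is_derive_id x 1))).
  by rewrite sub0r.
by apply: (is_derive_eq (@is_derive1_comp _ f (fun s => y - s) x _ _ hf hg)); rewrite mulrN1.
Qed.

Lemma derive_affine f x y k df : is_derive (y + x * k) 1 f df ->
  is_derive x 1 (fun s => f (y + s * k)) (k * df).
Proof.
move=> hf; have hg : is_derive x 1 (fun s => y + s * k) k.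
  have hk := derive_mul (is_derive_id x 1) (is_derive_cst k x 1).
  by apply: (is_derive_eq (derive_add (is_derive_cst y x 1) hk)); rewrite add0r mul1r mulr0 addr0.
by apply: (is_derive_eq (@is_derive1_comp _ f (fun s => y + s * k) x _ _ hf hg)); rewrite mulrC.
Qed.

Lemma derive_translate f x y df : is_derive (x - y) 1 f df ->
  is_derive x 1 (fun s => f (s - y)) df.
Proof.
move=> hf; have hg : is_derive x 1 (fun s => s - y) 1.
  apply: (is_derive_eq (derive_sub (is_derive_id x 1) (is_derive_cst y x 1))).
  by rewrite subr0.
by apply: (is_derive_eq (@is_derive1_comp _ f (fun s => s - y) x _ _ hf hg)); rewrite mulr1.
Qed.

Lemma is_derive_continuous f x df : is_derive x 1 f df -> {for x, continuous f}.
Proof.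
by move=> [dfx _]; apply: differentiable_continuous; apply/derivable1_diffP.
Qed.

Lemma within_is_derive_continuous f (df : R -> R) (A : set R) :
  (forall x, is_derive x 1 f (df x)) -> {within A, continuous f}.
Proof. by move=> hf; apply: continuous_subspaceT => x; exact: is_derive_continuous. Qed.

Lemma within_continuous_add (A : set R) f g : {within A, continuous f} ->
  {within A, continuous g} -> {within A, continuous (fun x => f x + g x)}.
Proof. by move=> cf cg x; exact: (continuousD (cf x) (cg x)). Qed.

Lemma within_continuous_sub (A : set R) f g : {within A, continuous f} ->
  {within A, continuous g} -> {within A, continuous (fun x => f x - g x)}.
Proof. by move=> cf cg x; exact: (continuousB (cf x) (cg x)). Qed.

Lemma within_continuous_mul (A : set R) f g : {within A, continuous f} ->
  {within A, continuous g} -> {within A, continuous (fun x => f x * g x)}.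
Proof. by move=> cf cg x; exact: (continuousM (cf x) (cg x)). Qed.

Lemma within_continuous_cst (A : set R) k : {within A, continuous (fun=> k : R)}.
Proof. by move=> x; exact: cst_continuous. Qed.

Lemma ge0_increment (F dF : R -> R) (a b : R) : a <= b ->
  (forall x, a < x < b -> is_derive x 1 F (dF x)) ->
  (forall x, a < x < b -> 0 <= dF x) ->
  {within `[a, b], continuous F} -> F a <= F b.
Proof.
rewrite le_eqVlt => /predU1P[->//|ab] hF hd cF.
have hF' x : x \in `]a, b[ -> is_derive x 1 F (dF x) by rewrite in_itv/=; exact: hF.
have [c] := MVT ab hF' cF; rewrite in_itv/= => cab hc.
by rewrite -subr_ge0 hc mulr_ge0 ?hd// subr_ge0 ltW.
Qed.

(** Both [G + F] and [G - F] are nondecreasing. A varying majorant [dG], instead of a constant,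
    admits derivatives that are unbounded at an end point. *)
Lemma le_increment (F G dF dG : R -> R) (a b : R) : a <= b ->
  (forall x, a < x < b -> is_derive x 1 F (dF x)) ->
  (forall x, a < x < b -> is_derive x 1 G (dG x)) ->
  (forall x, a < x < b -> `|dF x| <= dG x) ->
  {within `[a, b], continuous F} -> {within `[a, b], continuous G} ->
  `|F b - F a| <= G b - G a.
Proof.
move=> ab hF hG hd cF cG.
have h1 : G a + F a <= G b + F b.
  apply: (@ge0_increment (fun s => G s + F s) (fun s => dG s + dF s)) => //.
  - by move=> x xab; apply: derive_add; [exact: hG|exact: hF].
  - by move=> x /hd; rewrite ler_norml => /andP[+ _]; rewrite -subr_ge0 opprK addrC.
  - by move=> x; apply: continuousD; [exact: cG|exact: cF].
have h2 : G a - F a <= G b - F b.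
  apply: (@ge0_increment (fun s => G s - F s) (fun s => dG s - dF s)) => //.
  - by move=> x xab; apply: derive_sub; [exact: hG|exact: hF].
  - by move=> x /hd; rewrite ler_norml => /andP[_ +]; rewrite -subr_ge0.
  - by move=> x; apply: continuousB; [exact: cG|exact: cF].
by rewrite ler_norml; apply/andP; split; lra.
Qed.

Lemma abs_increment_le (F dF : R -> R) (K a b : R) : a <= b ->
  (forall x, a < x < b -> is_derive x 1 F (dF x)) ->
  (forall x, a < x < b -> `|dF x| <= K) ->
  {within `[a, b], continuous F} -> `|F b - F a| <= K * (b - a).
Proof.
move=> ab hF hd cF.
have hK x : is_derive x 1 (fun s : R => K * s) K.
  by apply: (is_derive_eq (derive_scale K (is_derive_id x 1))); rewrite mulr1.
rewrite mulrBr; apply: (@le_increment F (fun s => K * s) dF (fun=> K)) => //.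
exact: within_is_derive_continuous.
Qed.

End RealDerivatives.

Section FractionalKernel.
Context {R : realType}.
Local Notation mu := (@lebesgue_measure R).
Implicit Types a x s p q : R.

(* Successive antiderivatives of [omega a], extended by [0] to the negative
   half-line. *)
Definition omega1 a x : R := (Gamma a)^-1 / a * pos_pow a x.
Definition omega2 a x : R := (Gamma a)^-1 / a / (a + 1) * pos_pow (a + 1) x.
Definition omega3 a x : R :=
  (Gamma a)^-1 / a / (a + 1) / (a + 2) * pos_pow (a + 2) x.

Lemma Gamma_ge0 a : 0 <= Gamma a.
Proof.
by apply: Rintegral_ge0 => s _; rewrite mulr_ge0// ?powR_ge0// expR_ge0.
Qed.

(* If the integral defining [Gamma a] diverges, then [Gamma a] is [0] and so is
   its inverse. *)
Lemma invGamma_le a : a < 1 -> (Gamma a)^-1 <= expR 1.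
Proof.
move=> a1; pose f (s : R) := s `^ (a - 1) * expR (- s).
have f0 s : 0 <= f s by rewrite mulr_ge0// ?powR_ge0// expR_ge0.
(* On []0, 1[] both factors are bounded below: the power by 1 since [a - 1 <= 0], the exponential by
   [expR (-1)]. *)
have h : ((expR (-1))%:E <= \int[mu]_(s in `]0%R, +oo[) (f s)%:E)%E.
  have -> : (expR (-1))%:E = (\int[mu]_(s in `]0%R, 1%R[) (cst (expR (-1))%:E s))%E.
    rewrite integral_cst//= lebesgue_measure_itv/= lte_fin ltr01.
    by rewrite oppr0 adde0 mule1.
  rewrite integral_mkcond [leRHS]integral_mkcond.
  apply: ge0_le_integral_nonmeasurable => s _.
    by apply: erestrict_ge0 => x _; rewrite lee_fin expR_ge0.
  rewrite !patchE; case: ifPn => [|_]; last by case: ifPn => // _; rewrite lee_fin.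
  rewrite inE/= in_itv/= => /andP[s0 s1].
  rewrite mem_set/= ?in_itv/= ?s0// lee_fin.
  rewrite -[leLHS]mul1r ler_pM ?expR_ge0//.
    have a10 : a - 1 <= 0 by lra.
    by rewrite -[leLHS](powRr0 s) ger_powR// s0 ltW.
  by rewrite ler_expR lerN2 ltW.
rewrite /Gamma /Rintegral -/f; case: (X in fine X) h => [r| |]//=.
- rewrite lee_fin => h; have := expR_gt0 (-1 : R) => e0.
  rewrite -[leRHS]invrK -expRN lef_pV2 ?posrE//.
  exact: lt_le_trans h.
- by rewrite invr0 expR_ge0.
Qed.

Lemma omega_ge0 a x : 0 <= omega a x.
Proof. by rewrite divr_ge0 ?powR_ge0 ?Gamma_ge0. Qed.

Lemma continuous_omega a x : 0 < x -> {for x, continuous (omega a)}.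
Proof.
move=> x0; apply: (@is_derive_continuous _ _ _ ((a - 1) * x `^ (a - 1 - 1) / Gamma a)).
have := @is_derive1_powR _ (a - 1) x x0.
move=> /(derive_scale (Gamma a)^-1) h; rewrite mulrC.
by apply: near_eq_is_derive h; near=> y; rewrite mulrC.
Unshelve. all: by end_near. Qed.

Lemma continuous_omega_reflect a x s : s < x ->
  {for s, continuous (fun s => omega a (x - s))}.
Proof.
move=> sx; have xs0 : 0 < x - s by rewrite subr_gt0.
apply: (@continuous_comp _ _ _ (fun s => x - s) (omega a)).
  by apply: continuousB; [exact: cst_continuous|].
exact: continuous_omega.
Qed.

Section Antiderivatives.
Variable a : R.
Hypothesis a0 : 0 < a.

Let ap1 : 0 < a + 1. Proof. exact: addr_gt0. Qed.
Let ap2 : 0 < a + 2. Proof. exact: addr_gt0. Qed.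

Let c0 : 0 <= (Gamma a)^-1 / a.
Proof. by rewrite divr_ge0 ?invr_ge0 ?Gamma_ge0// ltW. Qed.

Lemma omega1_ge0 x : 0 <= omega1 a x.
Proof. by rewrite mulr_ge0 ?pos_pow_ge0. Qed.

Lemma omega1_homo : {homo omega1 a : x y / x <= y}.
Proof. by move=> x y xy; rewrite ler_wpM2l ?pos_pow_homo. Qed.

Lemma omega1_le0 x : x <= 0 -> omega1 a x = 0.
Proof. by move=> x0; rewrite /omega1 pos_pow_le0// mulr0. Qed.

Lemma omega2_le0 x : x <= 0 -> omega2 a x = 0.
Proof. by move=> x0; rewrite /omega2 pos_pow_le0// mulr0. Qed.

Lemma omega3_le0 x : x <= 0 -> omega3 a x = 0.
Proof. by move=> x0; rewrite /omega3 pos_pow_le0// mulr0. Qed.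

Lemma continuous_omega1 : continuous (omega1 a).
Proof.
by move=> x; apply: (continuousM (@cst_continuous _ _ _ x)); exact: continuous_pos_pow.
Qed.

Lemma is_derive_omega1 x : 0 < x -> is_derive x 1 (omega1 a) (omega a x).
Proof.
move=> x0; apply: (is_derive_eq (derive_scale _ (is_derive_pos_pow_gt0 a x0))).
rewrite /omega; have := gt_eqF a0; set g := (Gamma a)^-1.
by move=> an0; field; rewrite an0.
Qed.

Lemma is_derive_omega2 x : is_derive x 1 (omega2 a) (omega1 a x).
Proof.
have a11 : 1 < a + 1 by rewrite ltrDr.
apply: (is_derive_eq (derive_scale _ (is_derive_pos_pow x a11))).
by rewrite addrK /omega1 mulrA divfK// gt_eqF.
Qed.

Lemma is_derive_omega3 x : is_derive x 1 (omega3 a) (omega2 a x).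
Proof.
have a21 : 1 < a + 2 by rewrite ltr_wpDl// ?ltW// ltr1n.
apply: (is_derive_eq (derive_scale _ (is_derive_pos_pow x a21))).
by rewrite /omega2 mulrA divfK ?gt_eqF// -addrA (_ : 2 - 1 = 1 :> R)//; lra.
Qed.

Lemma omega2_homo : {homo omega2 a : x y / x <= y}.
Proof.
move=> x y xy; apply: (ge0_increment xy (dF := omega1 a)).
- by move=> z _; exact: is_derive_omega2.
- by move=> z _; exact: omega1_ge0.
- exact: within_is_derive_continuous is_derive_omega2.
Qed.

(** This is convexity of [omega2 a], whose derivative [omega1 a] is nondecreasing. It is the source
    of the positivity of the memory weights. *)
Lemma omega2_diff_homo k : 0 <= k ->
  {homo (fun z => omega2 a z - omega2 a (z - k)) : x y / x <= y}.
Proof.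
move=> k0 x y xy.
have d (z : R) := derive_sub (is_derive_omega2 z) (derive_translate (is_derive_omega2 (z - k))).
apply: (ge0_increment xy (dF := fun z => omega1 a z - omega1 a (z - k))).
- by move=> z _; rewrite subr_ge0 omega1_homo// gerBl.
- exact: within_is_derive_continuous d.
Qed.

Lemma omega2_diff_le k x : 0 <= k ->
  0 <= omega2 a x - omega2 a (x - k) <= k * omega1 a x.
Proof.
move=> k0; have xk : x - k <= x by rewrite gerBl.
rewrite subr_ge0 omega2_homo//=.
have := @abs_increment_le _ (omega2 a) (omega1 a) (omega1 a x) _ _ xk.
rewrite subKr mulrC => H; apply: le_trans (ler_norm _) _; apply: H.
- by move=> z _; exact: is_derive_omega2.
- by move=> z /andP[_ zx]; rewrite ger0_norm ?omega1_ge0// omega1_homo// ltW.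
- exact: within_is_derive_continuous is_derive_omega2.
Qed.

(** Replacing X^a by [X], legitimate for [X] at least 1, makes the bound uniform in the exponent up
    to the Gamma factor. *)
Lemma omega1_le x X : a <= 1 -> x <= X -> 1 <= X ->
  omega1 a x <= (Gamma a)^-1 / a * X.
Proof.
move=> a1 xX X1; rewrite ler_wpM2l//; apply: le_trans (pos_pow_homo a0 xX) _.
by rewrite pos_powE ?(le_trans ler01)// -[leRHS]powRr1 ?(le_trans ler01)// ler_powR.
Qed.

Section Cell.
Variables p q x : R.
Hypotheses (pq : p < q) (px : p < x).

Let y := Num.min x q.
Let py : p < y. Proof. by rewrite lt_min px pq. Qed.
Let yx : y <= x. Proof. by rewrite ge_min lexx. Qed.
Let yq : y <= q. Proof. by rewrite ge_min lexx orbT. Qed.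
Let o1E : omega1 a (x - y) = omega1 a (x - q).
Proof.
rewrite /y; case: (leP x q) => // xq.
by rewrite subrr !omega1_le0// subr_le0.
Qed.
Let o2E : omega2 a (x - y) = omega2 a (x - q).
Proof.
rewrite /y; case: (leP x q) => // xq.
by rewrite subrr !omega2_le0// subr_le0.
Qed.

Let sx s : p < s < y -> 0 < x - s.
Proof. by move=> /andP[_ sy]; rewrite subr_gt0 (lt_le_trans sy). Qed.
Let c1 : {within `[p, y], continuous (fun s => omega1 a (x - s))}.
Proof.
apply: continuous_subspaceT => s.
apply: (@continuous_comp _ _ _ (fun s => x - s) (omega1 a)).
  by apply: continuousB; [exact: cst_continuous|].
exact: continuous_omega1.
Qed.
Let d1 s : p < s < y -> is_derive s 1 (fun s => omega1 a (x - s)) (- omega a (x - s)).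
Proof. by move=> /sx s0; apply: derive_reflect; exact: is_derive_omega1. Qed.

(** One formula covers a full cell and a cell cut at [x]: in the second case [omega1 a (x - q)]
    vanishes by truncation. *)
Lemma cell_integral0 : mu.-integrable `[p, Num.min x q] (EFin \o (fun s => omega a (x - s))) /\
  (\int[mu]_(s in `[p, Num.min x q]) omega a (x - s) =
     omega1 a (x - p) - omega1 a (x - q))%R.
Proof.
have d s : p < s < y -> is_derive s 1 (fun s => 0 - omega1 a (x - s)) (omega a (x - s)).
  move=> sy; apply: (is_derive_eq (derive_sub (is_derive_cst 0 s 1) (d1 sy))).
  by rewrite sub0r opprK.
have c s : p < s < y -> {for s, continuous (fun s => omega a (x - s))}.
  by move=> /sx s0; apply: continuous_omega_reflect; rewrite -subr_gt0.
have c' : {within `[p, y], continuous (fun s => 0 - omega1 a (x - s))}.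
  by apply: within_continuous_sub; [exact: within_continuous_cst|exact: c1].
have [] := @FTC_dominated _ _ _ _ _ p y py _ c c d d c' c'.
  by move=> s _; rewrite ger0_norm ?omega_ge0.
by move=> -> ->; split=> //; rewrite !sub0r o1E opprK addrC.
Qed.

(** The integrand may change sign at the midpoint, so integrability comes from the majorant
    [(q - p) * omega a (x - s)]. The antiderivative [F] is an integration by parts. *)
Lemma cell_integral1 :
  mu.-integrable `[p, Num.min x q]
    (EFin \o (fun s => omega a (x - s) * ((p + q) / 2 - s))) /\
  (\int[mu]_(s in `[p, Num.min x q]) (omega a (x - s) * ((p + q) / 2 - s)) =
     (q - p) / 2 * (omega1 a (x - p) + omega1 a (x - q))
     - (omega2 a (x - p) - omega2 a (x - q)))%R.
Proof.
pose F s := omega2 a (x - s) - omega1 a (x - s) * ((p + q) / 2 - s).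
have dl s : is_derive s 1 (fun s : R => (p + q) / 2 - s) (-1).
  apply: (is_derive_eq (derive_sub (is_derive_cst _ s 1) (is_derive_id s 1))).
  by rewrite sub0r.
have cl : continuous (fun s : R => (p + q) / 2 - s).
  by move=> s; exact: is_derive_continuous (dl s).
have dF s : p < s < y -> is_derive s 1 F (omega a (x - s) * ((p + q) / 2 - s)).
  move=> sy; apply: (is_derive_eq (derive_sub
    (derive_reflect (is_derive_omega2 (x - s))) (derive_mul (d1 sy) (dl s)))).
  by ring.
have dG s : p < s < y -> is_derive s 1 (fun s => - (q - p) * omega1 a (x - s))
    ((q - p) * omega a (x - s)).
  move=> sy; apply: (is_derive_eq (derive_scale (- (q - p)) (d1 sy))).
  by rewrite mulrNN.
have c s : p < s < y -> {for s, continuous (fun s => omega a (x - s))}.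
  by move=> /sx s0; apply: continuous_omega_reflect; rewrite -subr_gt0.
have cF : {within `[p, y], continuous F}.
  apply: within_continuous_sub.
    apply: (within_is_derive_continuous (df := fun s => - omega1 a (x - s))) => z.
    by apply: derive_reflect; exact: is_derive_omega2.
  exact: within_continuous_mul c1 (continuous_subspaceT cl).
have cG : {within `[p, y], continuous (fun s => - (q - p) * omega1 a (x - s))}.
  by apply: within_continuous_mul; [exact: within_continuous_cst|exact: c1].
have [] := @FTC_dominated _ _ _ _ _ p y py _ _ _ dF dG cF cG.
- move=> s /andP[ps sy]; have sq : s < q by exact: lt_le_trans yq.
  rewrite normrM ger0_norm ?omega_ge0// mulrC ler_wpM2r ?omega_ge0//.
  by rewrite ler_norml; apply/andP; split; lra.
- by move=> s sy; apply: continuousM; [exact: c|exact: cl].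
- by move=> s sy; apply: continuousM; [exact: cst_continuous|exact: c].
move=> -> ->; split => //; rewrite /F o1E o2E.
have [xq|qx] := leP x q; last first.
  by rewrite /y min_r ?(ltW qx)//; field.
by rewrite (@omega1_le0 (x - q)) ?subr_le0// !mul0r; field.
Qed.

End Cell.

Lemma cell_double_integral p q b c : p < q -> p <= b -> b < c ->
  (\int[mu]_(x in `[b, c]) \int[mu]_(s in `[p, Num.min x q]) omega a (x - s))%R =
    omega2 a (c - p) - omega2 a (b - p) - omega2 a (c - q) + omega2 a (b - q).
Proof.
move=> pq pb bc.
have -> : (\int[mu]_(x in `[b, c]) \int[mu]_(s in `[p, Num.min x q]) omega a (x - s))%R =
    (\int[mu]_(x in `[b, c]) (omega1 a (x - p) - omega1 a (x - q)))%R.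
  apply: eq_Rintegral => x; rewrite inE/= in_itv/= => /andP[bx xc].
  have : p <= x by exact: le_trans bx.
  rewrite le_eqVlt => /predU1P[<-|px]; last exact: (cell_integral0 pq px).2.
  rewrite min_l ?(ltW pq)// set_itv1 Rintegral_set1 subrr.
  by rewrite !omega1_le0 ?subrr// subr_le0 ltW.
have d (x : R) := derive_sub (derive_translate (is_derive_omega2 (x - p)))
  (derive_translate (is_derive_omega2 (x - q))).
rewrite /Rintegral (@ge0_FTC_itv _ _ (fun x => omega2 a (x - p) - omega2 a (x - q)))//=.
- by ring.
- by move=> x _; rewrite subr_ge0 omega1_homo// lerD2l lerN2 ltW.
- have c1' (z : R) : continuous (fun x => omega1 a (x - z)).
    move=> x; apply: (@continuous_comp _ _ _ (fun s => s - z) (omega1 a)).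
      by apply: continuousB; [|exact: cst_continuous].
    exact: continuous_omega1.
  by move=> x _; exact: (continuousB (c1' p x) (c1' q x)).
- exact: within_is_derive_continuous d.
Qed.

End Antiderivatives.
End FractionalKernel.

(** * Inner products and Bochner integrals *)

Section InnerProduct.
Context {R : realType} {H : completeNormedModType R}.
Variable ip : {dot H for idfun}.
Hypothesis ip_norm : hilbert_norm ip.
Implicit Types (x y z psi : H) (k : R).

Lemma ipC x y : ip x y = ip y x.
Proof. by rewrite hermC expr0 mul1r. Qed.

Lemma ipDl x y z : ip (x + y) z = ip x z + ip y z.
Proof. exact: linearDl. Qed.
Lemma ipBl x y z : ip (x - y) z = ip x z - ip y z.
Proof. exact: linearBl. Qed.
Lemma ipZl k x z : ip (k *: x) z = k * ip x z.
Proof. exact: linearZl_LR. Qed.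
Lemma ip0l z : ip 0 z = 0.
Proof. by rewrite -(scale0r (0 : H)) ipZl mul0r. Qed.
Lemma ip_suml (I : Type) (r : seq I) (P : pred I) (E : I -> H) z :
  ip (\sum_(i <- r | P i) E i) z = \sum_(i <- r | P i) ip (E i) z.
Proof. exact: linear_sumlz. Qed.
Lemma ipDr x y z : ip x (y + z) = ip x y + ip x z.
Proof. by rewrite ipC ipDl !(ipC x). Qed.
Lemma ipBr x y z : ip x (y - z) = ip x y - ip x z.
Proof. by rewrite ipC ipBl !(ipC x). Qed.
Lemma ipZr k x y : ip x (k *: y) = k * ip x y.
Proof. by rewrite ipC ipZl ipC. Qed.

Lemma cauchy_schwarz x y : `|ip x y| <= `|x| * `|y|.
Proof.
have [->|y0] := eqVneq y 0; first by rewrite ipC ip0l normr0 normr0 mulr0.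
have n0 : 0 < `|y| ^+ 2 by rewrite exprn_gt0 ?normr_gt0.
rewrite -(@ler_pXn2r _ 2)// ?nnegrE ?mulr_ge0// exprMn.
pose k := ip x y / `|y| ^+ 2.
have := sqr_ge0 `|x - k *: y|.
rewrite -ip_norm ipBl !ipBr !ipZl !ipZr !ip_norm (ipC y x) real_normK ?num_real//.
have -> : `|x| ^+ 2 - k * ip x y - (k * ip x y - k * (k * `|y| ^+ 2)) =
    `|x| ^+ 2 - ip x y ^+ 2 / `|y| ^+ 2 by rewrite /k; field; rewrite normr_eq0.
by rewrite subr_ge0 ler_pdivrMr.
Qed.

Lemma continuous_ip psi : continuous (ip ^~ psi).
Proof.
move=> x; apply/cvgrPdist_le => e e0.
near=> y; rewrite -ipBl; apply: le_trans (cauchy_schwarz _ _) _.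
have p0 : 0 < `|psi| + 1 by rewrite ltr_wpDl.
apply: (@le_trans _ _ (`|x - y| * (`|psi| + 1))); first by rewrite ler_wpM2l// lerDl.
rewrite -ler_pdivlMr//; near: y.
by apply: cvgr_dist_le => //; rewrite divr_gt0.
Unshelve. all: by end_near. Qed.

Lemma is_derive_ip (u : R -> H) (t : R) psi : derivable u t 1 ->
  is_derive t 1 (fun s => ip (u s) psi) (ip (derive1 u t) psi).
Proof.
move=> du.
suff h : h^-1 *: (ip (u (h *: 1 + t)) psi - ip (u t) psi) @[h --> (0 : R)^'] -->
    ip (derive1 u t) psi.
  by apply: DeriveDef; [apply/cvg_ex; exists (ip (derive1 u t) psi)|apply/cvg_lim].
have : h^-1 *: (u (h *: 1 + t) - u t) @[h --> (0 : R)^'] --> derive1 u t.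
  by rewrite derive1E; exact: du.
have -> : (fun h : R => h^-1 *: (ip (u (h *: 1 + t)) psi - ip (u t) psi)) =
    ip ^~ psi \o (fun h : R => h^-1 *: (u (h *: 1 + t) - u t)).
  by apply/funext => h /=; rewrite ipZl ipBl.
move=> du'; exact: continuous_cvg _ (@continuous_ip psi _) du'.
Qed.

(** The choice [psi = x] would give the claim at once, but [x] need not lie in [D]; a nearby [psi]
    is used instead. *)
Lemma norm_le_dense (D : set H) x k : closure D = setT -> 0 <= k ->
  (forall psi, D psi -> ip x psi <= k * `|psi|) -> `|x| <= k.
Proof.
move=> Ddense k0 hD; rewrite leNgt; apply/negP => kx.
have x0 : 0 < `|x| by exact: le_lt_trans kx.
(* With this [e] the perturbation (k + |x|) e is half the gap |x|^2 - k |x|, which contradicts the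
   bound [h2] below. *)
pose e := (`|x| - k) * `|x| / (2 * (k + `|x|)).
have kx0 : 0 < k + `|x| by rewrite ltr_wpDl.
have e0 : 0 < e by rewrite divr_gt0 ?mulr_gt0// subr_gt0.
have : closure D x by rewrite Ddense.
move=> /(_ _ (nbhsx_ballx x e e0)) [psi [Dpsi]].
rewrite -ball_normE/= => xpsi.
have h1 : `|psi| <= `|x| + e.
  have -> : psi = x - (x - psi) by rewrite subKr.
  by apply: le_trans (ler_normB _ _) _; rewrite lerD2l ltW.
have h2 : `|x| ^+ 2 <= k * (`|x| + e) + `|x| * e.
  rewrite -ip_norm -[X in ip x X](subrK psi) addrC ipDr lerD//.
    by apply: le_trans (hD _ Dpsi) _; rewrite ler_wpM2l.
  apply: le_trans (ler_norm _) _; apply: le_trans (cauchy_schwarz _ _) _.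
  by rewrite ler_wpM2l// ltW.
have h3 : (k + `|x|) * e = (`|x| - k) * `|x| / 2.
  by rewrite /e; field; rewrite gt_eqF.
have h4 : 0 < (`|x| - k) * `|x| by rewrite mulr_gt0// subr_gt0.
by move: h2 h3 h4; set X := `|x|; nra.
Qed.

Section BochnerPairing.
Local Notation mu := (@lebesgue_measure R).
Variable D : set R.
Hypothesis mD : measurable (D : set (measurableTypeR R)).

Let step_ip (s : step_fun H) psi (t : R) : R :=
  \sum_(i < npieces s) (\1_(piece i) t : R) * ip (height i) psi.

Let step_ipE s psi t : ip (step_val s t) psi = step_ip s psi t.
Proof. by rewrite ip_suml; apply: eq_bigr => i _; rewrite ipZl. Qed.

Let integrable_piece (s : step_fun H) (i : 'I_(npieces s)) (c : R) :
  mu.-integrable D (EFin \o (fun t => (\1_(piece i) t : R) * c)).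
Proof.
have -> : EFin \o (fun t => (\1_(piece i) t : R) * c) =
    (fun t => c%:E * (EFin \o \1_(piece i)) t)%E.
  by apply/funext => t /=; rewrite -EFinM mulrC.
apply: integrableZl => //; apply/integrableP; split.
  by apply/measurable_EFinP; exact: measurable_indic (piece_measurable i).
under eq_integral do rewrite /= ger0_norm//.
rewrite integral_indic//; last exact: piece_measurable.
apply: le_lt_trans (piece_finite i); apply: le_measure; rewrite ?inE.
- by apply: measurableI => //; exact: piece_measurable.
- exact: piece_measurable.
- exact: subIsetl.
Qed.

Let integrable_step s psi : mu.-integrable D (EFin \o step_ip s psi).
Proof.
have -> : EFin \o step_ip s psi =
    fun t => \sum_(i < npieces s) (EFin \o (fun t => (\1_(piece i) t : R) * ip (height i) psi)) t.
  by apply/funext => t; rewrite /= /step_ip -sumEFin.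
by apply: integrable_sum => // i _; exact: integrable_piece.
Qed.

Let integral_step s psi :
  (\int[mu]_(t in D) (step_ip s psi t)%:E)%E = (ip (step_integral D s) psi)%:E.
Proof.
rewrite /step_ip; under eq_integral do rewrite -sumEFin.
rewrite (@integral_sum _ _ _ mu D mD _
  (fun i t => ((\1_(piece i) t : R) * ip (height i) psi)%:E)); last first.
  by move=> i; exact: integrable_piece.
rewrite ip_suml -sumEFin; apply: eq_bigr => i _.
have i1 : mu.-integrable D (EFin \o \1_(piece i)).
  have := integrable_piece i 1; congr integrable.
  by apply/funext => t /=; rewrite mulr1.
rewrite ipZl; under eq_integral do rewrite mulrC EFinM.
rewrite (integralZl mD i1) integral_indic//; last exact: piece_measurable.
rewrite mulrC EFinM setIC fineK// ge0_fin_numE//.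
apply: le_lt_trans (piece_finite i); apply: le_measure; rewrite ?inE.
- by apply: measurableI => //; exact: piece_measurable.
- exact: piece_measurable.
- exact: subIsetr.
Qed.

(** The step functions defining the Bochner integral, paired with [psi], converge to the paired
    integrand both pointwise, which gives measurability, and in L1, which identifies the limit of
    their integrals. *)
Lemma ip_bochner (F : R -> H) psi : bochner_integrable D F ->
  mu.-integrable D (EFin \o (fun t => ip (F t) psi)) /\
  ip (bochner D F) psi = (\int[mu]_(t in D) ip (F t) psi)%R.
Proof.
move=> /(@xgetPex _ 0 (is_bochner D F)); rewrite -/(bochner D F).
move=> [s [sF s0 sx]].
pose f t := ip (F t) psi; pose fs n t := step_ip (s n) psi t.
have ifs n : mu.-integrable D (EFin \o fs n) by exact: integrable_step.
have mfs n : measurable_fun D (fs n).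
  by apply/measurable_EFinP; exact: measurable_int (ifs n).
have mf : measurable_fun D f.
  apply: (measurable_fun_cvg mfs) => t Dt.
  have h : ip (step_val (s n) t) psi @[n --> \oo] --> f t.
    exact: continuous_cvg _ (@continuous_ip psi _) (sF t Dt).
  by move: h; under eq_fun do rewrite step_ipE.
pose c := `|psi| + 1; have c0 : 0 < c by rewrite ltr_wpDl.
have mB n : measurable_fun D (fun t => f t - fs n t).
  exact: measurable_funB mf (mfs n).
have mfn n : measurable_fun D (EFin \o (fun t => `|f t - fs n t|)).
  by apply/measurable_EFinP/measurableT_comp.
(* The added 1 keeps [c] invertible when [psi] is 0. The constant is factored out on the left, where
   the integrand is measurable, before the two integrals are compared. *)
have dist n : (\int[mu]_(t in D) (`|f t - fs n t|)%:E <=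
    c%:E * \int[mu]_(t in D) (`|F t - step_val (s n) t|)%:E)%E.
  have -> : (\int[mu]_(t in D) (`|f t - fs n t|)%:E =
      c%:E * \int[mu]_(t in D) (c^-1 * `|f t - fs n t|)%:E)%E.
    under [in RHS]eq_integral do rewrite EFinM.
    rewrite ge0_integralZl_EFin//; [|exact: mfn|by rewrite invr_ge0 ltW].
    by rewrite muleA -EFinM divff ?mul1e// gt_eqF.
  rewrite lee_pmul2l ?lte_fin//; apply: ge0_le_integral_nonmeasurable => t Dt.
    by rewrite lee_fin mulr_ge0// invr_ge0 ltW.
  rewrite lee_fin mulrC ler_pdivrMr// /f /fs -step_ipE -ipBl.
  apply: le_trans (cauchy_schwarz _ _) _.
  by rewrite ler_wpM2l// lerDl.
have dist0 : (\int[mu]_(t in D) (`|f t - fs n t|)%:E)%E @[n --> \oo] --> 0%E.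
  apply: (@squeeze_cvge _ _ _ _ (cst 0%E) _
    (fun n => c%:E * \int[mu]_(t in D) (`|F t - step_val (s n) t|)%:E)%E).
  - by near=> n; rewrite dist andbT; apply: integral_ge0 => t _; rewrite lee_fin.
  - exact: cvg_cst.
  - rewrite -[X in _ --> X](mule0 c%:E); apply: cvgeZl => //.
(* A single step function at L1 distance less than 1 is enough for integrability. *)
have if_ : mu.-integrable D (EFin \o f).
  have [n] : exists n, (\int[mu]_(t in D) (`|f t - fs n t|)%:E < 1)%E.
    have /fine_cvgP[fin fcvg] := dist0.
    near \oo => n; exists n.
    have h : (\int[mu]_(t in D) (`|f t - fs n t|)%:E)%E \is a fin_num by near: n.
    rewrite -(fineK h) lte_fin; near: n; apply: (cvgr_lt _ fcvg); exact: ltr01.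
  move=> h; have -> : EFin \o f = (fun t => (EFin \o (fun t => f t - fs n t)%R) t + (EFin \o fs n) t)%E.
    by apply/funext => t /=; rewrite -EFinD subrK.
  apply: integrableD => //; apply/integrableP; split.
    by apply/measurable_EFinP; exact: mB.
  by apply: lt_trans h _; rewrite ltry.
split=> //.
have l1 : ip (step_integral D (s n)) psi @[n --> \oo] --> ip (bochner D F) psi.
  exact: continuous_cvg _ (@continuous_ip psi _) sx.
have l2 : ip (step_integral D (s n)) psi @[n --> \oo] --> (\int[mu]_(t in D) f t)%R.
  apply/cvgrPdist_le => e e0.
  have /fine_cvgP[fin fcvg] := dist0.
  near=> n.
  have -> : ip (step_integral D (s n)) psi = (\int[mu]_(t in D) fs n t)%R.
    by rewrite /Rintegral integral_step.
  rewrite -RintegralB//.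
  apply: le_trans (le_normr_Rintegral _ _) _ => //.
    have -> : EFin \o (fun t => f t - fs n t) = (fun t => (EFin \o f) t - (EFin \o fs n) t)%E.
      by apply/funext => t /=; rewrite -EFinB.
    exact: integrableB.
  by apply: ltW; near: n; apply: (cvgr_lt _ fcvg).
exact: (cvg_unique _ l1 l2).
Unshelve. all: by end_near. Qed.

End BochnerPairing.
End InnerProduct.

(** * Summation by parts and the discrete energy argument *)

Lemma exchange_triangular (T : nmodType) (F : nat -> nat -> T) (m N : nat) :
  \sum_(m <= n < N) \sum_(m <= p < n.+1) F n p =
  \sum_(m <= p < N) \sum_(p <= n < N) F n p.
Proof.
transitivity (\sum_(m <= n < N) \sum_(m <= p < N | (p <= n)%N) F n p).
  apply: eq_big_nat => n /andP[mn nN].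
  by rewrite (big_nat_widen _ _ _ _ _ nN).
rewrite (exchange_big_dep_nat xpredT)//=; apply: eq_big_nat => p /andP[mp pN].
rewrite [RHS](big_nat_widenl _ _ _ _ _ mp).
by [].
Qed.

Section SummationByParts.
Context {R : realType} {V : normedModType R}.

(** Shifting p by one, each difference is the sum of a(n,p) (Z_p - Z_(p-1)) minus the sum of
    (a(n-1,p) - a(n,p+1)) Z_p. The last coefficients are nonnegative by monotonicity along
    diagonals. Hence the norm of the second sum is at most [P n.-1 - P n] plus another copy of the
    bound for the first, and [P] telescopes. *)
Lemma norm_shifted_sum_le (a : nat -> nat -> R) (Z : nat -> V) (N : nat) :
  Z 0%N = 0 ->
  (forall n p, (p <= n <= N)%N -> 0 <= a n p) ->
  (forall n p, (1 <= p)%N -> (p < n <= N)%N -> a n p.+1 <= a n.-1 p) ->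
  \sum_(1 <= n < N.+1)
     `|\sum_(1 <= p < n.+1) a n p *: Z p - \sum_(1 <= p < n) a n.-1 p *: Z p|
    <= 2 * \sum_(1 <= n < N.+1) \sum_(1 <= p < n.+1) a n p * `|Z p - Z p.-1|.
Proof.
move=> Z0 a0 am.
pose P n := \sum_(1 <= p < n.+1) a n p * `|Z p|.
suff step n : (1 <= n < N.+1)%N ->
    `|\sum_(1 <= p < n.+1) a n p *: Z p - \sum_(1 <= p < n) a n.-1 p *: Z p| <=
    2 * (\sum_(1 <= p < n.+1) a n p * `|Z p - Z p.-1|) + (P n.-1 - P n).
  apply: le_trans (ler_sum_nat step) _; rewrite big_split/= -mulr_sumr gerDl.
  have -> : \sum_(1 <= n < N.+1) (P n.-1 - P n) = - (P N - P 0%N).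
    rewrite -(telescope_sumr P (leq0n N)) -sumrN big_add1/=.
    by apply: eq_bigr => i _; rewrite opprB.
  rewrite oppr_le0 /P [X in _ - X]big_geq// subr0 big_nat sumr_ge0// => p /andP[_ pN].
  by rewrite mulr_ge0// a0// leqnn andbT -ltnS.
move=> /andP[n1 nN]; rewrite ltnS in nN.
have nn : n = n.-1.+1 by rewrite prednK.
have aZ : \sum_(1 <= p < n.+1) a n p *: Z p.-1 = \sum_(1 <= p < n) a n p.+1 *: Z p.
  by rewrite big_add1/= nn big_nat_recl//= Z0 scaler0 add0r big_add1 -nn.
have aZn : \sum_(1 <= p < n.+1) a n p * `|Z p.-1| = \sum_(1 <= p < n) a n p.+1 * `|Z p|.
  by rewrite big_add1/= nn big_nat_recl//= Z0 normr0 mulr0 add0r big_add1 -nn.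
have -> : \sum_(1 <= p < n.+1) a n p *: Z p - \sum_(1 <= p < n) a n.-1 p *: Z p =
    \sum_(1 <= p < n.+1) a n p *: (Z p - Z p.-1)
    - \sum_(1 <= p < n) (a n.-1 p - a n p.+1) *: Z p.
  under [in RHS]eq_bigr do rewrite scalerBr.
  under [X in _ = _ - X]eq_bigr do rewrite scalerBl.
  by rewrite !sumrB aZ opprB addrA subrK.
apply: le_trans (ler_normB _ _) _.
have h1 : `|\sum_(1 <= p < n.+1) a n p *: (Z p - Z p.-1)| <=
    \sum_(1 <= p < n.+1) a n p * `|Z p - Z p.-1|.
  apply: le_trans (ler_norm_sum _ _ _) _; apply: ler_sum_nat => p /andP[_ pn].
  by rewrite normrZ ger0_norm// a0// -ltnS pn.
have h2 : `|\sum_(1 <= p < n) (a n.-1 p - a n p.+1) *: Z p| <=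
    P n.-1 - \sum_(1 <= p < n.+1) a n p * `|Z p.-1|.
  rewrite aZn /P -nn -sumrB.
  apply: le_trans (ler_norm_sum _ _ _) _; apply: ler_sum_nat => p /andP[p1 pn].
  by rewrite normrZ -mulrBl ger0_norm// subr_ge0 am// pn.
have h3 : P n - \sum_(1 <= p < n.+1) a n p * `|Z p.-1| <=
    \sum_(1 <= p < n.+1) a n p * `|Z p - Z p.-1|.
  rewrite /P -sumrB; apply: ler_sum_nat => p /andP[_ pn].
  by rewrite -mulrBr ler_wpM2l ?lerB_dist// a0// -ltnS pn.
lra.
Qed.

End SummationByParts.

Section WeightedEnergy.
Context {R : realType}.

Lemma nat_argmax (f : nat -> R) (N : nat) :
  exists2 M, (M <= N)%N & forall n, (n <= N)%N -> f n <= f M.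
Proof.
elim: N => [|N [M MN hM]]; first by exists 0%N => // n; rewrite leqn0 => /eqP->.
have [h|h] := leP (f N.+1) (f M).
  exists M; first exact: leqW.
  by move=> n; rewrite leq_eqVlt => /predU1P[->//|]; rewrite ltnS; exact: hM.
exists N.+1 => // n; rewrite leq_eqVlt => /predU1P[->//|]; rewrite ltnS => /hM.
by move=> h'; exact: le_trans (ltW h).
Qed.

(** Induction step of [main] below, freed of its sums: [m] is the weight at the new level, [x1] and
    [x2] the squares of the new and old errors [e1] and [e2], [k] stands for kappa tau_n, [q] for
    the dissipation, [s] for the memory, [r] for the residual; [A], [B], [C] are the accumulated
    sums of these three. *)
Let step_arith (m g' x1 x2 e1 e2 k A B C Y s q r : R) :
  (1 + k) * m * x2 <= g' * x2 ->
  m * ((x1 - x2) / 2 + q) <= m * (s + k * ((x1 + x2) / 2) + r * ((e1 + e2) / 2)) ->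
  g' * x2 / 2 + A <= B + Y * C -> m * e1 * r <= Y * r -> m * e2 * r <= Y * r ->
  (1 - k) * m * x1 / 2 + (A + m * q) <= B + m * s + Y * (C + r).
Proof. by move=> h1 h2 h3 h4 h5; lra. Qed.

(* The factor [1 - kappa tau_n] carries the sum by parts of the weighted
   squares from one step to the next; at the first step there is nothing to
   carry since the scheme starts with backward Euler. *)
Lemma weighted_energy (N : nat) (t : nat -> R) (K : nat -> nat -> R)
    (E a r : nat -> R) (kappa lam : R) :
  0 <= kappa -> 2 * kappa <= lam ->
  t 0%N = 0 -> (forall n, (n < N)%N -> t n < t n.+1) ->
  (forall n, (2 <= n < N)%N -> tau t n <= tau t n.+1) ->
  (forall n, (1 <= n <= N)%N -> kappa * tau t n <= 2^-1) ->
  (forall n p, (1 <= p <= n)%N -> (n <= N)%N -> 0 <= K n p) ->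
  (forall n, (1 <= n <= N)%N ->
     \sum_(1 <= p < n.+1) K n p * expR (- lam * (t n - t p)) <= tau t n) ->
  (forall p, (1 <= p <= N)%N ->
     \sum_(p <= n < N.+1) K n p * expR (- lam * (t n - t p)) <= tau t p) ->
  (forall n, 0 <= E n) -> (forall n, 0 <= r n) -> E 0%N = 0 ->
  ((1 <= N)%N -> E 1%N ^+ 2 + tau t 1 * a 1%N ^+ 2 <=
     K 1%N 1%N * (a 1%N * a 1%N) + kappa * tau t 1 * E 1%N ^+ 2 + r 1%N * E 1%N) ->
  (forall n, (2 <= n <= N)%N ->
     (E n ^+ 2 - E n.-1 ^+ 2) / 2 + tau t n * a n ^+ 2 <=
     \sum_(1 <= p < n.+1) K n p * (a p * a n)
     + kappa * tau t n * ((E n ^+ 2 + E n.-1 ^+ 2) / 2)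
     + r n * ((E n + E n.-1) / 2)) ->
  forall n, (n <= N)%N ->
    E n <= 4 * expR (lam * t N) * \sum_(1 <= i < N.+1) r i.
Proof.
move=> kap0 klam t0 tinc kinc ktau K0 rowK colK E0 r0 E00 en1 en.
have lam0 : 0 <= lam by apply: le_trans klam; rewrite mulr_ge0.
have tle i j : (i <= j <= N)%N -> t i <= t j.
  move=> /andP[ij jN]; elim: j ij jN => [|j IH]; first by rewrite leqn0 => /eqP->.
  rewrite leq_eqVlt => /predU1P[->//|]; rewrite ltnS => ij jN.
  by rewrite (le_trans (IH ij (ltnW jN)))// ltW// tinc.
have t_ge0 i : (i <= N)%N -> 0 <= t i by move=> iN; rewrite -t0 tle.
pose w n := expR (- lam * t n).
have w0 n : 0 < w n by exact: expR_gt0.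
have w1 n : (n <= N)%N -> w n <= 1.
  by move=> nN; rewrite -expR0 ler_expR mulNr oppr_le0 mulr_ge0// t_ge0.
(* At the largest weighted error [Y], one factor of every product of residual and error is replaced
   by [Y]; the estimate becomes Y^2 at most a multiple of Y times the residual sum. *)
have [M MN] := nat_argmax (fun n => w n * E n) N.
pose Y := w M * E M; rewrite -/Y => Ymax.
have Y0 : 0 <= Y by rewrite mulr_ge0// ltW.
pose S := \sum_(1 <= i < N.+1) r i.
have tau0 n : (1 <= n <= N)%N -> 0 < tau t n.
  by case: n => // n nN; rewrite subr_gt0 tinc.
(* At the first step kappa tau_1, being at most 1/2, absorbs half of the square of the error. What
   remains has coefficient 1/2, that is, [g 1 = 1]. *)
pose g n := if (n <= 1)%N then 1 else 1 - kappa * tau t n.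
(* With x = kappa tau_n at most 1/2 and L = lam tau_n at least 2x, one has (1 - x)(1 + 2L) >= 1 + x.
   Monotone steps give [g n.-1 >= 1 - x], and the weight ratio supplies exp(2L) >= 1 + 2L. *)
have gstep n : (2 <= n <= N)%N ->
    (1 + kappa * tau t n) * w n ^+ 2 <= g n.-1 * w n.-1 ^+ 2.
  move=> /andP[n2 nN]; have n1 : (1 <= n <= N)%N by rewrite nN (ltnW n2).
  have -> : w n.-1 = w n * expR (lam * tau t n).
    by rewrite /w -expRD /tau; congr expR; ring.
  have -> : g n.-1 * (w n * expR (lam * tau t n)) ^+ 2 =
      g n.-1 * expR (lam * tau t n) ^+ 2 * w n ^+ 2 by ring.
  rewrite ler_wpM2r ?exprn_ge0 ?(ltW (w0 _))//.
  rewrite -expRM_natl.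
  have tn0 := tau0 n n1; have tn2 := ktau n n1.
  have e1 := expR_ge1Dx (2 * (lam * tau t n)).
  have e2 : 2 * kappa * tau t n <= lam * tau t n by rewrite ler_pM2r.
  have kt0 : 0 <= kappa * tau t n by rewrite mulr_ge0// ltW.
  have g1 : 1 - kappa * tau t n <= g n.-1.
    rewrite /g; case: leqP => n'1; first by rewrite gerBl.
    rewrite lerD2l lerN2 ler_wpM2l//.
    have := kinc n.-1; rewrite prednK ?(ltnW n2)//; apply.
    by rewrite n'1.
  have h1 : 0 <= (1 - kappa * tau t n) * (lam * tau t n - 2 * kappa * tau t n).
    by apply: mulr_ge0; lra.
  have h2 : 0 <= kappa * tau t n * (1 - 2 * (kappa * tau t n)).
    by apply: mulr_ge0; lra.
  have p1 : 0 <= 1 - kappa * tau t n by lra.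
  have p2 : 0 <= 1 + 2 * (lam * tau t n) by lra.
  apply: le_trans (ler_pM p1 p2 g1 e1); lra.
pose m2 n := w n ^+ 2.
have m20 n : 0 <= m2 n by exact: sqr_ge0.
have main n : (1 <= n <= N)%N ->
    g n * m2 n * E n ^+ 2 / 2 + \sum_(1 <= i < n.+1) tau t i * (m2 i * a i ^+ 2) <=
    \sum_(1 <= i < n.+1) \sum_(1 <= p < i.+1) m2 i * (K i p * (a p * a i))
    + Y * \sum_(1 <= i < n.+1) r i.
  case: n => // n; elim: n => [N1|n IH nN].
    have := en1 N1; rewrite !big_nat1 /g/= mul1r.
    have h2 := ktau 1%N N1.
    have h3 : m2 1%N * E 1%N <= Y.
      rewrite /m2 expr2 -mulrA; apply: le_trans (Ymax _ N1).
      by rewrite ler_piMl ?w1// mulr_ge0// ltW.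
    move=> /(ler_wpM2l (m20 1%N)) h1.
    have h4 := ler_wpM2r (r0 1%N) h3.
    have h5 : kappa * tau t 1 * (m2 1%N * E 1%N ^+ 2) <= 2^-1 * (m2 1%N * E 1%N ^+ 2).
      by rewrite ler_wpM2r// mulr_ge0// sqr_ge0.
    lra.
  have n2N : (2 <= n.+2 <= N)%N by [].
  have nNb : (n.+2 <= N)%N by [].
  have nN' : (n.+1 <= N)%N by exact: ltnW.
  have recr (F : nat -> R) : \sum_(1 <= i < n.+3) F i = \sum_(1 <= i < n.+2) F i + F n.+2.
    exact: big_nat_recr.
  have := IH nN'; rewrite (recr (fun i => tau t i * (m2 i * a i ^+ 2))) (recr r).
  rewrite (recr (fun i => \sum_(1 <= p < i.+1) m2 i * (K i p * (a p * a i)))).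
  have := en n.+2 n2N; have := gstep n.+2 n2N; rewrite /= -/(m2 n.+2) -/(m2 n.+1).
  have -> : \sum_(1 <= p < n.+3) m2 n.+2 * (K n.+2 p * (a p * a n.+2)) =
      m2 n.+2 * \sum_(1 <= p < n.+3) K n.+2 p * (a p * a n.+2) by rewrite mulr_sumr.
  set E1 := E n.+2; set E2 := E n.+1; set s1 := \sum_(1 <= p < n.+3) K _ _ * _.
  set A := \sum_(1 <= p < n.+2) tau _ _ * _; set B := \sum_(1 <= p < _) \sum_(1 <= q < _) _.
  set C := \sum_(1 <= p < _) _.
  move=> hg /(ler_wpM2l (m20 n.+2)) h1 h2.
  have := ler_wpM2r (sqr_ge0 E2) hg.
  have y1 : m2 n.+2 * E1 <= Y.
    rewrite /m2 expr2 -mulrA; apply: le_trans (Ymax _ nN).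
    exact: ler_piMl (mulr_ge0 (ltW (w0 _)) (E0 _)) (w1 _ nNb).
  have y2 : m2 n.+2 * E2 <= Y.
    rewrite /m2 expr2 -mulrA; apply: le_trans (Ymax _ nN').
    apply: (@le_trans _ _ (w n.+2 * E2)).
      exact: ler_piMl (mulr_ge0 (ltW (w0 _)) (E0 _)) (w1 _ nNb).
    apply: (ler_wpM2r (E0 n.+1)).
    by rewrite /w ler_expR !mulNr lerN2 ler_wpM2l// tle// leqnSn.
  move=> h3; rewrite [tau t n.+2 * (m2 _ * _)]mulrCA.
  exact: step_arith h3 h1 h2 (ler_wpM2r (r0 n.+2) y1) (ler_wpM2r (r0 n.+2) y2).
(* Schur test for the symmetrised kernel [K i p * e i p] acting on [w i * a i]: Young's inequality
   splits each product, the row sums control one half and the column sums the other. *)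
have memory n : (n <= N)%N ->
    \sum_(1 <= i < n.+1) \sum_(1 <= p < i.+1) m2 i * (K i p * (a p * a i)) <=
    \sum_(1 <= i < n.+1) tau t i * (m2 i * a i ^+ 2).
  move=> nN; pose e i p := expR (- lam * (t i - t p)).
  have wE i p : w i = e i p * w p by rewrite /w /e -expRD; congr expR; ring.
  have step i p : (1 <= p <= i)%N -> (i <= N)%N -> m2 i * (K i p * (a p * a i)) <=
      K i p * e i p * (m2 i * a i ^+ 2) / 2 + K i p * e i p * (m2 p * a p ^+ 2) / 2.
    move=> pi iN; have Ke0 : 0 <= K i p * e i p by rewrite mulr_ge0 ?K0// expR_ge0.
    have := mulr_ge0 Ke0 (sqr_ge0 (w i * a i - w p * a p)).
    rewrite /m2 [w i ^+ 2 * (_ * _)](_ : _ = K i p * e i p * ((w i * a i) * (w p * a p))).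
      by lra.
    by rewrite expr2 {1}(wE i p); ring.
  apply: (@le_trans _ _ (\sum_(1 <= i < n.+1) \sum_(1 <= p < i.+1)
     (K i p * e i p * (m2 i * a i ^+ 2) / 2 + K i p * e i p * (m2 p * a p ^+ 2) / 2))).
    apply: ler_sum_nat => i /andP[_ iN]; apply: ler_sum_nat => p /andP[p1 pi].
    rewrite ltnS in iN; rewrite ltnS in pi.
    by apply: step; rewrite ?p1// (leq_trans iN).
  under eq_bigr do rewrite big_split/=.
  rewrite big_split/= (exchange_triangular (fun i p => K i p * e i p * (m2 p * a p ^+ 2) / 2)).
  rewrite -big_split/=; apply: ler_sum_nat => i /andP[i1]; rewrite ltnS => iN.
  have iNN : (1 <= i <= N)%N by rewrite i1 (leq_trans iN).
  have ma0 : 0 <= m2 i * a i ^+ 2 by exact: mulr_ge0 (m20 _) (sqr_ge0 _).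
  have h1 : \sum_(1 <= p < i.+1) K i p * e i p * (m2 i * a i ^+ 2) / 2 <=
      tau t i * (m2 i * a i ^+ 2) / 2.
    rewrite -!mulr_suml; apply: ler_wpM2r => //; apply: ler_wpM2r => //.
    exact: rowK iNN.
  have h2 : \sum_(i <= p < n.+1) K p i * e p i * (m2 i * a i ^+ 2) / 2 <=
      tau t i * (m2 i * a i ^+ 2) / 2.
    rewrite -!mulr_suml; apply: ler_wpM2r => //; apply: ler_wpM2r => //.
    apply: le_trans (colK i iNN).
    rewrite [leRHS](@big_cat_nat _ _ _ n.+1)//= ?leqW// lerDl.
    rewrite big_nat sumr_ge0// => p /andP[np]; rewrite ltnS => pN.
    by rewrite mulr_ge0 ?expR_ge0// K0// i1 (leq_trans iN)// ltnW.
  by apply: le_trans (lerD h1 h2) _; rewrite -splitr.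
have Yle : Y <= 4 * S.
  have S0 : 0 <= S by rewrite /S big_nat sumr_ge0.
  have [M0|M1] := posnP M.
    by rewrite /Y M0 E00 mulr0 mulr_ge0.
  have M1N : (1 <= M <= N)%N by rewrite M1.
  have := main M M1N; have := memory M MN.
  (* Together with the factor 1/2 in [main] this leaves Y^2 / 4 on the left, whence the constant
     4. *)
  have gM : 2^-1 <= g M by rewrite /g; have := ktau M M1N; case: ifP => _; lra.
  have := ler_wpM2r (sqr_ge0 Y) gM.
  have -> : g M * m2 M * E M ^+ 2 = g M * Y ^+ 2 by rewrite /Y /m2; ring.
  have rS : \sum_(1 <= i < M.+1) r i <= S.
    rewrite /S [leRHS](@big_cat_nat _ _ _ M.+1)//= lerDl.
    by rewrite big_nat sumr_ge0.
  have := ler_wpM2l Y0 rS.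
  move: (\sum_(1 <= i < M.+1) r i) rS (\sum_(1 <= i < M.+1) _) (\sum_(1 <= i < M.+1) _).
  move=> Q rS T1 T2 h1 h2 h3 h4.
  have : Y * Y <= Y * (4 * S) by move: h2; rewrite expr2; lra.
  have [->|Yn0] := eqVneq Y 0; first by rewrite mulr_ge0.
  by rewrite ler_pM2l// lt_def Yn0.
move=> n nN.
have -> : E n = expR (lam * t n) * (w n * E n).
  by rewrite mulrA /w -expRD mulNr subrr expR0 mul1r.
have -> : 4 * expR (lam * t N) * \sum_(1 <= i < N.+1) r i = expR (lam * t N) * (4 * S).
  by rewrite /S; ring.
rewrite ler_pM ?expR_ge0//.
- by rewrite mulr_ge0// ltW.
- by rewrite ler_expR ler_wpM2l// tle// nN leqnn.
- exact: le_trans (Ymax _ nN) Yle.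
Qed.

End WeightedEnergy.

(** * Peano coefficients and memory weights *)

Section KernelWeights.
Context {R : realType}.
Local Notation mu := (@lebesgue_measure R).
Variable a : R.
Hypotheses (a0 : 0 < a) (a1 : a < 1).
Implicit Types d k s u x : R.

Lemma omega_nincr x y : 0 < x -> x <= y -> omega a y <= omega a x.
Proof.
move=> x0 xy; rewrite /omega ler_wpM2r ?invr_ge0 ?Gamma_ge0//.
have y0 : 0 < y by exact: lt_le_trans xy.
have -> : a - 1 = - (1 - a) by rewrite opprB.
rewrite !powRN lef_pV2 ?posrE ?powR_gt0// ge0_ler_powR// ?nnegrE ?ltW// subr_gt0//.
Qed.

Lemma omega1_increment_ge d k : 0 < k -> k <= d ->
  k * omega a d <= omega1 a d - omega1 a (d - k).
Proof.
move=> k0 kd; have dk : d - k < d by rewrite gtrBl.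
have hd x : x \in `](d - k), d[ -> is_derive x 1 (omega1 a) (omega a x).
  rewrite in_itv/= => /andP[c1 _]; apply: is_derive_omega1 => //.
  by apply: le_lt_trans c1; rewrite subr_ge0.
have [c] := MVT dk hd (continuous_subspaceT (continuous_omega1 a0)).
rewrite in_itv/= => /andP[c1 c2] ->; rewrite subKr mulrC ler_wpM2r ?(ltW k0)//.
by apply: omega_nincr; [apply: le_lt_trans c1; rewrite subr_ge0|exact: ltW].
Qed.

(* Peano kernel coefficient of the trapezoidal rule for [omega2] on
   [d, d + k]. *)
Definition peano_coef d k : R :=
  (\int[mu]_(u in `[0%R, 1%R]) (omega a (d + u * k) * (u * (1 - u) / 2)))%R.

Section PeanoCoef.
Variables d k : R.
Hypotheses (d0 : 0 <= d) (k0 : 0 < k).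

Let duk u : 0 < u -> 0 < d + u * k.
Proof. by move=> u0; rewrite ltr_wpDl// mulr_gt0. Qed.

Let cw u : 0 < u -> {for u, continuous (fun u => omega a (d + u * k))}.
Proof.
move=> u0; apply: (@continuous_comp _ _ _ (fun u => d + u * k) (omega a)).
  have := derive_affine (is_derive_id (d + u * k) (1 : R)).
  exact: is_derive_continuous.
exact: continuous_omega (duk u0).
Qed.

Let dpoly u : is_derive u 1 (fun u : R => u * (1 - u) / 2) (2^-1 - u).
Proof.
have h1 := derive_sub (is_derive_cst (1 : R) u 1) (is_derive_id u (1 : R)).
have h2 := derive_mul (is_derive_id u (1 : R)) h1.
have h3 := derive_mul h2 (is_derive_cst (2^-1 : R) u 1).
by apply: (is_derive_eq h3); rewrite /cst; field.
Qed.

Let cpoly : continuous (fun u : R => u * (1 - u) / 2).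
Proof. by move=> u; exact: is_derive_continuous (dpoly u). Qed.

Let dG u : 0 < u -> is_derive u 1 (fun u => k^-1 * omega1 a (d + u * k)) (omega a (d + u * k)).
Proof.
move=> u0; have h := derive_affine (is_derive_omega1 a0 (duk u0)).
by apply: (is_derive_eq (derive_scale k^-1 h)); rewrite mulKf ?gt_eqF.
Qed.

Let caff (f : R -> R) (A : set R) : continuous f ->
  {within A, continuous (fun u => f (d + u * k))}.
Proof.
move=> cf; apply: continuous_subspaceT => u.
apply: (@continuous_comp _ _ _ (fun u => d + u * k) f); last exact: cf.
exact: is_derive_continuous (derive_affine (is_derive_id (d + u * k) (1 : R))).
Qed.

Let cG : {within `[0, 1], continuous (fun u => k^-1 * omega1 a (d + u * k))}.
Proof.
apply: within_continuous_mul; first exact: within_continuous_cst.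
exact: caff (continuous_omega1 a0).
Qed.

(** Two integrations by parts: the weight u (1 - u) / 2 has derivatives 1/2 - u and -1, and each
    antiderivative of the kernel costs a factor 1/k. *)
Let F u := k^-1 * (u * (1 - u) / 2 * omega1 a (d + u * k))
  - k^-1 ^+ 2 * ((2^-1 - u) * omega2 a (d + u * k)) - k^-1 ^+ 3 * omega3 a (d + u * k).

Let dF u : 0 < u -> is_derive u 1 F (omega a (d + u * k) * (u * (1 - u) / 2)).
Proof.
move=> u0; have kn0 : k != 0 by rewrite gt_eqF.
have h1 := derive_scale k^-1 (derive_mul (dpoly u) (derive_affine (is_derive_omega1 a0 (duk u0)))).
have l := derive_sub (is_derive_cst (2^-1 : R) u 1) (is_derive_id u (1 : R)).
have h2 := derive_scale (k^-1 ^+ 2) (derive_mul l (derive_affine (is_derive_omega2 a0 (d + u * k)))).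
have h3 := derive_scale (k^-1 ^+ 3) (derive_affine (is_derive_omega3 a0 (d + u * k))).
by apply: (is_derive_eq (derive_sub (derive_sub h1 h2) h3)); rewrite /cst; field.
Qed.

Let cF : {within `[0, 1], continuous F}.
Proof.
have c2 : continuous (omega2 a) by move=> x; exact: is_derive_continuous (is_derive_omega2 a0 x).
have c3 : continuous (omega3 a) by move=> x; exact: is_derive_continuous (is_derive_omega3 a0 x).
have cl : continuous (fun u : R => 2^-1 - u).
  by move=> u; exact: is_derive_continuous
    (derive_sub (is_derive_cst (2^-1 : R) u 1) (is_derive_id u (1 : R))).
apply: within_continuous_sub; first apply: within_continuous_sub.
- apply: within_continuous_mul; first exact: within_continuous_cst.
  apply: within_continuous_mul; first exact: continuous_subspaceT cpoly.
  exact: caff (continuous_omega1 a0).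
- apply: within_continuous_mul; first exact: within_continuous_cst.
  by apply: within_continuous_mul; [exact: continuous_subspaceT cl|exact: caff].
- by apply: within_continuous_mul; [exact: within_continuous_cst|exact: caff].
Qed.

Let poly_bound u : 0 <= u <= 1 -> 0 <= u * (1 - u) / 2 <= 1.
Proof. by move=> /andP[u0 u1]; apply/andP; split; nra. Qed.

Let FTC : mu.-integrable `[0, 1] (EFin \o (fun u => omega a (d + u * k) * (u * (1 - u) / 2))) /\
  peano_coef d k = F 1 - F 0.
Proof.
apply: (@FTC_dominated _ _ _ (fun u => omega a (d + u * k))
  (fun u => k^-1 * omega1 a (d + u * k)) 0 1 ltr01).
- move=> u /andP[u0 u1]; have /andP[p0 p1] : 0 <= u * (1 - u) / 2 <= 1.
    by apply: poly_bound; rewrite !ltW.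
  by rewrite normrM !ger0_norm ?omega_ge0// ler_piMr ?omega_ge0.
- by move=> u /andP[u0 u1]; exact: (continuousM (cw u0) (@cpoly u)).
- by move=> u /andP[u0 u1]; exact: cw.
- by move=> u /andP[u0 _]; exact: dF.
- by move=> u /andP[u0 _]; exact: dG.
- exact: cF.
- exact: cG.
Qed.

Lemma integrable_peano :
  mu.-integrable `[0, 1] (EFin \o (fun u => omega a (d + u * k) * (u * (1 - u) / 2))).
Proof. exact: FTC.1. Qed.

Lemma peano_coefE : k ^+ 3 * peano_coef d k =
  k / 2 * (omega2 a d + omega2 a (d + k)) - (omega3 a (d + k) - omega3 a d).
Proof.
have e1 : d + 1 * k = d + k by rewrite mul1r.
have e0 : d + 0 * k = d by rewrite mul0r addr0.
by rewrite FTC.2 /F e1 e0; field; exact: lt0r_neq0.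
Qed.

Lemma peano_coef_ge0 : 0 <= peano_coef d k.
Proof.
apply: Rintegral_ge0 => u; rewrite /= in_itv/= => /poly_bound/andP[p0 _].
by rewrite mulr_ge0 ?omega_ge0.
Qed.

(** Bounding the polynomial weight by 1 leaves the integral of the kernel. Used for the diagonal
    cell, where [d] is 0 and the kernel is unbounded. *)
Lemma peano_coef_le_omega1 : k * peano_coef d k <= omega1 a (d + k) - omega1 a d.
Proof.
have b u : 0 < u < 1 -> `|omega a (d + u * k)| <= omega a (d + u * k).
  by move=> _; rewrite ger0_norm ?omega_ge0.
have c u : 0 < u < 1 -> {for u, continuous (fun u => omega a (d + u * k))}.
  by move=> /andP[u0 _]; exact: cw.
have e u : 0 < u < 1 ->
    is_derive u 1 (fun u => k^-1 * omega1 a (d + u * k)) (omega a (d + u * k)).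
  by move=> /andP[u0 _]; exact: dG.
have [iG eG] := FTC_dominated ltr01 b c c e e cG cG.
have -> : omega1 a (d + k) - omega1 a d =
    k * (\int[mu]_(u in `[0%R, 1%R]) omega a (d + u * k))%R.
  by rewrite eG mul1r mul0r addr0 mulrBr !mulVKf// gt_eqF.
rewrite ler_pM2l//; apply: le_Rintegral; [by []|exact: integrable_peano|exact: iG|].
move=> u /=; rewrite in_itv/= => /poly_bound/andP[p0 p1].
by rewrite ler_piMr ?omega_ge0.
Qed.

End PeanoCoef.

(** For [a < 1] the kernel decreases, so a larger distance and a larger step both lower the
    integrand. At [u = 0] the kernel may be singular but the polynomial weight is 0. *)
Lemma peano_coef_nincr d d' k k' : 0 <= d' -> 0 < k' -> d' <= d -> k' <= k ->
  peano_coef d k <= peano_coef d' k'.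
Proof.
move=> d'0 k'0 dd kk.
have d0 : 0 <= d by exact: le_trans dd.
have k0 : 0 < k by exact: lt_le_trans kk.
apply: le_Rintegral => //; [exact: integrable_peano|exact: integrable_peano|].
move=> u /=; rewrite in_itv/= => /andP[]; rewrite le_eqVlt => /predU1P[<- _|u0 u1].
  by rewrite !mul0r !mulr0.
have p0 : 0 <= u * (1 - u) / 2 by nra.
rewrite ler_wpM2r//; apply: omega_nincr; first by rewrite ltr_wpDl// mulr_gt0.
by rewrite lerD// ler_wpM2l// ltW.
Qed.

(** Away from the diagonal the coefficient is at most [omega a d], which is bounded by the mean of
    the kernel over the preceding step [k']. The right-hand sides then telescope along a column. *)
Lemma peano_coef_le_increment d k k' : 0 < k -> k <= k' -> k' <= d ->
  k * peano_coef d k <= omega1 a d - omega1 a (d - k').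
Proof.
move=> k0 kk kd; have d0 : 0 < d by apply: lt_le_trans kd; exact: lt_le_trans kk.
have k'0 : 0 < k' by exact: lt_le_trans kk.
apply: le_trans (omega1_increment_ge k'0 kd).
apply: (@le_trans _ _ (k * omega a d)).
  rewrite ler_pM2l//; apply: (@le_trans _ _ (\int[mu]_(u in `[0%R, 1%R]) omega a d)%R).
    apply: le_Rintegral => //; first by apply: integrable_peano => //; exact: ltW.
      by apply: continuous_compact_integrable; [exact: segment_compact|
        exact: continuous_subspaceT (@cst_continuous _ _ _)].
    move=> u /=; rewrite in_itv/= => /andP[u0 u1].
    have p0 : 0 <= u * (1 - u) / 2 by nra.
    have p1 : u * (1 - u) / 2 <= 1 by nra.
    apply: (@le_trans _ _ (omega a (d + u * k))); first by rewrite ler_piMr ?omega_ge0.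
    by apply: omega_nincr => //; rewrite lerDl mulr_ge0// ltW.
  by rewrite Rintegral_cst//= lebesgue_measure_itv/= lte_fin ltr01 oppr0 adde0 mulr1.
by rewrite ler_wpM2r ?omega_ge0.
Qed.

End KernelWeights.

(** * Memory weights on a nonuniform mesh and their row and column sums *)

Section MeshWeights.
Context {R : realType}.
Local Notation mu := (@lebesgue_measure R).
Variables (T : R) (N : nat) (t : nat -> R).
Hypothesis tl : time_levels T N t.

Lemma time_level0 : t 0%N = 0. Proof. by case: tl. Qed.

Lemma time_level_last : t N = T. Proof. by case: tl. Qed.

Lemma time_level_le i j : (i <= j <= N)%N -> t i <= t j.
Proof.
case: tl => _ _ _ tinc /andP[ij jN].
elim: j ij jN => [|j IH]; first by rewrite leqn0 => /eqP->.
rewrite leq_eqVlt => /predU1P[->//|]; rewrite ltnS => ij jN.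
by rewrite (le_trans (IH ij (ltnW jN)))// ltW// tinc.
Qed.

Lemma time_level_ge0 i : (i <= N)%N -> 0 <= t i.
Proof. by move=> iN; rewrite -time_level0 time_level_le. Qed.

Lemma tau_gt0 n : (1 <= n <= N)%N -> 0 < tau t n.
Proof. by case: tl => _ _ _ tinc; case: n => // n nN; rewrite subr_gt0 tinc. Qed.

Lemma time_level_lt n : (1 <= n <= N)%N -> t n.-1 < t n.
Proof. by move=> /tau_gt0; rewrite subr_gt0. Qed.

Lemma time_level_gt0 n : (1 <= n <= N)%N -> 0 < t n.
Proof.
move=> n1; apply: le_lt_trans (time_level_lt n1); apply: time_level_ge0.
by case/andP: n1 => n1; case: n n1 => // n _; exact: ltnW.
Qed.

Lemma time_level_pred n : t n.-1 = t n - tau t n.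
Proof. by rewrite /tau subKr. Qed.

Section Weights.
Variable a : R.
Hypothesis a0 : 0 < a.

(** The double integral of the kernel over cells [n] and [p], restricted to past times. It is the
    natural quantity once the scheme is multiplied by [tau t n]. *)
Definition cell_weight n p : R :=
  omega2 a (t n - t p.-1) - omega2 a (t n.-1 - t p.-1)
  - omega2 a (t n - t p) + omega2 a (t n.-1 - t p).

Lemma weightE n p : (1 <= p <= n)%N -> (n <= N)%N ->
  weight a t n p * tau t p = (tau t n)^-1 * cell_weight n p.
Proof.
move=> /andP[p1 pn] nN.
have p1N : (1 <= p <= N)%N by rewrite p1 (leq_trans pn).
have n1N : (1 <= n <= N)%N by rewrite (leq_trans p1 pn).
have [tp tn] := (tau_gt0 p1N, tau_gt0 n1N).
rewrite /weight cell_double_integral ?time_level_lt//; last first.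
  apply: time_level_le; rewrite -!subn1 leq_sub2r//=.
  by rewrite (leq_trans _ nN)// leq_subr.
by rewrite -/(cell_weight n p); field; rewrite !gt_eqF.
Qed.

(** This grouping telescopes in [p] for fixed [n]; that of [cell_weight_col] telescopes in [n] for
    fixed [p]. *)
Lemma cell_weight_row n p : cell_weight n p =
  (omega2 a (t n - t p.-1) - omega2 a (t n - t p.-1 - tau t n))
  - (omega2 a (t n - t p) - omega2 a (t n - t p - tau t n)).
Proof.
rewrite /cell_weight (time_level_pred n).
by rewrite [t n - tau t n - t p.-1]addrAC [t n - tau t n - t p]addrAC; ring.
Qed.

Lemma cell_weight_col n p : cell_weight n p =
  (omega2 a (t n - t p.-1) - omega2 a (t n - t p.-1 - tau t p))
  - (omega2 a (t n.-1 - t p.-1) - omega2 a (t n.-1 - t p.-1 - tau t p)).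
Proof.
rewrite /cell_weight; have -> (z : R) : z - t p.-1 - tau t p = z - t p.
  by rewrite /tau; ring.
by rewrite -(_ : t n.-1 - t p = t n.-1 - t p.-1 - tau t p); [ring|rewrite /tau; ring].
Qed.

Lemma cell_weight_ge0 n p : (1 <= p <= n)%N -> (n <= N)%N -> 0 <= cell_weight n p.
Proof.
move=> /andP[p1 pn] nN; rewrite cell_weight_row subr_ge0.
have n1N : (1 <= n <= N)%N by rewrite (leq_trans p1 pn).
apply: omega2_diff_homo => //; first exact/ltW/tau_gt0.
by rewrite lerD2l lerN2 time_level_le// leq_pred (leq_trans pn).
Qed.

Lemma cell_weight_col_sum p : (1 <= p <= N)%N ->
  \sum_(p <= n < N.+1) cell_weight n p <= tau t p * omega1 a T.
Proof.
move=> /andP[p1 pN]; have p1N : (1 <= p <= N)%N by rewrite p1.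
pose q z := omega2 a (z - t p.-1) - omega2 a (z - t p.-1 - tau t p).
have -> : \sum_(p <= n < N.+1) cell_weight n p = q (t N) - q (t p.-1).
  under eq_bigr do rewrite cell_weight_col.
  rewrite -[in RHS](telescope_sumr (fun n => q (t n))) ?(leq_trans (leq_pred _))//.
  by rewrite -{1}(prednK p1) big_add1.
have tp0 := ltW (tau_gt0 p1N).
have [/andP[_ h1] /andP[h2 _]] := (omega2_diff_le a0 (t N - t p.-1) tp0,
  omega2_diff_le a0 (t p.-1 - t p.-1) tp0).
apply: (@le_trans _ _ (q (t N))); first by rewrite gerBl.
apply: le_trans h1 _; rewrite ler_wpM2l//; apply: omega1_homo => //.
rewrite time_level_last gerBl time_level_ge0//.
by rewrite (leq_trans (leq_pred _)).
Qed.

Variables (lam d : R).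
Hypotheses (lam0 : 0 <= lam) (d0 : 0 <= d).

(** If the distance [e] is at most [d], both arguments stay below [2 * d] and truncation does not
    change the increment; otherwise the exponential is at most [expR (- lam * d)]. Each of the two
    bounds is again an increment, so the sums over cells still telescope. *)
Let near_far (q : R -> R) (e u l : R) : {homo q : x y / x <= y} ->
  0 <= e -> l <= u -> u <= e + d ->
  (q u - q l) * expR (- lam * e) <=
    (q (Num.min u (2 * d)) - q (Num.min l (2 * d))) + expR (- lam * d) * (q u - q l).
Proof.
move=> qh e0 lu ue; have qlu : 0 <= q u - q l by rewrite subr_ge0 qh.
have [ed|de] := leP e d.
  have u2 : u <= 2 * d by lra.
  have l2 : l <= 2 * d by lra.
  rewrite (min_l u2) (min_l l2) ler_wpDr//; first by rewrite mulr_ge0// expR_ge0.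
  by rewrite ler_piMr// -expR0 ler_expR mulNr oppr_le0 mulr_ge0.
rewrite ler_wpDl//.
  by rewrite subr_ge0 qh// le_min !ge_min lu lexx orbT.
by rewrite mulrC ler_wpM2r// ler_expR !mulNr lerN2 ler_wpM2l// ltW.
Qed.

Hypothesis tau_d : forall n, (1 <= n <= N)%N -> tau t n <= d.

Let bound (k z : R) : 0 <= k -> z <= T ->
  (omega2 a (Num.min z (2 * d)) - omega2 a (Num.min z (2 * d) - k))
  + expR (- lam * d) * (omega2 a z - omega2 a (z - k)) <=
  k * (omega1 a (2 * d) + expR (- lam * d) * omega1 a T).
Proof.
move=> k0 zT.
have /andP[_ h1] := omega2_diff_le a0 (Num.min z (2 * d)) k0.
have /andP[_ h2] := omega2_diff_le a0 z k0.
rewrite [leRHS]mulrDr lerD//.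
  by apply: le_trans h1 _; rewrite ler_wpM2l//; apply: omega1_homo; rewrite ?ge_min ?lexx ?orbT.
rewrite mulrCA ler_wpM2l ?expR_ge0//; apply: le_trans h2 _.
by rewrite ler_wpM2l//; exact: omega1_homo.
Qed.

Lemma cell_weight_row_sum n : (1 <= n <= N)%N ->
  \sum_(1 <= p < n.+1) cell_weight n p * expR (- lam * (t n - t p)) <=
    tau t n * (omega1 a (2 * d) + expR (- lam * d) * omega1 a T).
Proof.
move=> n1N; have /andP[n1 nN] := n1N; have tn0 := ltW (tau_gt0 n1N).
pose q z := omega2 a z - omega2 a (z - tau t n).
have qh : {homo q : x y / x <= y} by exact: omega2_diff_homo.
have q0 z : 0 <= q z by have /andP[] := omega2_diff_le a0 z tn0.
pose Q s := q (Num.min (t n - s) (2 * d)) + expR (- lam * d) * q (t n - s).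
apply: (@le_trans _ _ (\sum_(1 <= p < n.+1) - (Q (t p) - Q (t p.-1)))).
  apply: ler_sum_nat => p /andP[p1]; rewrite ltnS => pn.
  have p1N : (1 <= p <= N)%N by rewrite p1 (leq_trans pn).
  rewrite cell_weight_row; apply: le_trans (near_far qh _ _ _) _.
  - by rewrite subr_ge0 time_level_le// pn.
  - by rewrite lerD2l lerN2 ltW// time_level_lt.
  - by rewrite -subr_ge0; have := tau_d p1N; rewrite /tau; lra.
  - by rewrite /Q; lra.
rewrite sumrN big_add1/= telescope_sumr// opprB time_level0.
apply: (@le_trans _ _ (Q 0)).
  by rewrite gerBl addr_ge0// mulr_ge0// expR_ge0.
rewrite /Q subr0; apply: bound => //.
by rewrite -time_level_last time_level_le// nN leqnn.
Qed.

Lemma cell_weight_col_weighted_sum p : (1 <= p <= N)%N ->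
  \sum_(p <= n < N.+1) cell_weight n p * expR (- lam * (t n - t p)) <=
    tau t p * (omega1 a (2 * d) + expR (- lam * d) * omega1 a T).
Proof.
move=> p1N; have /andP[p1 pN] := p1N; have tp0 := ltW (tau_gt0 p1N).
pose q z := omega2 a z - omega2 a (z - tau t p).
have qh : {homo q : x y / x <= y} by exact: omega2_diff_homo.
have q0 z : 0 <= q z by have /andP[] := omega2_diff_le a0 z tp0.
pose Q s := q (Num.min (s - t p.-1) (2 * d)) + expR (- lam * d) * q (s - t p.-1).
apply: (@le_trans _ _ (\sum_(p <= n < N.+1) (Q (t n) - Q (t n.-1)))).
  apply: ler_sum_nat => n /andP[pn]; rewrite ltnS => nN.
  have n1N : (1 <= n <= N)%N by rewrite (leq_trans p1 pn).
  rewrite cell_weight_col; apply: le_trans (near_far qh _ _ _) _.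
  - by rewrite subr_ge0 time_level_le// pn.
  - by rewrite lerD2r ltW// time_level_lt.
  - by rewrite -subr_ge0; have := tau_d p1N; rewrite /tau; lra.
  - by rewrite /Q; lra.
have -> : \sum_(p <= n < N.+1) (Q (t n) - Q (t n.-1)) = Q (t N) - Q (t p.-1).
  rewrite -[in RHS](telescope_sumr (fun n => Q (t n))) ?(leq_trans (leq_pred _))//.
  by rewrite -{1}(prednK p1) big_add1.
apply: (@le_trans _ _ (Q (t N))).
  by rewrite gerBl addr_ge0// mulr_ge0// expR_ge0.
apply: bound => //; rewrite time_level_last gerBl time_level_ge0//.
by rewrite (leq_trans (leq_pred _)).
Qed.

End Weights.
End MeshWeights.

(** * Graded meshes *)

Section GradedSums.
Context {R : realType}.

(** The power z^s decreases for [s <= 0], so its value at the right end point underestimates the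
    integral over the cell. The exponent -1 leads to the logarithm, see [ln_cell_le]. *)
Lemma pow_cell_le (x y s : R) : 0 < x -> x <= y -> s <= 0 -> s + 1 != 0 ->
  (y - x) * y `^ s <= (y `^ (s + 1) - x `^ (s + 1)) / (s + 1).
Proof.
move=> x0 xy s0 s1.
pose F z := (s + 1)^-1 * z `^ (s + 1) - y `^ s * z.
have dF (z : R) : 0 < z -> is_derive z 1 F (z `^ s - y `^ s).
  move=> z0; have h1 := derive_scale (s + 1)^-1 (@is_derive1_powR _ (s + 1) z z0).
  have h2 := derive_scale (y `^ s) (is_derive_id z (1 : R)).
  by apply: (is_derive_eq (derive_sub h1 h2)); rewrite addrK mulKf// mulr1.
have := ge0_increment (F := F) (dF := fun z => z `^ s - y `^ s) xy.
rewrite /F => H; suff : (s + 1)^-1 * x `^ (s + 1) - y `^ s * x <=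
    (s + 1)^-1 * y `^ (s + 1) - y `^ s * y by lra.
apply: H.
- by move=> z /andP[xz _]; apply: dF; exact: lt_trans xz.
- move=> z /andP[xz zy]; have z0 : 0 < z by exact: lt_trans xz.
  have y0 : 0 < y by exact: lt_trans zy.
  rewrite subr_ge0 -[s]opprK !(powRN _ (- s)) lef_pV2 ?posrE ?powR_gt0//.
  by apply: ge0_ler_powR; rewrite ?nnegrE ?oppr_ge0 ?(ltW z0) ?(ltW y0) ?(ltW zy).
- apply: derivable_within_continuous => z; rewrite in_itv/= => /andP[xz _].
  by have [] := dF z (lt_le_trans x0 xz).
Qed.

Lemma ln_cell_le (x y : R) : 0 < x -> x <= y -> (y - x) / y <= ln y - ln x.
Proof.
move=> x0 xy; have y0 : 0 < y by exact: lt_le_trans xy.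
have h : ln (x / y) <= x / y - 1.
  have := @expR_ge1Dx R (x / y - 1); rewrite addrC subrK => h.
  by rewrite -ler_expR lnK// posrE divr_gt0.
rewrite lnM ?posrE ?invr_gt0// lnV ?posrE// in h.
by rewrite mulrBl divff ?gt_eqF//; lra.
Qed.

Variables (T gamma Cgam cgam k : R) (N : nat) (t : nat -> R).
Hypotheses (tl : time_levels T N t) (gm : graded_mesh gamma Cgam cgam k N t).
Hypotheses (T0 : 0 < T) (g1 : 1 <= gamma) (C0 : 0 < Cgam) (c0 : 0 < cgam) (k0 : 0 < k).

Let N1 : (1 <= N)%N. Proof. by case: tl. Qed.
Let t1_gt0 : 0 < t 1%N. Proof. exact: (time_level_gt0 tl). Qed.
Let g0 : 0 < gamma. Proof. exact: lt_le_trans g1. Qed.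

Let telescope2 (G : R -> R) :
  \sum_(2 <= n < N.+1) (G (t n) - G (t n.-1)) = G (t N) - G (t 1%N).
Proof. by rewrite big_add1/= (telescope_sumr (fun n => G (t n))). Qed.

Let cell_bounds n : (2 <= n < N.+1)%N -> [/\ 0 < t n.-1, t n.-1 <= t n & 0 < t n].
Proof.
move=> /andP[n2]; rewrite ltnS => nN.
have n1N : (1 <= n <= N)%N by rewrite nN (ltnW n2).
split; [|exact/ltW/(time_level_lt tl)|exact: (time_level_gt0 tl)].
by apply: (time_level_gt0 tl); case: n n2 nN n1N => [|[|n]]//= _ nN _; exact: ltnW.
Qed.

(** In the first cell the step is the level itself, so the grading condition can be solved: dividing
    by t_1^(1 - 1/gamma) bounds t_1^(1/gamma). *)
Lemma first_level_le : t 1%N <= (Cgam * k) `^ gamma.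
Proof.
have [h _ _ _] := gm; have Ck0 : 0 <= Cgam * k by rewrite mulr_ge0 ?ltW.
have := h 1%N; rewrite N1 => /(_ isT); rewrite /tau/= (time_level0 tl) subr0 => ht.
have {}ht : t 1%N <= Cgam * k * t 1%N `^ (1 - 1 / gamma).
  by apply: le_trans ht _; rewrite ler_wpM2l// ge_min lexx orbT.
have : t 1%N `^ (1 / gamma) <= Cgam * k.
  have p0 : 0 < t 1%N `^ (1 - 1 / gamma) by exact: powR_gt0.
  rewrite -(ler_pM2r p0); apply: le_trans ht.
  by rewrite -powRD ?(gt_eqF t1_gt0) ?implybT// addrCA subrr addr0 powRr1// ltW.
move=> /(ge0_ler_powR (ltW g0)); rewrite !nnegrE powR_ge0 => /(_ isT Ck0).
by rewrite -powRrM div1r mulVf ?gt_eqF// powRr1// ltW.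
Qed.

Lemma graded_sum_lt (s : R) : s + 1 < 0 ->
  \sum_(2 <= n < N.+1) tau t n * t n `^ s <= t 1%N `^ (s + 1) / - (s + 1).
Proof.
move=> s1; have s0 : s <= 0 by lra.
apply: (@le_trans _ _ (\sum_(2 <= n < N.+1)
  (t n `^ (s + 1) / (s + 1) - t n.-1 `^ (s + 1) / (s + 1)))).
  apply: ler_sum_nat => n nN; have [h1 h2 h3] := cell_bounds nN.
  by rewrite -mulrBl /tau; apply: pow_cell_le => //; rewrite lt_eqF.
rewrite (telescope2 (fun z => z `^ (s + 1) / (s + 1))) invrN mulrN gerDr.
by rewrite mulr_ge0_le0 ?powR_ge0// invr_le0 ltW.
Qed.

Lemma graded_sum_eq :
  \sum_(2 <= n < N.+1) tau t n * t n `^ (-1) <= ln (t N / t 1%N).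
Proof.
apply: (@le_trans _ _ (\sum_(2 <= n < N.+1) (ln (t n) - ln (t n.-1)))).
  apply: ler_sum_nat => n nN; have [h1 h2 h3] := cell_bounds nN.
  by rewrite powR_inv1 ?(ltW h3)//; exact: ln_cell_le.
have tN0 : 0 < t N by rewrite (time_level_last tl).
by rewrite telescope2 lnM ?posrE ?invr_gt0// lnV// posrE.
Qed.

(** In the last factor, 1 serves the case [s > 0], where t_n^s is at most T^s, and the inverse
    serves [s <= 0], where the sum is compared with an integral. *)
Lemma graded_sum_gt (s : R) : 0 < s + 1 ->
  \sum_(2 <= n < N.+1) tau t n * t n `^ s <= T `^ (s + 1) * (1 + (s + 1)^-1).
Proof.
move=> s1; have Tp : 0 <= T `^ (s + 1) by exact: powR_ge0.
have [s0|s0] := leP s 0.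
  apply: (@le_trans _ _ (\sum_(2 <= n < N.+1)
    (t n `^ (s + 1) / (s + 1) - t n.-1 `^ (s + 1) / (s + 1)))).
    apply: ler_sum_nat => n nN; have [h1 h2 h3] := cell_bounds nN.
    by rewrite -mulrBl /tau; apply: pow_cell_le => //; rewrite gt_eqF.
  rewrite (telescope2 (fun z => z `^ (s + 1) / (s + 1))) (time_level_last tl).
  have : 0 <= t 1%N `^ (s + 1) / (s + 1) by rewrite divr_ge0 ?powR_ge0// ltW.
  by rewrite mulrDr mulr1; lra.
apply: (@le_trans _ _ (\sum_(2 <= n < N.+1) (t n * T `^ s - t n.-1 * T `^ s))).
  apply: ler_sum_nat => n nN; have [h1 h2 h3] := cell_bounds nN.
  rewrite -mulrBl /tau ler_wpM2l ?subr_ge0// ge0_ler_powR ?nnegrE ?(ltW s0) ?(ltW h3) ?(ltW T0)//.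
  by rewrite -(time_level_last tl) (time_level_le tl)// leqnn andbT; case/andP: nN.
rewrite (telescope2 (fun z => z * T `^ s)) (time_level_last tl).
have -> : T `^ (s + 1) = T * T `^ s.
  by rewrite powRD ?(gt_eqF T0) ?implybT// powRr1 ?(ltW T0)// mulrC.
have := mulr_ge0 (ltW t1_gt0) (powR_ge0 T s).
have : 0 <= T * T `^ s / (s + 1) by rewrite !mulr_ge0 ?powR_ge0 ?invr_ge0 ?ltW.
by rewrite mulrDr mulr1; lra.
Qed.

End GradedSums.

Section MeshError.
Context {R : realType}.
Variables (T alpha gamma Cgam cgam : R).
Hypotheses (T0 : 0 < T) (a0 : 0 < alpha) (a1 : alpha < 1) (g1 : 1 <= gamma).
Hypotheses (C0 : 0 < Cgam) (c0 : 0 < cgam).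

(* For [gamma = 2 / (alpha + 1)], [Xi] is [0] if [t_1 = T]; small steps keep
   [ln (T / t_1)] away from [0]. *)
Lemma graded_sum_le_Xi : exists C k0 : R, [/\ 0 < C, 0 < k0 &
  forall (k : R) (N : nat) (t : nat -> R), 0 < k <= k0 ->
  time_levels T N t -> graded_mesh gamma Cgam cgam k N t ->
  t 1%N `^ (alpha + 1) +
    k ^+ 2 * (\sum_(2 <= n < N.+1) tau t n * t n `^ (alpha - 2 / gamma))
  <= C * Xi k alpha gamma (t 1%N) (t N)].
Proof.
have g0 : 0 < gamma by exact: lt_le_trans g1.
have a10 : 0 < alpha + 1 by exact: addr_gt0.
pose s := alpha - 2 / gamma; pose b := gamma * (alpha + 1).
have b0 : 0 < b by exact: mulr_gt0.
(* The sign of [s + 1] is that of [b - 2]: the three branches of [Xi] are the divergent, convergent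
   and logarithmic regimes of the graded sum. *)
have gs : gamma * (s + 1) = b - 2.
  by rewrite /s /b; field; rewrite gt_eqF.
have first k N (t : nat -> R) : 0 < k -> time_levels T N t ->
    graded_mesh gamma Cgam cgam k N t -> t 1%N `^ (alpha + 1) <= Cgam `^ b * k `^ b.
  move=> k0 tl gm; have h := first_level_le tl gm g1 C0 k0.
  rewrite -powRM ?(ltW k0) ?(ltW C0)// /b powRrM ge0_ler_powR ?nnegrE ?powR_ge0 ?(ltW a10)//.
  by rewrite (time_level_ge0 tl)//; case: tl.
have Cb0 : 0 < Cgam `^ b by exact: powR_gt0.
have gE : (gamma < 2 / (alpha + 1)) = (b < 2) by rewrite ltr_pdivlMr.
have gE' : (gamma == 2 / (alpha + 1)) = (b == 2).
  have an0 := lt0r_neq0 a10.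
  by apply/eqP/eqP => [h|h]; [rewrite /b h divfK|rewrite -h /b mulfK].
have [b2|b2|b2] := ltgtP b 2.
- have s1 : s + 1 < 0 by rewrite -(pmulr_rlt0 _ g0) gs subr_lt0.
  pose C := Cgam `^ b + cgam `^ (s + 1) / - (s + 1).
  have C10 : 0 <= cgam `^ (s + 1) / - (s + 1).
    by rewrite divr_ge0 ?powR_ge0// oppr_ge0 ltW.
  exists C, 1; split=> //; first by rewrite ltr_pwDl.
  move=> k N t /andP[k0 k1] tl gm; rewrite /Xi gE b2 -/b /C [leRHS]mulrDl; apply: lerD; first exact: first tl gm.
  have h := graded_sum_lt tl s1.
  apply: le_trans (ler_wpM2l (sqr_ge0 k) h) _.
  rewrite mulrA [leRHS]mulrAC ler_wpM2r//; first by rewrite invr_ge0 oppr_ge0 ltW.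
  (* The sum is governed by its first cell through a negative power of t_1. The lower bound on t_1
     turns that power into one of [k], and the exponents add up to [b]. *)
  have -> : k `^ b = k ^+ 2 * (k `^ gamma) `^ (s + 1).
    rewrite -powRrM gs -powR_mulrn ?(ltW k0)// -powRD ?(gt_eqF k0) ?implybT//.
    by rewrite addrCA subrr addr0.
  rewrite [leRHS]mulrCA ler_wpM2l ?sqr_ge0// -powRM ?powR_ge0 ?(ltW c0)//.
  have [_ ht _ _] := gm.
  rewrite -[s + 1]opprK !(powRN _ (- (s + 1))).
  have tp : 0 < cgam * k `^ gamma by rewrite mulr_gt0 ?powR_gt0.
  rewrite lef_pV2 ?posrE ?powR_gt0// ?(lt_le_trans tp)//.
  by rewrite ge0_ler_powR ?nnegrE ?oppr_ge0 ?(ltW s1) ?(ltW tp) ?(ltW (lt_le_trans tp ht)).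
- have s1 : 0 < s + 1 by rewrite -(pmulr_rgt0 _ g0) gs subr_gt0.
  pose K := T `^ (s + 1) * (1 + (s + 1)^-1).
  have K0 : 0 <= K by rewrite mulr_ge0 ?powR_ge0// addr_ge0// invr_ge0 ltW.
  exists (Cgam `^ b + K), 1; split=> //; first by rewrite ltr_pwDl.
  move=> k N t /andP[k0 k1] tl gm; rewrite /Xi gE gE' ltNge (ltW b2)/= gt_eqF//.
  rewrite [leRHS]mulrDl lerD//; last by rewrite mulrC ler_wpM2r ?sqr_ge0//; exact: (graded_sum_gt tl).
  apply: le_trans (first _ _ _ k0 tl gm) _; rewrite ler_wpM2l ?(ltW Cb0)//.
  rewrite -powR_mulrn ?(ltW k0)//; apply: ger_powR; last exact: ltW.
  by rewrite k0.
- have s1 : s = -1.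
    have := gs; rewrite b2 subrr => /eqP; rewrite mulf_eq0 (gt_eqF g0)/= => /eqP; lra.
  (* For [k] below this value (Cgam k)^gamma, and with it t_1, is at most T / e. *)
  pose k0 := (T / expR 1) `^ gamma^-1 / Cgam.
  have Te0 : 0 < T / expR 1 by rewrite divr_gt0// expR_gt0.
  have k00 : 0 < k0 by rewrite divr_gt0// powR_gt0.
  exists (Cgam `^ b + 1), k0; split=> //; first by rewrite ltr_pwDl.
  move=> k N t /andP[kp kk0] tl gm; rewrite /Xi gE gE' b2 ltxx eqxx.
  have t1 : 0 < t 1%N by apply: (time_level_gt0 tl); case: tl => ->.
  have ln1 : 1 <= ln (t N / t 1%N).
    rewrite -ler_expR lnK ?posrE ?divr_gt0 ?(time_level_last tl)//.
    rewrite ler_pdivlMr// -ler_pdivlMl ?expR_gt0// mulrC.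
    apply: le_trans (first_level_le tl gm g1 C0 kp) _.
    have -> : T / expR 1 = ((T / expR 1) `^ gamma^-1) `^ gamma.
      by rewrite -powRrM mulVf ?gt_eqF// powRr1// ltW.
    apply: ge0_ler_powR; rewrite ?nnegrE ?powR_ge0 ?(ltW g0) ?mulr_ge0 ?(ltW C0) ?(ltW kp)//.
    by rewrite -ler_pdivlMl// mulrC.
  have k2 := sqr_ge0 k; rewrite [leRHS]mulrDl mul1r lerD//.
    apply: le_trans (first _ _ _ kp tl gm) _; rewrite b2.
    apply: ler_wpM2l; first exact: powR_ge0.
    by rewrite powR_mulrn ?(ltW kp)// ler_peMr.
  by rewrite ler_wpM2l// -/s s1; exact: (graded_sum_eq tl).
Qed.

End MeshError.

(** * Local errors *)

Section Splitting.
Context {R : realType}.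
Local Notation mu := (@lebesgue_measure R).

Lemma Rintegral_itv_sum (f : R -> R) (z : nat -> R) (n : nat) :
  (forall i, (i < n)%N -> z i <= z i.+1) ->
  mu.-integrable `[z 0%N, z n] (EFin \o f) ->
  (\int[mu]_(s in `[z 0%N, z n]) f s)%R =
    \sum_(1 <= p < n.+1) (\int[mu]_(s in `[z p.-1, z p]) f s)%R.
Proof.
elim: n => [_ _|n IH zi int]; first by rewrite big_geq// set_itv1 Rintegral_set1.
have z0 i : (i <= n.+1)%N -> z 0%N <= z i.
  by elim: i => // i IHi iN; rewrite (le_trans (IHi (ltnW iN)))// zi.
have intn : mu.-integrable `[z 0%N, z n] (EFin \o f).
  by apply: integrableS int => //; apply: subset_itvl; rewrite bnd_simp zi.
rewrite big_nat_recr//= -IH//; last by move=> i iN; apply: zi; exact: ltnW.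
have := @Rintegral_itvB _ f (BLeft (z 0%N)) (BRight (z n.+1)) (z n) int.
rewrite !bnd_simp z0// zi// => /(_ isT isT) h.
have e := @Rintegral_itv_obnd_cbnd _ (z n) (BRight (z n.+1)) f.
rewrite -e; first by rewrite -h [RHS]addrC subrK.
by apply: integrableS int => //; apply: subset_itvr; rewrite bnd_simp z0.
Qed.

End Splitting.

Section NodalQuantities.
Context {R : realType}.
Implicit Types (t : nat -> R) (c : R -> R) (x : nat -> R).

(* The value with superscript [n - 1/2], except in the first cell where the
   scheme uses the right end point. *)
Definition stage x n : R := if (n <= 1)%N then x n else (x n + x n.-1) / 2.

(** Zero in the first cell: there the scheme sees a constant, and difference quotients would meet
    the singularity at 0. *)
Definition slope t x n : R := if (n <= 1)%N then 0 else (x n - x n.-1) / tau t n.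

Definition midpoint t n : R := (t n.-1 + t n) / 2.

(** From the second cell on this is the linear interpolant at the two nodes. Centring it at the
    midpoint separates the stage value, which the scheme integrates, from a part with zero mean. *)
Definition cell_interp t x n s : R :=
  stage x n + slope t x n * (s - midpoint t n).

End NodalQuantities.

Section ScalarError.
Context {R : realType}.
Local Notation mu := (@lebesgue_measure R).
Variables (T alpha Cgam : R) (N : nat) (t : nat -> R).
Hypothesis tl : time_levels T N t.
Hypotheses (a0 : 0 < alpha) (a1 : alpha < 1) (C0 : 0 < Cgam).
Hypothesis t_ratio : forall n, (2 <= n <= N)%N -> t n <= Cgam * t n.-1.

Let a2 : 0 <= 2 - alpha. Proof. by rewrite subr_ge0 ltW// (lt_trans a1)// ltr1n. Qed.

Definition weakly_singular (K : R) (c c1 c2 : R -> R) : Prop :=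
  [/\ {within `[0, T], continuous c},
      forall s, 0 < s <= T -> is_derive s 1 c (c1 s) /\ is_derive s 1 c1 (c2 s),
      forall s, 0 < s <= T -> `|c1 s| <= K * s `^ (alpha - 1) &
      forall s, 0 < s <= T -> `|c2 s| <= K * s `^ (alpha - 2)].

(** In the first cell this is the integral of s^(alpha - 1); later it is the usual second-order
    error, with the factor [Cgam] powered to move the singular weight from the left to the right
    node. *)
Definition interp_error n : R :=
  if (n <= 1)%N then t 1%N `^ alpha / alpha
  else Cgam `^ (2 - alpha) * (tau t n ^+ 2 * t n `^ (alpha - 2)).

Lemma interp_error_ge0 n : (1 <= n <= N)%N -> 0 <= interp_error n.
Proof.
move=> n1; rewrite /interp_error; case: ifP => _.
  by rewrite divr_ge0 ?powR_ge0// ltW.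
by rewrite mulr_ge0 ?powR_ge0// mulr_ge0 ?sqr_ge0// powR_ge0.
Qed.

(** Negative powers are largest at the left end of a cell; the ratio condition on consecutive levels
    moves them to the right end. *)
Lemma pow_level_pred e n : (2 <= n <= N)%N -> 0 <= e ->
  t n.-1 `^ (- e) <= Cgam `^ e * t n `^ (- e).
Proof.
move=> n2N e0; have /andP[n2 nN] := n2N.
have n1N : (1 <= n <= N)%N by rewrite (ltnW n2).
have tn := time_level_gt0 tl n1N.
have tp : 0 < t n.-1.
  apply: (time_level_gt0 tl); rewrite (leq_trans (leq_pred _) nN) andbT.
  by case: n n2 {n2N nN n1N tn} => [|[|n]].
rewrite !powRN -ler_pdivrMr ?invr_gt0 ?powR_gt0// invrK mulrC ler_pdivrMr ?powR_gt0//.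
rewrite -powRM ?(ltW C0) ?(ltW tp)// ge0_ler_powR ?nnegrE ?(ltW tn) ?mulr_ge0 ?(ltW C0) ?(ltW tp)//.
exact: t_ratio.
Qed.

Section Regular.
Variables (K : R) (c c1 c2 : R -> R).
Hypotheses (K0 : 0 <= K) (creg : weakly_singular K c c1 c2).

Let cont_sub x y : 0 <= x -> y <= T -> {within `[x, y], continuous c}.
Proof.
move=> x0 yT; have [cc _ _ _] := creg.
by apply: continuous_subspaceW cc; apply: subset_itv; rewrite bnd_simp.
Qed.

Lemma first_cell_error s : 0 <= s <= t 1%N -> `|c s - c (t 1%N)| <= K * interp_error 1.
Proof.
move=> /andP[s0 s1].
have N1 : (1 <= N)%N by case: tl.
have t1T : t 1%N <= T by rewrite -(time_level_last tl) (time_level_le tl)// N1 leqnn.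
have [cc dc bc1 _] := creg.
pose G (z : R) := K / alpha * pos_pow alpha z.
have h : `|c (t 1%N) - c s| <= G (t 1%N) - G s.
  apply: (@le_increment _ _ _ c1 (fun z => K / alpha * (alpha * z `^ (alpha - 1)))) => //.
  - by move=> x /andP[sx xt]; have [] := dc x _; rewrite ?(le_lt_trans s0 sx) ?(le_trans (ltW xt)).
  - by move=> x /andP[sx xt]; apply: derive_scale; apply: is_derive_pos_pow_gt0; exact: le_lt_trans sx.
  - move=> x /andP[sx xt]; rewrite mulrA divfK ?gt_eqF//.
    by apply: bc1; rewrite (le_lt_trans s0 sx) (le_trans (ltW xt)).
  - exact: cont_sub.
  - apply: within_continuous_mul; first exact: within_continuous_cst.
    exact: continuous_subspaceT (continuous_pos_pow a0).
rewrite distrC; apply: le_trans h _; rewrite /interp_error/= /G.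
have := pos_pow_ge0 alpha s; rewrite (@pos_powE _ alpha (t 1%N)) ?(le_trans s0 s1)// => p0.
have Ka : 0 <= K / alpha by rewrite divr_ge0// ltW.
by have := mulr_ge0 Ka p0; rewrite [K * (_ / _)]mulrCA [K / alpha * t _ `^ _]mulrC -mulrA; lra.
Qed.

Lemma derivative_diff_le x y X : 0 < X -> X <= x -> x <= y -> y <= T ->
  `|c1 y - c1 x| <= K * X `^ (alpha - 2) * (y - x).
Proof.
move=> X0 Xx xy yT; have [cc dc _ bc2] := creg.
have xT z : x <= z <= y -> 0 < z <= T.
  by move=> /andP[h1 h2]; rewrite (lt_le_trans X0 (le_trans Xx h1)) (le_trans h2).
apply: (@abs_increment_le _ c1 c2) => //.
- by move=> z /andP[h1 h2]; have [] // := dc z _; apply: xT; rewrite !ltW.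
- move=> z /andP[h1 h2]; have zT : 0 < z <= T by apply: xT; rewrite !ltW.
  apply: le_trans (bc2 z zT) _; rewrite ler_wpM2l//.
  have -> : alpha - 2 = - (2 - alpha) by rewrite opprB.
  have z0 : 0 < z by case/andP: zT.
  rewrite !powRN lef_pV2 ?posrE ?powR_gt0// ge0_ler_powR ?nnegrE ?(ltW X0) ?(ltW z0)//.
  by rewrite (le_trans Xx) ?ltW.
- apply: derivable_within_continuous => z; rewrite in_itv/= => zxy.
  by have [_ []] := dc z (xT z zxy).
Qed.

Section LaterCell.
Variable n : nat.
Hypothesis n2N : (2 <= n <= N)%N.

Let n1N : (1 <= n <= N)%N. Proof. by case/andP: n2N => n2 ->; rewrite (ltnW n2). Qed.
Let tp : 0 < t n.-1.
Proof.
apply: (time_level_gt0 tl); case/andP: n2N => n2 nN.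
by rewrite (leq_trans (leq_pred _) nN) andbT; case: n n2 {nN} => [|[|]].
Qed.
Let tn : t n.-1 < t n. Proof. exact: (time_level_lt tl). Qed.
Let tnT : t n <= T.
Proof.
rewrite -(time_level_last tl) (time_level_le tl)// leqnn andbT.
by case/andP: n2N.
Qed.
Let inT x : t n.-1 <= x <= t n -> 0 < x <= T.
Proof. by move=> /andP[h1 h2]; rewrite (lt_le_trans tp h1) (le_trans h2). Qed.

Lemma slope_mean_value : exists2 xi, t n.-1 < xi < t n &
  slope t (fun i => c (t i)) n = c1 xi.
Proof.
have [cc dc _ _] := creg.
have hd x : x \in `](t n.-1), (t n)[ -> is_derive x 1 c (c1 x).
  rewrite in_itv/= => /andP[h1 h2]; have [] // := dc x _.
  by apply: inT; rewrite !ltW.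
have [xi] := MVT tn hd (cont_sub (ltW tp) tnT); rewrite in_itv/= => hxi e.
exists xi => //; rewrite /slope leqNgt; have -> /= : (1 < n)%N by case/andP: n2N.
by rewrite e -/(tau t n) mulfK// gt_eqF// (tau_gt0 tl).
Qed.

Lemma slope_le : `|slope t (fun i => c (t i)) n| <= K * t n.-1 `^ (alpha - 1).
Proof.
have [xi /andP[h1 h2] ->] := slope_mean_value; have [_ _ bc1 _] := creg.
have xi0 : 0 < xi by exact: lt_trans h1.
have xiT : 0 < xi <= T by apply: inT; rewrite !ltW.
apply: le_trans (bc1 xi xiT) _; rewrite ler_wpM2l//.
have -> : alpha - 1 = - (1 - alpha) by rewrite opprB.
rewrite !powRN lef_pV2 ?posrE ?powR_gt0// ge0_ler_powR ?nnegrE ?(ltW tp) ?(ltW xi0) ?(ltW h1)//.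
by rewrite subr_ge0 ltW.
Qed.

(** The error vanishes at [t n.-1], and its derivative is [c1 z - c1 xi] for a fixed point [xi] of
    the cell. The bound on [c2] gives one factor of the step, integration of the derivative the
    other. *)
Lemma later_cell_error s : t n.-1 <= s <= t n ->
  `|c s - cell_interp t (fun i => c (t i)) n s| <= K * interp_error n.
Proof.
move=> /andP[s1 s2]; have [cc dc _ bc2] := creg.
have [xi /andP[x1 x2] hs] := slope_mean_value.
have n1 : (n <= 1)%N = false by rewrite leqNgt; case/andP: n2N => ->.
set d := slope _ _ n in hs *.
have dE : d * tau t n = c (t n) - c (t n.-1).
  by rewrite /d /slope n1 divfK// gt_eqF// (tau_gt0 tl).
have iE z : cell_interp t (fun i => c (t i)) n z = c (t n.-1) + d * (z - t n.-1).
  rewrite /cell_interp -/d /stage n1 /midpoint.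
  by move: dE; rewrite /tau; lra.
have bound z : t n.-1 <= z <= t n ->
    `|c1 z - d| <= K * t n.-1 `^ (alpha - 2) * tau t n.
  move=> /andP[z1 z2]; rewrite hs.
  have p0 : 0 <= K * t n.-1 `^ (alpha - 2) by rewrite mulr_ge0 ?powR_ge0.
  have [zx|xz] := leP z xi.
    rewrite distrC; apply: le_trans (derivative_diff_le tp z1 zx _) _.
      exact: le_trans (ltW x2) tnT.
    by rewrite ler_wpM2l// /tau; lra.
  apply: le_trans (derivative_diff_le tp (ltW x1) (ltW xz) _) _.
    exact: le_trans z2 tnT.
  by rewrite ler_wpM2l// /tau; lra.
pose F z := c z - d * z.
have dF z : t n.-1 < z < s -> is_derive z 1 F (c1 z - d).
  move=> /andP[z1 z2]; have [|dcz _] := dc z.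
    by apply: inT; rewrite (ltW z1) (le_trans (ltW z2)).
  apply: (is_derive_eq (derive_sub dcz (derive_scale d (is_derive_id z (1 : R))))).
  by rewrite mulr1.
have h : `|F s - F (t n.-1)| <= K * t n.-1 `^ (alpha - 2) * tau t n * (s - t n.-1).
  apply: (abs_increment_le s1 dF).
    by move=> z /andP[z1 z2]; apply: bound; rewrite (ltW z1) (le_trans (ltW z2)).
  apply: within_continuous_sub; first exact: cont_sub (ltW tp) (le_trans s2 tnT).
  apply: within_continuous_mul; first exact: within_continuous_cst.
  by apply: continuous_subspaceT => z.
have -> : c s - cell_interp t (fun i => c (t i)) n s = F s - F (t n.-1).
  by rewrite iE /F; ring.
apply: le_trans h _; rewrite /interp_error n1.
have p := pow_level_pred n2N a2.
have {}p : t n.-1 `^ (alpha - 2) <= Cgam `^ (2 - alpha) * t n `^ (alpha - 2).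
  by move: p; rewrite opprB.
have tau0 : 0 <= tau t n by exact/ltW/(tau_gt0 tl).
apply: (@le_trans _ _ (K * t n.-1 `^ (alpha - 2) * tau t n * tau t n)).
  by rewrite ler_wpM2l ?mulr_ge0 ?powR_ge0// /tau lerD2r.
have := ler_wpM2l K0 p => /(ler_wpM2r (sqr_ge0 (tau t n))).
by rewrite expr2; lra.
Qed.

End LaterCell.

Lemma cell_error n s : (1 <= n <= N)%N -> t n.-1 <= s <= t n ->
  `|c s - cell_interp t (fun i => c (t i)) n s| <= K * interp_error n.
Proof.
move=> /andP[n1 nN] sn; have [n2|] := leqP 2 n.
  by apply: later_cell_error => //; rewrite n2.
rewrite ltnS leq_eqVlt ltnS leqn0 => /orP[/eqP nE|/eqP n0]; last by rewrite n0 in n1.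
rewrite nE in sn *; rewrite /cell_interp /stage /slope/= mul0r addr0.
by apply: first_cell_error; move: sn; rewrite /= (time_level0 tl).
Qed.

Lemma slope_diff_le n : (3 <= n <= N)%N ->
  `|slope t (fun i => c (t i)) n - slope t (fun i => c (t i)) n.-1| <=
    K * t n.-2 `^ (alpha - 2) * (tau t n + tau t n.-1).
Proof.
move=> /andP[n3 nN].
have h1 : (2 <= n <= N)%N by rewrite nN (ltnW n3).
have h2 : (2 <= n.-1 <= N)%N.
  by rewrite (leq_trans (leq_pred _) nN) andbT; case: n n3 {nN h1} => [|[|[|]]].
have [xi /andP[x1 x2] ->] := slope_mean_value h1.
have [ze /andP[z1 z2] ->] := slope_mean_value h2.
have tp : 0 < t n.-2.
  apply: (time_level_gt0 tl); rewrite (leq_trans _ nN) ?(leq_trans (leq_pred _) (leq_pred _))//.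
  by rewrite andbT; case: n n3 {nN h1 h2 x1 x2 z1 z2} => [|[|[|]]].
apply: le_trans (derivative_diff_le tp (ltW z1) _ _) _.
- exact: ltW (lt_trans z2 x1).
- by rewrite (le_trans (ltW x2))// -(time_level_last tl) (time_level_le tl)// nN leqnn.
- by rewrite ler_wpM2l ?mulr_ge0 ?powR_ge0// /tau; lra.
Qed.

End Regular.
End ScalarError.

Lemma derive_sum (R : realType) (I : Type) (r : seq I) (F : I -> R -> R)
    (dF : I -> R) (x : R) :
  (forall i, is_derive x 1 (F i) (dF i)) ->
  is_derive x 1 (fun s => \sum_(i <- r) F i s) (\sum_(i <- r) dF i).
Proof.
move=> h; elim: r => [|i r IH].
  have -> : (fun s : R => \sum_(i <- [::]) F i s) = cst 0.
    by apply/funext => s; rewrite big_nil.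
  by rewrite big_nil; exact: is_derive_cst.
have -> : (fun s : R => \sum_(j <- i :: r) F j s) =
    (fun s => F i s + \sum_(j <- r) F j s).
  by apply/funext => s; rewrite big_cons.
by rewrite big_cons; exact: derive_add (h i) IH.
Qed.

Section MemoryError.
Context {R : realType}.
Local Notation mu := (@lebesgue_measure R).
Variables (T alpha Cgam : R) (N : nat) (t : nat -> R).
Hypothesis tl : time_levels T N t.
Hypotheses (a0 : 0 < alpha) (a1 : alpha < 1) (C0 : 0 < Cgam).
Hypothesis t_ratio : forall n, (2 <= n <= N)%N -> t n <= Cgam * t n.-1.

Section Moments.
Variable a : R.
Hypothesis ap : 0 < a.

(** Antiderivatives in [x]: [dmoment0] and [dmoment1] below are the integrals over cell [p], cut at
    [x], of the kernel and of the kernel times (midpoint - s). *)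
Definition moment0 p x : R := omega2 a (x - t p.-1) - omega2 a (x - t p).

Definition moment1 p x : R :=
  tau t p / 2 * (omega2 a (x - t p.-1) + omega2 a (x - t p))
  - (omega3 a (x - t p.-1) - omega3 a (x - t p)).

Definition dmoment0 p x : R := omega1 a (x - t p.-1) - omega1 a (x - t p).

Definition dmoment1 p x : R :=
  tau t p / 2 * (omega1 a (x - t p.-1) + omega1 a (x - t p))
  - (omega2 a (x - t p.-1) - omega2 a (x - t p)).

Lemma is_derive_moment0 (p : nat) (x : R) : is_derive x 1 (moment0 p) (dmoment0 p x).
Proof.
exact: derive_sub (derive_translate (is_derive_omega2 ap (x - t p.-1)))
  (derive_translate (is_derive_omega2 ap (x - t p))).
Qed.

Lemma is_derive_moment1 (p : nat) (x : R) : is_derive x 1 (moment1 p) (dmoment1 p x).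
Proof.
have h2 (z : R) := derive_translate (is_derive_omega2 ap (x - z)).
have h3 (z : R) := derive_translate (is_derive_omega3 ap (x - z)).
exact: derive_sub (derive_scale (tau t p / 2) (derive_add (h2 (t p.-1)) (h2 (t p))))
  (derive_sub (h3 (t p.-1)) (h3 (t p))).
Qed.

Lemma moment0_increment n p : moment0 p (t n) - moment0 p (t n.-1) = cell_weight t a n p.
Proof. by rewrite /moment0 /cell_weight; ring. Qed.

Variables (K : R) (c c1 c2 : R -> R).
Hypotheses (K0 : 0 <= K) (creg : weakly_singular T alpha K c c1 c2).
Hypothesis memory_int : forall x, 0 < x <= T ->
  mu.-integrable `[0, x] (EFin \o (fun s => omega a (x - s) * c s)).

Local Notation cn := (fun i => c (t i)).

(** Replacing [c] by its interpolant costs at most the interpolation error times the kernel mass of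
    the cell. The interpolant itself integrates exactly to stage times mass minus slope times first
    moment. *)
Lemma memory_error n x : (1 <= n <= N)%N -> t n.-1 < x < t n ->
  `|(\int[mu]_(s in `[0%R, x]) (omega a (x - s) * c s))%R
    - \sum_(1 <= p < n.+1) (stage cn p * dmoment0 p x - slope t cn p * dmoment1 p x)|
  <= \sum_(1 <= p < n.+1) K * interp_error alpha Cgam t p * dmoment0 p x.
Proof.
move=> n1N /andP[x1 x2]; have /andP[n1 nN] := n1N.
have xT : 0 < x <= T.
  apply/andP; split.
    by apply: le_lt_trans x1; rewrite (time_level_ge0 tl)// (leq_trans (leq_pred _)).
  by rewrite (le_trans (ltW x2))// -(time_level_last tl) (time_level_le tl)// nN leqnn.
pose f s := omega a (x - s) * c s.
(* Cutting the nodes at [x] makes the incomplete cell [n] an ordinary member of the partition. *)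
pose z p := Num.min x (t p).
have z0 : z 0%N = 0 by rewrite /z (time_level0 tl) min_r//; case/andP: xT => /ltW.
have zn : z n = x by rewrite /z min_l// ltW.
have zpred p : (1 <= p <= n)%N -> t p.-1 < x /\ z p.-1 = t p.-1.
  move=> /andP[p1 pn]; suff h : t p.-1 < x by rewrite /z min_r// ltW.
  apply: le_lt_trans x1; apply: (time_level_le tl).
  by rewrite -!subn1 leq_sub2r//= (leq_trans _ nN)// leq_subr.
have fint := memory_int xT.
have -> : (\int[mu]_(s in `[0%R, x]) f s)%R =
    \sum_(1 <= p < n.+1) (\int[mu]_(s in `[z p.-1, z p]) f s)%R.
  rewrite -{1}z0 -{1}zn Rintegral_itv_sum//; last by rewrite z0 zn.
  move=> i iN; rewrite /z le_min !ge_min lexx/= (time_level_le tl) ?orbT//.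
  by rewrite leqnSn (leq_trans iN).
rewrite -sumrB; apply: le_trans (ler_norm_sum _ _ _) _.
apply: ler_sum_nat => p /andP[p1]; rewrite ltnS => pn.
have p1n : (1 <= p <= n)%N by rewrite p1.
have p1N : (1 <= p <= N)%N by rewrite p1 (leq_trans pn).
have [tpx ->] := zpred p p1n.
have tp := time_level_lt tl p1N.
have [i0 e0] := cell_integral0 ap tp tpx.
have [i1 e1] := cell_integral1 ap tp tpx.
pose I : set R := `[t p.-1, Num.min x (t p)]%classic.
have mI : measurable (I : set (measurableTypeR R)) by exact: measurable_itv.
have fI : mu.-integrable I (EFin \o f).
  apply: integrableS fint => //; apply: subset_itv; rewrite bnd_simp.
    by rewrite (time_level_ge0 tl)// (leq_trans (leq_pred _))//; case/andP: p1N.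
  by rewrite ge_min lexx.
pose A := stage cn p; pose B := slope t cn p.
pose L s := A * omega a (x - s) - B * (omega a (x - s) * (midpoint t p - s)).
have iA : mu.-integrable I (EFin \o (fun s => A * omega a (x - s))).
  by have := integrableZl mI A i0.
have iB : mu.-integrable I (EFin \o (fun s => B * (omega a (x - s) * (midpoint t p - s)))).
  by have := integrableZl mI B i1.
have iL : mu.-integrable I (EFin \o L).
  have -> : EFin \o L = (fun s => (EFin \o (fun s => A * omega a (x - s))%R) s -
      (EFin \o (fun s => B * (omega a (x - s) * (midpoint t p - s)))%R) s)%E.
    by apply/funext => s /=; rewrite -EFinB.
  exact: integrableB.
have LE : (\int[mu]_(s in I) L s)%R = A * dmoment0 p x - B * dmoment1 p x.
  by rewrite RintegralB// !RintegralZl// e0 e1.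
rewrite -/A -/B -LE -RintegralB//.
have ifL : mu.-integrable I (EFin \o (fun s => f s - L s)).
  have -> : EFin \o (fun s => f s - L s) = (fun s => (EFin \o f) s - (EFin \o L) s)%E.
    by apply/funext => s /=; rewrite -EFinB.
  exact: integrableB.
apply: le_trans (le_normr_Rintegral mI ifL) _.
pose k := K * interp_error alpha Cgam t p.
have -> : K * interp_error alpha Cgam t p * dmoment0 p x =
    (\int[mu]_(s in I) (k * omega a (x - s)))%R by rewrite RintegralZl// e0.
apply: le_Rintegral => //.
- by apply: (@integrable_norm _ _ _ mu I _ ifL).
- by have := integrableZl mI k i0.
move=> s; rewrite /I/= in_itv/= le_min => /andP[s1 /andP[s2 s3]].
have -> : f s - L s = omega a (x - s) * (c s - cell_interp t cn p s).
  by rewrite /f /L /cell_interp -/A -/B; ring.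
rewrite normrM (ger0_norm (omega_ge0 _ _)) mulrC ler_wpM2r ?omega_ge0//.
by apply: (cell_error tl a0 a1 C0 t_ratio K0 creg p1N); rewrite s1.
Qed.

End Moments.

Section LocalError.
Variables (m : nat) (al : 'I_m -> R) (kappa Ky Kh Kb : R).
Hypotheses (al0 : forall j, 0 < al j) (kappa0 : 0 <= kappa).
Hypotheses (Ky0 : 0 <= Ky) (Kh0 : 0 <= Kh) (Kb0 : 0 <= Kb).
Variables (y y1 y2 h h1 h2 g : R -> R) (b b1 b2 : 'I_m -> R -> R).
Hypothesis yreg : weakly_singular T alpha Ky y y1 y2.
Hypothesis hreg : weakly_singular T alpha Kh h h1 h2.
Hypothesis breg : forall j, weakly_singular T alpha Kb (b j) (b1 j) (b2 j).
Hypothesis memory_int : forall j x, 0 < x <= T ->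
  mu.-integrable `[0, x] (EFin \o (fun s => omega (al j) (x - s) * b j s)).
Hypothesis y_eq : forall x, 0 < x <= T -> is_derive x 1 y
  (g x - h x - \sum_(j < m) (\int[mu]_(s in `[0%R, x]) (omega (al j) (x - s) * b j s))%R
   + kappa * y x).
Hypothesis g_cont : forall x, 0 < x <= T -> {for x, continuous g}.

(** The left-hand side is an increment over the cell. It is bounded through its derivative, so the
    equation enters pointwise and the memory is never integrated in the outer variable except
    through its explicit antiderivatives. *)
Lemma local_error n : (1 <= n <= N)%N ->
  mu.-integrable `[t n.-1, t n] (EFin \o g) ->
  `|y (t n) - y (t n.-1) + tau t n * stage (fun i => h (t i)) n
    + \sum_(j < m) \sum_(1 <= p < n.+1)
        (stage (fun i => b j (t i)) p * cell_weight t (al j) n p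
         - slope t (fun i => b j (t i)) p *
             (moment1 (al j) p (t n) - moment1 (al j) p (t n.-1)))
    - kappa * (tau t n * stage (fun i => y (t i)) n)
    - (\int[mu]_(s in `[t n.-1, t n]) g s)%R|
  <= (Kh + kappa * Ky) * interp_error alpha Cgam t n * tau t n
     + \sum_(j < m) \sum_(1 <= p < n.+1)
         Kb * interp_error alpha Cgam t p * cell_weight t (al j) n p.
Proof.
move=> n1N gint; have tn := time_level_lt tl n1N.
have inT x : t n.-1 < x <= t n -> 0 < x <= T.
  move=> /andP[x1 x2]; have /andP[n1 nN] := n1N; apply/andP; split.
    by apply: le_lt_trans x1; rewrite (time_level_ge0 tl)// (leq_trans (leq_pred _)).
  by rewrite (le_trans x2)// -(time_level_last tl) (time_level_le tl)// nN leqnn.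
pose prim (x : nat -> R) (s : R) :=
  stage x n * s + slope t x n / 2 * ((s - midpoint t n) * (s - midpoint t n)).
have dprim (x : nat -> R) (s : R) : is_derive s 1 (prim x) (cell_interp t x n s).
  have e1 := derive_scale (stage x n) (is_derive_id s (1 : R)).
  have e2 := derive_sub (is_derive_id s (1 : R)) (is_derive_cst (midpoint t n) s 1).
  have e3 := derive_scale (slope t x n / 2) (derive_mul e2 e2).
  by apply: (is_derive_eq (derive_add e1 e3)); rewrite /cell_interp /cst; field.
have prim_inc x : prim x (t n) - prim x (t n.-1) = tau t n * stage x n.
  by rewrite /prim /midpoint /tau; field.
pose G s := (\int[mu]_(r in `[t n.-1, s]) g r)%R.
have dG (s : R) : t n.-1 < s < t n -> is_derive s 1 G (g s).
  move=> /andP[s1 s2].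
  have [|dd dv] := @continuous_FTC1_closed _ g (t n.-1) s (t n) s2 gint s1.
    by apply: g_cont; apply: inT; rewrite s1 ltW.
  by apply: DeriveDef; [exact: dd|rewrite -derive1E; exact: dv].
have cG : {within `[t n.-1, t n], continuous G}.
  exact: parameterized_integral_continuous (ltW tn) gint.
pose hn i := h (t i); pose yn i := y (t i); pose bn j i := b j (t i).
pose M s := \sum_(j < m) \sum_(1 <= p < n.+1)
  (stage (bn j) p * moment0 (al j) p s - slope t (bn j) p * moment1 (al j) p s).
pose dM s := \sum_(j < m) \sum_(1 <= p < n.+1)
  (stage (bn j) p * dmoment0 (al j) p s - slope t (bn j) p * dmoment1 (al j) p s).
have dMP (s : R) : is_derive s 1 M (dM s).
  apply: derive_sum => j; apply: derive_sum => p.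
  exact: derive_sub (derive_scale _ (is_derive_moment0 (al0 j) p s))
    (derive_scale _ (is_derive_moment1 (al0 j) p s)).
pose err p := interp_error alpha Cgam t p.
pose E s := (Kh + kappa * Ky) * err n * s + \sum_(j < m) \sum_(1 <= p < n.+1)
  Kb * err p * moment0 (al j) p s.
pose dE s := (Kh + kappa * Ky) * err n + \sum_(j < m) \sum_(1 <= p < n.+1)
  Kb * err p * dmoment0 (al j) p s.
have dEP (s : R) : is_derive s 1 E (dE s).
  apply: derive_add.
    by apply: (is_derive_eq (derive_scale _ (is_derive_id s (1 : R)))); rewrite mulr1.
  apply: derive_sum => j; apply: derive_sum => p.
  exact: derive_scale (is_derive_moment0 (al0 j) p s).
(* In the derivative of [D] the data cancel and only differences between a function and its
   interpolant survive; [E] is an antiderivative of their bounds. *)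
pose D s := y s + prim hn s + M s - kappa * prim yn s - G s.
pose mem j x := (\int[mu]_(s in `[0%R, x]) (omega (al j) (x - s) * b j s))%R.
pose dD s := (g s - h s - \sum_(j < m) mem j s + kappa * y s) + cell_interp t hn n s
  + dM s - kappa * cell_interp t yn n s - g s.
have dDP (s : R) : t n.-1 < s < t n -> is_derive s 1 D (dD s).
  move=> sn; have sT : 0 < s <= T by apply: inT; case/andP: sn => -> /ltW.
  apply: derive_sub (dG s sn); apply: derive_sub (derive_scale _ (dprim _ _)).
  exact: derive_add (derive_add (y_eq sT) (dprim _ _)) (dMP s).
have cD : {within `[t n.-1, t n], continuous D}.
  apply: within_continuous_sub cG.
  apply: within_continuous_sub; last first.
    exact: within_is_derive_continuous (fun s => derive_scale kappa (dprim yn s)).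
  apply: within_continuous_add; last exact: within_is_derive_continuous dMP.
  apply: within_continuous_add; last exact: within_is_derive_continuous (dprim hn).
  have [cy _ _ _] := yreg; apply: continuous_subspaceW cy.
  have /andP[n1 nN] := n1N.
  apply: subset_itv; rewrite bnd_simp.
    by rewrite (time_level_ge0 tl)// (leq_trans (leq_pred _)).
  by rewrite -(time_level_last tl) (time_level_le tl)// nN leqnn.
have bound (s : R) : t n.-1 < s < t n -> `|dD s| <= dE s.
  move=> sn; have /andP[s1 s2] := sn.
  have hle := cell_error tl a0 a1 C0 t_ratio Kh0 hreg n1N (s := s).
  have yle := cell_error tl a0 a1 C0 t_ratio Ky0 yreg n1N (s := s).
  have sn' : t n.-1 <= s <= t n by rewrite !ltW.
  have {}hle := hle sn'; have {}yle := ler_wpM2l kappa0 (yle sn').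
  have Mle : `|\sum_(j < m) mem j s - dM s| <= \sum_(j < m) \sum_(1 <= p < n.+1)
      Kb * err p * dmoment0 (al j) p s.
    rewrite /dM -sumrB; apply: le_trans (ler_norm_sum _ _ _) _.
    apply: ler_sum => j _.
    exact: (memory_error (al0 j) Kb0 (breg j) (@memory_int j) n1N sn).
  have -> : dD s = - (h s - cell_interp t hn n s) - (\sum_(j < m) mem j s - dM s)
      + kappa * (y s - cell_interp t yn n s) by rewrite /dD; ring.
  apply: le_trans (ler_normD _ _) _; rewrite normrM (ger0_norm kappa0).
  apply: le_trans (lerD (ler_normB _ _) (lexx _)) _; rewrite normrN /dE.
  move: hle yle Mle; rewrite -/hn -/yn -/(err n).
  move: `|h s - _| `|_ - dM s| `|y s - _| (\sum_(j < m) _) => *; lra.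
have := le_increment (ltW tn) dDP (fun x _ => dEP x) bound cD
  (within_is_derive_continuous dEP).
have -> : E (t n) - E (t n.-1) = (Kh + kappa * Ky) * err n * tau t n
     + \sum_(j < m) \sum_(1 <= p < n.+1) Kb * err p * cell_weight t (al j) n p.
  rewrite /E opprD addrACA -mulrBr -/(tau t n) -sumrB; congr (_ + _).
  apply: eq_bigr => j _; rewrite -sumrB; apply: eq_bigr => p _.
  by rewrite -mulrBr moment0_increment.
apply: le_trans; rewrite le_eqVlt; apply/orP; left; apply/eqP; congr (`| _ |).
have -> : \sum_(j < m) \sum_(1 <= p < n.+1)
      (stage (bn j) p * cell_weight t (al j) n p
       - slope t (bn j) p * (moment1 (al j) p (t n) - moment1 (al j) p (t n.-1))) =
    M (t n) - M (t n.-1).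
  rewrite /M -sumrB; apply: eq_bigr => j _; rewrite -sumrB; apply: eq_bigr => p _.
  by rewrite -moment0_increment; ring.
rewrite -!prim_inc /D -/(G (t n)).
have -> : G (t n.-1) = 0 by rewrite /G set_itv1 Rintegral_set1.
by rewrite -/hn -/yn; ring.
Qed.

End LocalError.
End MemoryError.

(** * Sums of local errors *)

Section TruncationSums.
Context {R : realType}.
Local Notation mu := (@lebesgue_measure R).
Variables (T alpha gamma Cgam cgam k : R) (N : nat) (t : nat -> R).
Hypotheses (tl : time_levels T N t) (gm : graded_mesh gamma Cgam cgam k N t).
Hypotheses (a0 : 0 < alpha) (a1 : alpha < 1) (C0 : 0 < Cgam) (k0 : 0 < k).

Let s := alpha - 2 / gamma.

Definition mesh_error : R :=
  t 1%N `^ (alpha + 1)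
  + k ^+ 2 * (\sum_(2 <= n < N.+1) tau t n * t n `^ (alpha - 2 / gamma)).

Let N1 : (1 <= N)%N. Proof. by case: tl. Qed.
Let t1_gt0 : 0 < t 1%N. Proof. exact: (time_level_gt0 tl). Qed.

Lemma graded_ratio n : (2 <= n <= N)%N -> t n <= Cgam * t n.-1.
Proof. by case: gm => _ _ h _; exact: h. Qed.

Let t_gt0 n : (1 <= n <= N)%N -> 0 < t n.
Proof. exact: (time_level_gt0 tl). Qed.

Lemma tau_mono n : (2 <= n < N)%N -> tau t n <= tau t n.+1.
Proof. by case: gm => _ _ _ h /h /andP[+ _]; rewrite subr_ge0. Qed.

Lemma tau_mono_le i j : (2 <= i <= j)%N -> (j <= N)%N -> tau t i <= tau t j.
Proof.
move=> /andP[i2]; elim: j => [|j IH]; first by rewrite leqn0 => /eqP->.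
rewrite leq_eqVlt => /predU1P[->//|]; rewrite ltnS => ij jN.
by rewrite (le_trans (IH ij (ltnW jN)))// tau_mono// jN (leq_trans i2 ij).
Qed.

(** Two of the three factors of the step are spent on the grading condition, which trades them for
    k^2 and a power of t_n; the third remains as the measure of the cell. *)
Lemma tau_cube_le n : (1 <= n <= N)%N ->
  tau t n ^+ 3 * t n `^ (alpha - 2) <= Cgam ^+ 2 * (k ^+ 2 * (tau t n * t n `^ s)).
Proof.
move=> n1N; have [h _ _ _] := gm.
have tn0 := t_gt0 n1N; have tau0 := ltW (tau_gt0 tl n1N).
pose w := t n `^ (1 - 1 / gamma).
have tw : tau t n <= Cgam * k * w.
  apply: le_trans (h n n1N) _; rewrite ler_wpM2l ?mulr_ge0 ?(ltW C0) ?(ltW k0)//.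
  by rewrite ge_min lexx orbT.
have -> : t n `^ s = w ^+ 2 * t n `^ (alpha - 2).
  rewrite -powR_mulrn ?powR_ge0// -powRrM -powRD ?(gt_eqF tn0) ?implybT//.
  congr (_ `^ _); rewrite /s; ring.
have p0 : 0 <= tau t n * t n `^ (alpha - 2) by rewrite mulr_ge0 ?powR_ge0.
have : tau t n ^+ 2 <= (Cgam * k * w) ^+ 2 by rewrite ler_pXn2r ?nnegrE ?(le_trans tau0 tw).
move=> /(ler_wpM2r p0); rewrite !exprMn.
clear tw; move: (tau t n) (t n `^ (alpha - 2)) (w) => x y w'; rewrite !exprS expr0; lra.
Qed.

Lemma mesh_error_ge0 : 0 <= mesh_error.
Proof.
rewrite addr_ge0 ?powR_ge0// mulr_ge0 ?sqr_ge0// big_nat sumr_ge0// => n /andP[n2 nN].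
by rewrite mulr_ge0 ?powR_ge0// ltW// (tau_gt0 tl)// (ltnW n2).
Qed.

Lemma le_mesh_error (F : nat -> R) (A B : R) : 0 <= A -> 0 <= B ->
  F 1%N <= A * t 1%N `^ (alpha + 1) ->
  (forall n, (2 <= n <= N)%N -> F n <= B * (k ^+ 2 * (tau t n * t n `^ s))) ->
  \sum_(1 <= n < N.+1) F n <= (A + B) * mesh_error.
Proof.
move=> A0 B0 F1 Fn; rewrite big_nat_recl//= [leRHS]mulrDl.
have h1 : F 1%N <= A * mesh_error.
  apply: le_trans F1 _; rewrite ler_wpM2l// /mesh_error lerDl.
  rewrite mulr_ge0 ?sqr_ge0// big_nat sumr_ge0// => n /andP[n2 nN].
  by rewrite mulr_ge0 ?powR_ge0// ltW// (tau_gt0 tl)// (ltnW n2).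
apply: lerD => //.
have -> : \sum_(1 <= i < N) F i.+1 = \sum_(2 <= n < N.+1) F n by rewrite [RHS]big_add1.
apply: (@le_trans _ _ (B * (k ^+ 2 * \sum_(2 <= n < N.+1) tau t n * t n `^ s))).
  by rewrite !mulr_sumr; apply: ler_sum_nat => n; exact: Fn.
by rewrite ler_wpM2l// /mesh_error lerDr powR_ge0.
Qed.

Lemma interp_error_sum :
  \sum_(1 <= n < N.+1) interp_error alpha Cgam t n * tau t n <=
  (alpha^-1 + Cgam `^ (2 - alpha) * Cgam ^+ 2) * mesh_error.
Proof.
apply: le_mesh_error.
- by rewrite invr_ge0 ltW.
- by rewrite mulr_ge0 ?powR_ge0 ?sqr_ge0.
- rewrite /interp_error/= /tau (time_level0 tl) subr0.
  rewrite powRD ?(gt_eqF t1_gt0) ?implybT// powRr1 ?(ltW t1_gt0)//.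
  by rewrite mulrCA mulrA.
move=> n /andP[n2 nN]; rewrite /interp_error leqNgt n2/= -!mulrA ler_wpM2l ?powR_ge0//.
have := @tau_cube_le n; rewrite (ltnW n2) nN => /(_ isT).
by rewrite exprS; lra.
Qed.

Section FirstMoments.
Context {V : normedModType R}.
Variables (a : R) (z : nat -> V) (K : R).
Hypotheses (ap : 0 < a) (ap1 : a < 1) (K0 : 0 <= K) (z1 : z 1%N = 0).
Hypothesis z_le : forall n, (2 <= n <= N)%N -> `|z n| <= K * t n.-1 `^ (alpha - 1).
Hypothesis z_diff : forall n, (3 <= n <= N)%N ->
  `|z n - z n.-1| <= K * t n.-2 `^ (alpha - 2) * (tau t n + tau t n.-1).

Let coef n p := peano_coef a (t n - t p) (tau t p).

Let moment1_coef n p : (1 <= p <= n)%N -> (n <= N)%N ->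
  moment1 t a p (t n) = tau t p ^+ 3 * coef n p.
Proof.
move=> /andP[p1 pn] nN.
rewrite peano_coefE//.
- have -> : t n - t p + tau t p = t n - t p.-1 by rewrite /tau; ring.
  by rewrite /moment1 addrC [_ * (_ + _)]mulrC; ring.
- by rewrite subr_ge0 (time_level_le tl)// pn.
- by rewrite (tau_gt0 tl)// p1 (leq_trans pn).
Qed.

Let moment1_self n : (1 <= n <= N)%N -> moment1 t a n (t n.-1) = 0.
Proof.
move=> n1N; have h : t n.-1 - t n <= 0 by rewrite subr_le0 ltW// (time_level_lt tl).
by rewrite /moment1 !omega2_le0 ?omega3_le0 ?subrr// !addr0 mulr0 subr0.
Qed.

(** One [omega1 a T] pays for the diagonal term, the other for the telescoping remainder. The latter
    needs tau_p at most tau_n, hence [2 <= p]. *)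
Let coef_col p : (2 <= p <= N)%N ->
  tau t p * \sum_(p <= n < N.+1) coef n p <= 2 * omega1 a T.
Proof.
move=> /andP[p2 pN]; have p1N : (1 <= p <= N)%N by rewrite (ltnW p2).
have tp := tau_gt0 tl p1N.
have o1T x : x <= T -> omega1 a x <= omega1 a T by exact: omega1_homo.
rewrite big_ltn ?ltnS// mulrDr [leRHS]mulr_natl mulr2n; apply: lerD.
  rewrite /coef subrr; apply: le_trans (peano_coef_le_omega1 ap (lexx 0) tp) _.
  rewrite add0r (omega1_le0 ap (lexx 0)) subr0; apply: o1T.
  rewrite /tau -(time_level_last tl); have := time_level_le tl (_ : (p <= N <= N)%N).
  rewrite pN leqnn => /(_ isT); have := @time_level_ge0 _ _ _ _ tl p.-1.
  by rewrite (leq_trans (leq_pred _) pN) => /(_ isT); lra.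
rewrite mulr_sumr.
apply: (@le_trans _ _ (\sum_(p.+1 <= n < N.+1)
    (omega1 a (t n - t p) - omega1 a (t n.-1 - t p)))).
  apply: ler_sum_nat => n /andP[pn]; rewrite ltnS => nN.
  have -> : t n.-1 - t p = t n - t p - tau t n by rewrite /tau; ring.
  apply: peano_coef_le_increment => //.
    by rewrite tau_mono_le// p2 ltnW.
  rewrite /tau lerD2l lerN2 (time_level_le tl)// (leq_trans (leq_pred _) nN) andbT.
  by case: n pn {nN}.
rewrite big_add1/= (telescope_sumr (fun n => omega1 a (t n - t p)))// subrr.
rewrite (omega1_le0 ap (lexx 0)) subr0; apply: o1T.
by rewrite (time_level_last tl) gerBl (time_level_ge0 tl).
Qed.

(** The index is shifted by one because the steps are assumed monotone only from the second on. The
    vanishing first slope then provides [Z 0 = 0]. *)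
Let Z i := tau t i.+1 ^+ 3 *: z i.+1.

Let D := \sum_(1 <= n < N.+1) `|\sum_(1 <= p < n.+1)
  (moment1 t a p (t n) - moment1 t a p (t n.-1)) *: z p|.

Let NP : N.-1.+1 = N. Proof. by rewrite prednK. Qed.

Let D_shift : D = \sum_(1 <= n < N.-1.+1)
  `|\sum_(1 <= p < n.+1) coef n.+1 p.+1 *: Z p
    - \sum_(1 <= p < n) coef n.-1.+1 p.+1 *: Z p|.
Proof.
rewrite /D big_nat_recl//= big_nat1 z1 scaler0 normr0 add0r NP.
apply: eq_big_nat => n /andP[n1 nN]; congr (`| _ |).
have n1N : (1 <= n.+1 <= N)%N by [].
rewrite prednK//.
rewrite big_nat_recl//= z1 scaler0 add0r.
under eq_bigr do rewrite scalerBl.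
rewrite sumrB; congr (_ - _).
  apply: eq_big_nat => p /andP[p1 pn]; rewrite moment1_coef// ?scalerA 1?mulrC//.
rewrite big_nat_recr//= -/(t n) (_ : t n = t n.+1.-1)// moment1_self// scale0r addr0/=.
by apply: eq_big_nat => p /andP[p1 pn]; rewrite moment1_coef// ?scalerA 1?mulrC// ltnW.
Qed.

Let D_le : D <= 4 * omega1 a T * \sum_(1 <= p < N.-1.+1) `|Z p - Z p.-1| / tau t p.+1.
Proof.
rewrite D_shift; apply: le_trans
  (norm_shifted_sum_le (a := fun n p => coef n.+1 p.+1) (Z := Z) (N := N.-1) _ _ _) _.
- by rewrite /Z z1 scaler0.
- move=> n p /andP[pn nN]; rewrite -ltnS NP in nN.
  exact: peano_coef_ge0.
- move=> n p p1 /andP[pn nN]; rewrite -ltnS NP in nN.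
  have n0 : (0 < n)%N by exact: leq_ltn_trans pn.
  rewrite (prednK n0).
  have d0 : 0 <= t n - t p.+1 by rewrite subr_ge0 (time_level_le tl)// pn ltnW.
  have tp0 : 0 < tau t p.+1 by rewrite (tau_gt0 tl)//= (leq_trans pn)// ltnW.
  have h1 := tau_mono_le (i := p.+2) (j := n.+1) pn nN.
  have h2 : tau t p.+1 <= tau t p.+2.
    by apply: tau_mono_le; rewrite ?ltnS ?p1//= (leq_ltn_trans pn).
  have h3 : t n - t p.+1 <= t n.+1 - t p.+2 by move: h1; rewrite /tau/=; lra.
  exact: (peano_coef_nincr ap ap1 d0 tp0 h3 h2).
rewrite (exchange_triangular (fun n p => coef n.+1 p.+1 * `|Z p - Z p.-1|)).
rewrite (_ : 4 * omega1 a T = 2 * (2 * omega1 a T)); last by ring.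
rewrite -mulrA ler_wpM2l// mulr_sumr; apply: ler_sum_nat => p /andP[p1]; rewrite NP => pN.
rewrite -mulr_suml [leRHS]mulrCA mulrC ler_wpM2l//.
have tp : 0 < tau t p.+1 by rewrite (tau_gt0 tl).
rewrite ler_pdivlMr// mulrC; have := @coef_col p.+1; rewrite ltnS p1 pN => /(_ isT).
by rewrite big_add1.
Qed.

(** The summands come from the initial jump [Z 1 - Z 0], from the differences of slopes, and from
    the differences of consecutive steps. *)
Definition moment_constant : R :=
  Cgam ^+ 2 + (2 * Cgam `^ (2 - alpha) ^+ 2 * Cgam ^+ 2
    + 3 * Cgam * Cgam `^ (1 - alpha) * (1 + Cgam `^ (- s))).

Lemma moment_constant_ge0 : 0 <= moment_constant.
Proof.
have C := ltW C0.
by rewrite !addr_ge0 ?mulr_ge0 ?addr_ge0 ?sqr_ge0 ?exprn_ge0 ?powR_ge0.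
Qed.

(** The exponent [s] may have either sign: 1 suffices when the power increases, the level ratio when
    it decreases. *)
Let pow_pred_s n : (2 <= n <= N)%N -> t n.-1 `^ s <= (1 + Cgam `^ (- s)) * t n `^ s.
Proof.
move=> n2N; have /andP[n2 nN] := n2N.
have tn0 := t_gt0 (_ : (1 <= n <= N)%N).
have {}tn0 : 0 < t n by apply: tn0; rewrite (ltnW n2).
have h1 : 0 <= Cgam `^ (- s) * t n `^ s by rewrite mulr_ge0 ?powR_ge0.
have h2 : 0 <= t n `^ s by exact: powR_ge0.
rewrite mulrDl mul1r; have [s0|s0] := leP s 0.
  have := pow_level_pred tl C0 graded_ratio n2N (_ : 0 <= - s).
  rewrite oppr_ge0 opprK => /(_ s0) h3; lra.
suff : t n.-1 `^ s <= t n `^ s by lra.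
rewrite ge0_ler_powR ?nnegrE ?(ltW s0) ?(ltW tn0)//.
  by rewrite (time_level_ge0 tl)// (leq_trans (leq_pred _) nN).
by rewrite (time_level_le tl)// leq_pred.
Qed.

Let Z_first : (2 <= N)%N -> `|Z 1 - Z 0| / tau t 2 <= K * Cgam ^+ 2 * t 1%N `^ (alpha + 1).
Proof.
move=> N2; have n2 : (2 <= 2 <= N)%N by [].
have t2 : 0 < tau t 2 by rewrite (tau_gt0 tl)// N2.
rewrite /Z z1 scaler0 subr0 normrZ ger0_norm ?exprn_ge0 ?(ltW t2)//.
have -> : tau t 2 ^+ 3 * `|z 2| / tau t 2 = tau t 2 ^+ 2 * `|z 2|.
  by field; rewrite gt_eqF.
have t2le : tau t 2 <= Cgam * t 1%N.
  by apply: le_trans (graded_ratio n2); rewrite /tau gerBl ltW.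
have e1 : t 1%N `^ (alpha + 1) = t 1%N ^+ 2 * t 1%N `^ (alpha - 1).
  rewrite -powR_mulrn ?(ltW t1_gt0)// -powRD ?(gt_eqF t1_gt0) ?implybT//.
  by congr (_ `^ _); ring.
have -> : K * Cgam ^+ 2 * t 1%N `^ (alpha + 1) =
    (Cgam * t 1%N) ^+ 2 * (K * t 1%N `^ (alpha - 1)) by rewrite e1; ring.
apply: ler_pM => //; first exact: sqr_ge0.
- by rewrite ler_pXn2r ?nnegrE ?(ltW t2)// mulr_ge0 ?ltW.
- exact: z_le n2.
Qed.

Let Z_later q : (3 <= q <= N)%N -> `|Z q.-1 - Z q.-2| / tau t q <=
  K * (2 * Cgam `^ (2 - alpha) ^+ 2 * Cgam ^+ 2
    + 3 * Cgam * Cgam `^ (1 - alpha) * (1 + Cgam `^ (- s)))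
  * (k ^+ 2 * (tau t q * t q `^ s)).
Proof.
case: q => [|[|[|q]]]// /andP[_ qN]; rewrite /=.
set n := q.+3; set x := tau t q.+3; set y := tau t q.+2.
have h3 : (3 <= q.+3 <= N)%N by [].
have h2 : (2 <= q.+3 <= N)%N by [].
have h2' : (2 <= q.+2 <= N)%N by rewrite /= ltnW.
have h1 : (1 <= q.+3 <= N)%N by [].
have h1' : (1 <= q.+2 <= N)%N by rewrite /= ltnW.
have x0 : 0 < x by exact: (tau_gt0 tl).
have y0 : 0 < y by exact: (tau_gt0 tl).
have yx : y <= x by apply: tau_mono_le; rewrite /= ?ltnS ?leqnSn.
have tq0 := t_gt0 h1; have tq0' := t_gt0 h1'.
(* Discrete product rule: the difference falls either on the slope or on the cubed step, and x^3 -
   y^3 is at most 3 x^2 (x - y). *)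
have step : `|Z q.+2 - Z q.+1| / x <=
    x ^+ 2 * `|z q.+3 - z q.+2| + 3 * x * (x - y) * `|z q.+2|.
  have -> : Z q.+2 - Z q.+1 = x ^+ 3 *: (z q.+3 - z q.+2) + (x ^+ 3 - y ^+ 3) *: z q.+2.
    by rewrite /Z -/x -/y scalerBr scalerBl addrA subrK.
  rewrite ler_pdivrMr//; apply: le_trans (ler_normD _ _) _; rewrite (normrZ (x ^+ 3)) (normrZ (x ^+ 3 - y ^+ 3)).
  have xy3 : 0 <= x ^+ 3 - y ^+ 3 by rewrite subr_ge0 lerXn2r ?nnegrE ?(ltW x0) ?(ltW y0).
  rewrite (ger0_norm xy3) (ger0_norm (exprn_ge0 3 (ltW x0))) [leRHS]mulrDl; apply: lerD.
    by rewrite [leRHS]mulrAC -exprSr.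
  rewrite [leRHS]mulrAC ler_wpM2r//.
  have h : 0 <= (x - y) * ((x - y) * (2 * x + y)).
    by rewrite !mulr_ge0 ?subr_ge0// addr_ge0 ?mulr_ge0 ?ltW.
  by rewrite !exprS expr0; lra.
have zd := z_diff h3; rewrite /= -/x -/y in zd.
have zl := z_le h2'; rewrite /= in zl.
(* The smoothness of the mesh enters here: consecutive steps differ by a second-order amount. *)
have xy : x - y <= Cgam * k ^+ 2 * t q.+2 `^ (1 - 2 / gamma).
  have [_ _ _ /(_ q.+2)] := gm; rewrite /= qN => /(_ isT) /andP[_ h].
  apply: le_trans h _; rewrite ler_wpM2l ?(mulr_ge0 (ltW C0) (sqr_ge0 k))//.
  by rewrite ge_min lexx orbT.
have al2 : 0 <= 2 - alpha by rewrite subr_ge0 ltW// (lt_trans a1)// ltr1n.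
have al1 : 0 <= 1 - alpha by rewrite subr_ge0 ltW.
have p2 := pow_level_pred tl C0 graded_ratio h2 al2.
have p2' := pow_level_pred tl C0 graded_ratio h2' al2.
have p1' := pow_level_pred tl C0 graded_ratio h2' al1.
rewrite !opprB /= in p2 p2' p1'.
have ps := pow_pred_s h2; rewrite /= in ps.
have cube := tau_cube_le h1; rewrite -/x in cube.
set G2 := Cgam `^ (2 - alpha) in p2 p2' *; set G1 := Cgam `^ (1 - alpha) in p1' *.
have G20 : 0 <= G2 by exact: powR_ge0.
have G10 : 0 <= G1 by exact: powR_ge0.
set Y := k ^+ 2 * (x * t q.+3 `^ s); rewrite -/Y in cube.
have t1 : x ^+ 2 * `|z q.+3 - z q.+2| <= K * (2 * G2 ^+ 2 * Cgam ^+ 2) * Y.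
  have e1 : `|z q.+3 - z q.+2| <= K * (G2 ^+ 2 * t q.+3 `^ (alpha - 2)) * (2 * x).
    apply: le_trans zd _; apply: ler_pM.
    - by rewrite mulr_ge0 ?powR_ge0.
    - by rewrite addr_ge0 ?(ltW x0) ?(ltW y0).
    - rewrite ler_wpM2l//; apply: le_trans p2' _.
      by rewrite expr2 -mulrA ler_wpM2l.
    - by rewrite mulr_natl mulr2n lerD2l.
  apply: le_trans (ler_wpM2l (sqr_ge0 _) e1) _.
  have -> : x ^+ 2 * (K * (G2 ^+ 2 * t q.+3 `^ (alpha - 2)) * (2 * x)) =
    K * (2 * G2 ^+ 2) * (x ^+ 3 * t q.+3 `^ (alpha - 2)) by ring.
  rewrite [leRHS](_ : _ = K * (2 * G2 ^+ 2) * (Cgam ^+ 2 * Y)); last by ring.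
  by rewrite ler_wpM2l// !mulr_ge0// exprn_ge0.
have t2 : 3 * x * (x - y) * `|z q.+2| <=
    K * (3 * Cgam * G1 * (1 + Cgam `^ (- s))) * Y.
  have e2 : t q.+2 `^ (1 - 2 / gamma) * t q.+2 `^ (alpha - 1) = t q.+2 `^ s.
    rewrite -powRD ?(gt_eqF tq0') ?implybT//; congr (_ `^ _); rewrite /s; ring.
  apply: (@le_trans _ _ (3 * x * (Cgam * k ^+ 2 * t q.+2 `^ (1 - 2 / gamma))
      * (K * (G1 * t q.+2 `^ (alpha - 1))))).
    apply: ler_pM => //.
    - have xy0 : 0 <= x - y by rewrite subr_ge0.
      by rewrite !mulr_ge0 ?(ltW x0).
    - by rewrite ler_wpM2l// mulr_ge0 ?(ltW x0).
    - by apply: le_trans zl _; rewrite ler_wpM2l.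
  have -> : 3 * x * (Cgam * k ^+ 2 * t q.+2 `^ (1 - 2 / gamma))
      * (K * (G1 * t q.+2 `^ (alpha - 1))) =
      K * (3 * Cgam * G1) * (k ^+ 2 * x)
      * (t q.+2 `^ (1 - 2 / gamma) * t q.+2 `^ (alpha - 1)) by ring.
  rewrite e2.
  rewrite [leRHS](_ : _ = K * (3 * Cgam * G1) * (k ^+ 2 * x)
    * ((1 + Cgam `^ (- s)) * t q.+3 `^ s)); last by rewrite /Y; ring.
  by rewrite ler_wpM2l// !mulr_ge0 ?(ltW k0) ?(ltW x0) ?(ltW C0).
apply: le_trans step _.
by apply: le_trans (lerD t1 t2) _; rewrite -mulrDl -mulrDr.
Qed.

Lemma moment_increment_sum :
  \sum_(1 <= n < N.+1) `|\sum_(1 <= p < n.+1)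
    (moment1 t a p (t n) - moment1 t a p (t n.-1)) *: z p| <=
  4 * omega1 a T * (K * moment_constant * mesh_error).
Proof.
have o4 : 0 <= 4 * omega1 a T by rewrite mulr_ge0// omega1_ge0.
apply: le_trans D_le _; rewrite (ler_wpM2l o4)//.
have Gs := powR_ge0 Cgam (- s); have Ga := powR_ge0 Cgam (1 - alpha).
have C2 := sqr_ge0 Cgam; have Cp := ltW C0; have a10 := a1.
rewrite /moment_constant [K * _]mulrDr.
have K1 : 0 <= K * Cgam ^+ 2 by rewrite mulr_ge0.
have K2 : 0 <= K * (2 * Cgam `^ (2 - alpha) ^+ 2 * Cgam ^+ 2
    + 3 * Cgam * Cgam `^ (1 - alpha) * (1 + Cgam `^ (- s))).
  apply: mulr_ge0 => //; apply: addr_ge0; first by rewrite !mulr_ge0// powR_ge0.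
  by rewrite !mulr_ge0// addr_ge0.
have [N2|N2] := leqP N 1.
  have -> : N.-1 = 0%N by move: N1 N2; case: N => [|[|]].
  by rewrite big_geq// mulr_ge0 ?mesh_error_ge0// addr_ge0.
pose G q := `|Z q.-1 - Z q.-2| / tau t q.
(* The initial jump, naturally attached to cell 2, is placed in slot 1 to be compared with
   t_1^(alpha + 1); slot 2 is left empty. *)
have -> : \sum_(1 <= p < N.-1.+1) `|Z p - Z p.-1| / tau t p.+1 =
    \sum_(1 <= q < N.+1) (if q == 1%N then G 2 else if q == 2 then 0 else G q).
  have N12 : (1 < N.+1)%N by rewrite ltnW.
  have N3 : (2 < N.+1)%N by [].
  rewrite NP (big_ltn N2) (big_ltn N12) (big_ltn N3) add0r; congr (_ + _).
  rewrite [RHS]big_add1/=; apply: eq_big_nat => p /andP[p2 _].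
  by case: p p2 => [|[|]].
apply: le_mesh_error => //; first exact: Z_first.
move=> q /andP[q2 qN]; rewrite gtn_eqF//; case: eqVneq => [_|q3].
  apply: mulr_ge0 K2 _; apply: mulr_ge0; first exact: sqr_ge0.
  by rewrite mulr_ge0 ?powR_ge0// ltW// (tau_gt0 tl)// ltnW.
by apply: Z_later; rewrite qN ltn_neqAle eq_sym q3 q2.
Qed.

End FirstMoments.
End TruncationSums.

(** * The scheme *)

Section OperatorFacts.
Context {R : realType} {H : completeNormedModType R} {ip : {dot H for idfun}}.
Hypothesis ip_norm : hilbert_norm ip.
Implicit Types (A S B : linop H) (x y w v : H).

Lemma linop0 A : A 0 = 0.
Proof.
have := app_linear 1 (dom0 A) (dom0 A); rewrite !scale1r addr0 => e.
by apply: (addrI (A 0)); rewrite addr0 -e.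
Qed.

Lemma domZ A a x : dom A x -> dom A (a *: x).
Proof. by move=> Ax; have := dom_linear a Ax (dom0 A); rewrite addr0. Qed.

Lemma domD A x y : dom A x -> dom A y -> dom A (x + y).
Proof. by move=> Ax Ay; have := dom_linear 1 Ax Ay; rewrite scale1r. Qed.

Lemma domB A x y : dom A x -> dom A y -> dom A (x - y).
Proof. by move=> Ax Ay; rewrite -scaleN1r; apply: domD => //; exact: domZ. Qed.

Lemma linopZ A a x : dom A x -> A (a *: x) = a *: A x.
Proof. by move=> Ax; have := app_linear a Ax (dom0 A); rewrite !addr0 linop0 addr0. Qed.

Lemma self_adjoint_sym A w v : self_adjoint ip A -> dom A w -> dom A v ->
  ip (A w) v = ip w (A v).
Proof. by move=> [_ sa] Aw Av; have [_ h] := sa v (A v); exact: h. Qed.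

(** The inverse maps the unit ball into a compact, hence bounded set. The resulting inequality
    bounds pairings with [phi] itself by the norm of A w, as the term with kappa requires. *)
Lemma inverse_bounded A : has_compact_inverse A ->
  exists2 M : R, 0 < M & forall w, dom A w -> `|w| <= M * `|A w|.
Proof.
move=> [K [AK KA cK]].
have /compact_bounded [M0 [_ hM]] := cK.
pose M : R := `|M0| + 1.
have M0M : M0 < M by rewrite (le_lt_trans (ler_norm _))// ltrDl.
have bK x : `|x| < 1 -> `|K x| <= M.
  move=> x1; apply: (hM _ M0M); apply: subset_closure; exists x => //.
  by rewrite -ball_normE/= sub0r normrN.
have Mp : 0 < M by rewrite ltr_wpDl.
exists (2 * M); first by rewrite mulr_gt0.
move=> w Aw; have [A0|A0] := eqVneq (A w) 0.
  by rewrite A0 normr0 mulr0 -(KA w Aw) A0 -(linop0 A) KA ?normr0//; exact: dom0.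
have nA : 0 < `|A w| by rewrite normr_gt0.
(* Scales [A w] to norm 1/2, inside the open unit ball. *)
pose c := (2 * `|A w|)^-1.
have cp : 0 < c by rewrite invr_gt0 mulr_gt0.
have := bK (c *: A w); rewrite normrZ (gtr0_norm cp) /c invfM mulfVK ?gt_eqF//.
rewrite invf_lt1// ltr1n => /(_ isT).
rewrite -[_^-1 * _^-1]invfM -/c -linopZ// KA; last exact: domZ.
rewrite normrZ (gtr0_norm cp) /c mulrC ler_pdivrMr ?mulr_gt0//.
by rewrite mulrCA mulrA.
Qed.

Lemma sqrt_op_dom S A w : is_sqrt_op ip S A -> dom A w ->
  [/\ dom S w, dom S (S w) & S (S w) = A w].
Proof. by move=> [_ _ h] Aw; apply/h. Qed.

Lemma ip_sqrt_op S A w : is_sqrt_op ip S A -> dom A w -> ip (A w) w = `|S w| ^+ 2.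
Proof.
move=> sq Aw; have [Sw SSw <-] := sqrt_op_dom sq Aw; have [saS _ _] := sq.
by rewrite (self_adjoint_sym saS)// ip_norm.
Qed.

Lemma form_bound_graph A S B C w v : is_sqrt_op ip S A -> form_bound ip A S B C ->
  dom A w -> `|ip (B w) v| <= C * `|A w| * `|v|.
Proof.
move=> sq fb Aw; have [_ _ <-] := sqrt_op_dom sq Aw.
by apply: (fb 2%N 0%N) => //.
Qed.

Lemma form_bound_energy A S B C w v : is_sqrt_op ip S A -> form_bound ip A S B C ->
  dom A w -> dom A v -> `|ip (B w) v| <= C * `|S w| * `|S v|.
Proof.
move=> sq fb Aw Av; have [Sv _ _] := sqrt_op_dom sq Av.
by apply: (fb 1%N 1%N) => // -[|].
Qed.

End OperatorFacts.

Lemma integrable_itv_oc_cc (R : realType) (a x : R) (f : R -> \bar R) :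
  (@lebesgue_measure R).-integrable `]a, x] f ->
  (@lebesgue_measure R).-integrable `[a, x] f.
Proof.
move=> /integrableP[mf fi]; apply/integrableP; split.
  exact/emeasurable_fun_itv_obnd_cbndP.
rewrite -(@integral_itv_obnd_cbnd _ a (BRight x) (fun z => `|f z|%E))//.
exact: measurableT_comp.
Qed.

Section VectorNodes.
Context {R : realType} {V : lmodType R}.
Implicit Types (x : nat -> V) (t : nat -> R).

Definition vstage x n : V := if (n <= 1)%N then x n else 2^-1 *: (x n + x n.-1).

Definition vslope t x n : V :=
  if (n <= 1)%N then 0 else (tau t n)^-1 *: (x n - x n.-1).

Lemma vstageB x y n : vstage (fun i => x i - y i) n = vstage x n - vstage y n.
Proof. by rewrite /vstage; case: ifP => // _; rewrite -scalerBr opprD addrACA. Qed.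

End VectorNodes.

Section Scheme.
Context {R : realType} {H : completeNormedModType R} {ip : {dot H for idfun}}.
Local Notation mu := (@lebesgue_measure R).
Hypothesis ip_norm : hilbert_norm ip.
Variables (A : linop H) (m : nat) (B : 'I_m -> linop H) (al : 'I_m -> R).
Variables (T kappa alpha CB Cu M Cgam : R) (f u : R -> H) (u0 : H).
Hypotheses (A_sa : self_adjoint ip A) (M0 : 0 <= M) (CB0 : 0 <= CB) (Cu0 : 0 <= Cu).
Hypothesis A_inv : forall w, dom A w -> `|w| <= M * `|A w|.
Hypothesis B_sa : forall j, self_adjoint ip (B j).
Hypothesis B_dom : forall j, dom A `<=` dom (B j).
Hypothesis B_le : forall j w phi, dom A w -> `|ip (B j w) phi| <= CB * `|A w| * `|phi|.
Hypothesis sol : exact_solution A B al kappa f u0 u.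

Let v (s : R) := expR (kappa * s) *: u s.
Let g (s : R) := expR (kappa * s) *: f s.

Hypothesis v_reg : solution_regularity A T v (fun s => Cu * s `^ (alpha - 1)).

Lemma dom_scaled_solution (s : R) : 0 < s -> dom A (v s).
Proof. by move=> s0; have [_ _ /(_ s s0) [_ Au _ _]] := sol; exact: domZ. Qed.

Lemma paired_continuous psi : {within `[0, T], continuous (fun s => ip (v s) psi)}.
Proof.
have [cu _ _] := sol.
have cE : {within `[0, T], continuous (fun s : R => expR (kappa * s))}.
  apply: continuous_subspaceT => x.
  apply: continuous_comp; last exact: continuous_expR.
  by apply: cvgM; [exact: cvg_cst|exact: cvg_id].
have {}cu : {within `[0, T], continuous u}.
  by apply: continuous_subspaceW cu; apply: subset_itvl.
move=> x; have vx := cvgZ (cE x) (cu x).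
apply: (@cvg_comp _ _ _ _ (ip ^~ psi) _ _ _ (vx _)).
exact: continuous_ip.
Qed.

(** A functional dominated by the norm of A w inherits the rates of A v' and A v''. Continuity up to
    0 comes from [v] alone, as [psi] is a fixed element. *)
Lemma paired_weakly_singular psi K : 0 <= K ->
  (forall w, dom A w -> `|ip w psi| <= K * `|A w|) ->
  weakly_singular T alpha (K * Cu) (fun s => ip (v s) psi)
    (fun s => ip (derive1 v s) psi) (fun s => ip (derive1 (derive1 v) s) psi).
Proof.
move=> K0 psiK; have [dv bv] := v_reg; split.
- exact: paired_continuous.
- by move=> s sT; have [d1 d2] := dv s sT; split; exact: is_derive_ip.
- move=> s sT; have [d1 d2 b] := bv s sT; apply: le_trans (psiK _ d1) _.
  rewrite -mulrA ler_wpM2l//; apply: le_trans b.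
  have s0 : 0 <= s by case/andP: sT => /ltW.
  by rewrite lerDr addr_ge0// mulr_ge0.
move=> s sT; have [d1 d2 b] := bv s sT; apply: le_trans (psiK _ d2) _.
rewrite -mulrA ler_wpM2l//.
have s0 : 0 < s by case/andP: sT.
rewrite -(ler_pM2l s0).
have -> : s * (Cu * s `^ (alpha - 2)) = Cu * s `^ (alpha - 1).
  rewrite mulrCA -{1}(powRr1 (ltW s0)) -powRD ?(gt_eqF s0) ?implybT//.
  by congr (_ * _ `^ _); ring.
by apply: le_trans b; rewrite -addrA lerDl addr_ge0.
Qed.

Lemma graph_bound_A phi : dom A phi ->
  forall w, dom A w -> `|ip w (A phi)| <= `|phi| * `|A w|.
Proof.
move=> Aphi w Aw; rewrite -(self_adjoint_sym A_sa)// mulrC.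
exact: cauchy_schwarz.
Qed.

Lemma graph_bound_B j phi : dom A phi ->
  forall w, dom A w -> `|ip w (B j phi)| <= CB * `|phi| * `|A w|.
Proof.
move=> Aphi w Aw; rewrite -(self_adjoint_sym (B_sa j)); [|exact: B_dom..].
by apply: le_trans (B_le _ _ Aw) _; rewrite mulrAC.
Qed.

Lemma graph_bound_id phi : forall w, dom A w -> `|ip w phi| <= M * `|phi| * `|A w|.
Proof.
move=> w Aw; apply: le_trans (cauchy_schwarz ip_norm _ _) _.
by rewrite [leRHS]mulrAC ler_wpM2r// A_inv.
Qed.

(** The factor [expR (kappa * x)] splits into the part that turns [beta] into [omega] and the part
    that turns [u] into [v]; self-adjointness then puts [B j] on [phi]. *)
Lemma paired_memory j (x : R) phi : 0 < x -> dom A phi ->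
  mu.-integrable `[0, x]
    (EFin \o (fun s => omega (al j) (x - s) * ip (v s) (B j phi))) /\
  expR (kappa * x) *
    ip (bochner `[0, x] (fun s => beta kappa (al j) (x - s) *: B j (u s))) phi =
  (\int[mu]_(s in `[0, x]) (omega (al j) (x - s) * ip (v s) (B j phi)))%R.
Proof.
move=> x0 Aphi; have [_ _ /(_ x x0) [_ _ /(_ j) bint _]] := sol.
have mI : measurable (`[0, x]%classic : set (measurableTypeR R)).
  exact: measurable_itv.
have [i e] := ip_bochner ip_norm mI phi bint.
rewrite e -RintegralZl//.
set F := fun s : R => ip (beta kappa (al j) (x - s) *: B j (u s)) phi.
set G := fun s : R => omega (al j) (x - s) * ip (v s) (B j phi).
(* The initial value need not lie in the domain of [B j], so the two integrands are compared away
   from 0 only; a single point does not affect the integrals. *)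
have FG : {in `]0, x]%classic, forall s, expR (kappa * x) * F s = G s}.
  move=> s; rewrite inE/= in_itv/= => /andP[s0 sx]; rewrite /F /G /v !ipZl /beta.
  have [_ _ /(_ s s0) [_ Au _ _]] := sol.
  rewrite (self_adjoint_sym (B_sa j)); [|exact: B_dom..].
  have <- : expR (kappa * x) * expR (- kappa * (x - s)) = expR (kappa * s).
    by rewrite -expRD; congr expR; ring.
  by ring.
have iF : mu.-integrable `]0, x] (EFin \o (fun s => expR (kappa * x) * F s)).
  have i' := integrableZl mI (expR (kappa * x)) i.
  by apply: integrableS i' => //; apply: subset_itvr; rewrite bnd_simp.
have iG : mu.-integrable `]0, x] (EFin \o G).
  apply: eq_integrable iF => //.
  by move=> s /FG /= ->.
split; first exact: integrable_itv_oc_cc.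
rewrite -(@Rintegral_itv_obnd_cbnd _ 0 (BRight x) _ iF).
rewrite -(@Rintegral_itv_obnd_cbnd _ 0 (BRight x) _ iG).
exact: eq_Rintegral.
Qed.

Lemma paired_equation (x : R) phi : 0 < x -> dom A phi ->
  is_derive x 1 (fun s => ip (v s) phi)
    (ip (g x) phi - ip (v x) (A phi)
     - \sum_(j < m) (\int[mu]_(s in `[0%R, x])
         (omega (al j) (x - s) * ip (v s) (B j phi)))%R
     + kappa * ip (v x) phi).
Proof.
move=> x0 Aphi; have [_ _ /(_ x x0) [du Au bint eqx]] := sol.
have dE : is_derive x 1 (fun s : R => expR (kappa * s)) (expR (kappa * x) * kappa).
  have := derive_scale kappa (is_derive_id x (1 : R)); rewrite mulr1 => h.
  have := @is_derive1_comp _ expR (fun s => kappa * s) x _ _ (is_derive_expR (kappa * x)) h.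
  by [].
have -> : (fun s => ip (v s) phi) = (fun s => expR (kappa * s) * ip (u s) phi).
  by apply/funext => s; rewrite /v ipZl.
apply: (is_derive_eq (derive_mul dE (is_derive_ip ip_norm phi du))).
under [in RHS]eq_bigr do rewrite -(proj2 (paired_memory _ x0 Aphi)).
rewrite -mulr_sumr /v /g !ipZl -eqx !ipDl ip_suml -(self_adjoint_sym A_sa)//; ring.
Qed.

Hypothesis g_reg : twice_derivable T g.
Hypotheses (kappa0 : 0 <= kappa) (a0 : 0 < alpha) (a1 : alpha < 1).
Hypotheses (al0 : forall j, 0 < al j) (C0 : 0 < Cgam).
Variables (N : nat) (t : nat -> R) (gh V : nat -> H).
Hypothesis tl : time_levels T N t.
Hypothesis t_ratio : forall n, (2 <= n <= N)%N -> t n <= Cgam * t n.-1.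
Hypothesis g_int : forall n, (1 <= n <= N)%N -> bochner_integrable `[t n.-1, t n] g.
Hypothesis scheme : discrete_solution A B al kappa N t gh u0 V.

Let vn i := v (t i).

Definition nodal_error n : H := V n - expR (kappa * t n) *: u (t n).

Local Notation e := nodal_error.
Local Notation et := (vstage nodal_error).

Lemma ip_vstage (x : nat -> H) psi n :
  ip (vstage x n) psi = stage (fun i => ip (x i) psi) n.
Proof. by rewrite /vstage /stage; case: ifP => // _; rewrite ipZl ipDl mulrC. Qed.

Lemma ip_vslope (x : nat -> H) psi n :
  ip (vslope t x n) psi = slope t (fun i => ip (x i) psi) n.
Proof.
rewrite /vslope /slope; case: ifP => _; first by rewrite ip0l.
by rewrite ipZl ipBl mulrC.
Qed.

Let level_pred n : (2 <= n <= N)%N -> (1 <= n.-1 <= N)%N.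
Proof.
by move=> /andP[n2 nN]; rewrite (leq_trans (leq_pred _) nN) andbT; case: n n2 {nN} => [|[]].
Qed.

Let level_pos n : (1 <= n <= N)%N -> 0 < t n <= T.
Proof.
move=> n1N; rewrite (time_level_gt0 tl)// -(time_level_last tl) (time_level_le tl)//.
by case/andP: n1N => _ ->; rewrite leqnn.
Qed.

Lemma dom_level n : (1 <= n <= N)%N -> dom A (vn n).
Proof. by move=> /level_pos/andP[tn _]; exact: dom_scaled_solution. Qed.

Lemma dom_vstage (x : nat -> H) : (forall n, (1 <= n <= N)%N -> dom A (x n)) ->
  forall n, (1 <= n <= N)%N -> dom A (vstage x n).
Proof.
move=> xA n n1N; rewrite /vstage; case: leqP => n2; first exact: xA.
apply: domZ; apply: domD; first exact: xA.
by apply/xA/level_pred; rewrite n2; case/andP: n1N.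
Qed.

Lemma dom_vslope n : (n <= N)%N -> dom A (vslope t vn n).
Proof.
move=> nN; rewrite /vslope; case: leqP => n2; first exact: dom0.
have n2N : (2 <= n <= N)%N by rewrite n2.
apply: domZ; apply: domB; apply: dom_level; first by rewrite (ltnW n2).
exact: level_pred.
Qed.

Lemma dom_scheme n : (1 <= n <= N)%N -> dom A (V n).
Proof. by case: scheme => _ h _ _; exact: h. Qed.

Lemma dom_nodal_error n : (1 <= n <= N)%N -> dom A (e n).
Proof. by move=> n1N; apply: domB; [exact: dom_scheme|exact: dom_level]. Qed.

Lemma nodal_error0 : e 0 = 0.
Proof.
rewrite /nodal_error (time_level0 tl) mulr0 expR0 scale1r.
by case: scheme => -> _ _ _; case: sol => _ -> _; rewrite subrr.
Qed.

Lemma paired_frac_int j n phi : (1 <= n <= N)%N -> dom A phi ->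
  ip (frac_int (al j) t (fun i => B j (V i)) n) phi =
  (tau t n)^-1 * \sum_(1 <= p < n.+1)
     cell_weight t (al j) n p * ip (vstage V p) (B j phi).
Proof.
move=> /andP[n1 nN] Aphi.
have sym w : dom A w -> ip (B j w) phi = ip w (B j phi).
  by move=> Aw; apply: self_adjoint_sym => //; exact: B_dom.
rewrite /frac_int ipDl ipZl ip_suml.
have n1' : (1 < n.+1)%N by [].
rewrite [in RHS](big_ltn n1') [RHS]mulrDr [in RHS]mulr_sumr; congr (_ + _).
  have V1 : dom A (V 1%N) by apply: dom_scheme; exact: leq_trans n1 nN.
  by rewrite (weightE tl (al0 j))// (sym _ V1) -mulrA.
apply: eq_big_nat => p /andP[p2]; rewrite ltnS => pn.
have p1N : (1 <= p <= N)%N by rewrite (ltnW p2) (leq_trans pn).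
have p2N : (2 <= p <= N)%N by rewrite p2 (leq_trans pn).
rewrite (weightE tl (al0 j))//; last by rewrite (ltnW p2).
rewrite ipZl -mulrA; congr (_ * (_ * _)).
rewrite ip_vstage /stage leqNgt p2/= /avg ipZl ipDl.
by rewrite (sym _ (dom_scheme p1N)) (sym _ (dom_scheme (level_pred p2N))) mulrC.
Qed.

Lemma paired_scheme n phi : (1 <= n <= N)%N -> dom A phi ->
  ip (V n) phi - ip (V n.-1) phi + tau t n * ip (vstage V n) (A phi)
  + \sum_(j < m) \sum_(1 <= p < n.+1)
      cell_weight t (al j) n p * ip (vstage V p) (B j phi)
  - kappa * (tau t n * ip (vstage V n) phi) = tau t n * ip (gh n) phi.
Proof.
move=> n1N Aphi; have tn := tau_gt0 tl n1N.
have <- : dt t V n + A (vstage V n)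
    + \sum_(j < m) frac_int (al j) t (fun i => B j (V i)) n - kappa *: vstage V n = gh n.
  have [_ _ h1 h2] := scheme; have /andP[n1 nN] := n1N.
  case: n n1 nN {n1N tn} => [//|[//|n]] _ nN; exact: h2.
rewrite ipBl !ipDl ipZl ip_suml /dt ipZl ipBl (self_adjoint_sym A_sa)//; last first.
  by apply: dom_vstage => //; exact: dom_scheme.
under [in RHS]eq_bigr do rewrite paired_frac_int//.
rewrite -mulr_sumr; field; exact: lt0r_neq0.
Qed.

(** Kept as a vector: the test element of the energy argument depends on [n], so cancellation
    between different [n] must be exploited before pairing. *)
Definition moment_sum j n : H := \sum_(1 <= p < n.+1)
  (moment1 t (al j) p (t n) - moment1 t (al j) p (t n.-1)) *:
    B j (vslope t (fun i => expR (kappa * t i) *: u (t i)) p).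

Definition residual n : R :=
  `|tau t n *: gh n - bochner `[t n.-1, t n] (fun s => expR (kappa * s) *: f s)|
  + Cu * (1 + kappa * M) * (interp_error alpha Cgam t n * tau t n)
  + \sum_(j < m) \sum_(1 <= p < n.+1)
      CB * Cu * (interp_error alpha Cgam t p * cell_weight t (al j) n p)
  + \sum_(j < m) `|moment_sum j n|.

(** This is the paired scheme minus [local_error] for the pairings of [v] with [phi], [A phi] and
    [B j phi]. The first-moment terms, which [local_error] keeps on its left-hand side, become the
    pairing of [moment_sum] with [phi]. *)
Lemma paired_residual n phi : (1 <= n <= N)%N -> dom A phi ->
  `|ip (e n - e n.-1) phi + tau t n * ip (et n) (A phi)
    + \sum_(j < m) \sum_(1 <= p < n.+1)
        cell_weight t (al j) n p * ip (et p) (B j phi)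
    - kappa * (tau t n * ip (et n) phi)| <= residual n * `|phi|.
Proof.
move=> n1N Aphi; have p0 := normr_ge0 phi.
have gpos x : 0 < x <= T -> {for x, continuous (fun s => ip (g s) phi)}.
  move=> xT; have [dg _] := g_reg xT.
  by apply: is_derive_continuous; exact: is_derive_ip.
have mI : measurable (`[t n.-1, t n]%classic : set (measurableTypeR R)).
  exact: measurable_itv.
have [gi ge] := ip_bochner ip_norm mI phi (g_int n1N).
have Ky0 : 0 <= M * `|phi| * Cu by rewrite !mulr_ge0.
have Kh0 : 0 <= `|phi| * Cu by rewrite mulr_ge0.
have Kb0 : 0 <= CB * `|phi| * Cu by rewrite !mulr_ge0.
have yreg := paired_weakly_singular (mulr_ge0 M0 p0) (@graph_bound_id phi).
have hreg := paired_weakly_singular p0 (graph_bound_A Aphi).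
have breg j := paired_weakly_singular (mulr_ge0 CB0 p0) (graph_bound_B j Aphi).
have memi j x : 0 < x <= T ->
    mu.-integrable `[0, x] (EFin \o (fun s => omega (al j) (x - s) * ip (v s) (B j phi))).
  by move=> /andP[x0 _]; have [] := paired_memory j x0 Aphi.
have yeq x : 0 < x <= T -> is_derive x 1 (fun s => ip (v s) phi)
    (ip (g x) phi - ip (v x) (A phi)
     - \sum_(j < m) (\int[mu]_(s in `[0%R, x])
         (omega (al j) (x - s) * ip (v s) (B j phi)))%R + kappa * ip (v x) phi).
  by move=> /andP[x0 _]; exact: paired_equation.
have loc := local_error tl a0 a1 C0 t_ratio al0 kappa0 Ky0 Kh0 Kb0 yreg hreg breg
  memi yeq gpos n1N gi.
have sch := paired_scheme n1N Aphi.
have etE p psi : ip (et p) psi = ip (vstage V p) psi - stage (fun i => ip (vn i) psi) p.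
  by rewrite -ip_vstage -ipBl -vstageB.
have momE : \sum_(j < m) ip (moment_sum j n) phi =
    \sum_(j < m) \sum_(1 <= p < n.+1) slope t (fun i => ip (vn i) (B j phi)) p
      * (moment1 t (al j) p (t n) - moment1 t (al j) p (t n.-1)).
  apply: eq_bigr => j _; rewrite ip_suml; apply: eq_big_nat => p /andP[p1 pn].
  have pA : dom A (vslope t vn p) by apply: dom_vslope; case/andP: n1N => _; exact: leq_trans.
  rewrite ipZl (self_adjoint_sym (B_sa j)); [|exact: B_dom..].
  by rewrite ip_vslope mulrC.
have sumE : \sum_(j < m) \sum_(1 <= p < n.+1)
        cell_weight t (al j) n p * ip (et p) (B j phi) =
    \sum_(j < m) \sum_(1 <= p < n.+1)
        cell_weight t (al j) n p * ip (vstage V p) (B j phi)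
    - \sum_(j < m) \sum_(1 <= p < n.+1)
        (stage (fun i => ip (vn i) (B j phi)) p * cell_weight t (al j) n p
         - slope t (fun i => ip (vn i) (B j phi)) p *
             (moment1 t (al j) p (t n) - moment1 t (al j) p (t n.-1)))
    - \sum_(j < m) ip (moment_sum j n) phi.
  rewrite momE -!sumrB; apply: eq_bigr => j _; rewrite -!sumrB.
  by apply: eq_bigr => p _; rewrite etE; ring.
rewrite sumE !etE {sumE momE}.
set S1 := (X in _ + (X - _ - _)) in sch *.
set S2 := (X in _ + (_ - X - _)) in loc *.
set ms := (X in _ + (_ - X)).
set L := (X in `|X| <= _) in loc.
have -> : ip (e n - e n.-1) phi
    + tau t n * (ip (vstage V n) (A phi) - stage (fun i => ip (vn i) (A phi)) n)
    + (S1 - S2 - ms)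
    - kappa * (tau t n * (ip (vstage V n) phi - stage (fun i => ip (vn i) phi) n)) =
    ip (tau t n *: gh n - bochner `[t n.-1, t n] g) phi - L - ms.
  rewrite [in RHS]ipBl ge [in RHS]ipZl -sch /L /nodal_error !ipBl -/S1 /vn /v -/S2; ring.
apply: le_trans (ler_normB _ _) _; apply: le_trans (lerD (ler_normB _ _) (lexx _)) _.
rewrite /residual mulrDl; apply: lerD; last first.
  rewrite mulr_suml; apply: le_trans (ler_norm_sum _ _ _) _; apply: ler_sum => j _.
  exact: cauchy_schwarz.
rewrite -addrA mulrDl; apply: lerD; first exact: cauchy_schwarz.
apply: le_trans loc _; rewrite [leRHS]mulrDl; apply: lerD.
  rewrite le_eqVlt; apply/orP; left; apply/eqP; ring.
rewrite mulr_suml; apply: ler_sum => j _; rewrite mulr_suml; apply: ler_sum => p _.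
rewrite le_eqVlt; apply/orP; left; apply/eqP; ring.
Qed.

Lemma residual_ge0 n : (1 <= n <= N)%N -> 0 <= residual n.
Proof.
move=> n1N; have i0 p : (1 <= p <= n)%N -> 0 <= interp_error alpha Cgam t p.
  by move=> /andP[p1 pn]; apply: (@interp_error_ge0 _ _ _ N) => //; rewrite p1 (leq_trans pn)//; case/andP: n1N.
have tn := ltW (tau_gt0 tl n1N).
rewrite /residual !addr_ge0//.
- have n1n : (1 <= n <= n)%N by rewrite leqnn andbT; case/andP: n1N.
  by apply: mulr_ge0; [rewrite mulr_ge0// addr_ge0// mulr_ge0|rewrite mulr_ge0// i0].
- apply: sumr_ge0 => j _; rewrite big_nat; apply: sumr_ge0 => p /andP[p1 pn].
  have p1n : (1 <= p <= n)%N by rewrite p1.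
  apply: mulr_ge0; first exact: mulr_ge0.
  apply: mulr_ge0; first exact: i0.
  by apply: (cell_weight_ge0 tl (al0 j) p1n); case/andP: n1N.
by apply: sumr_ge0 => j _; exact: normr_ge0.
Qed.

Variable S : linop H.
Hypothesis S_sqrt : is_sqrt_op ip S A.
Hypothesis B_energy : forall j w phi, dom A w -> dom A phi ->
  `|ip (B j w) phi| <= CB * `|S w| * `|S phi|.

Let coupling n p := CB * \sum_(j < m) cell_weight t (al j) n p.

Let dom_et n : (1 <= n <= N)%N -> dom A (et n).
Proof. exact: dom_vstage dom_nodal_error n. Qed.

Let energy_step n : (1 <= n <= N)%N ->
  ip (e n - e n.-1) (et n) + tau t n * `|S (et n)| ^+ 2 <=
  \sum_(1 <= p < n.+1) coupling n p * (`|S (et p)| * `|S (et n)|)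
  + kappa * tau t n * `|et n| ^+ 2 + residual n * `|et n|.
Proof.
move=> n1N; have Aet := dom_et n1N.
have := paired_residual n1N Aet => /(le_trans (ler_norm _)).
rewrite (ipC ip (et n) (A (et n))) (ip_sqrt_op ip_norm S_sqrt)// ip_norm.
suff : - (\sum_(j < m) \sum_(1 <= p < n.+1)
      cell_weight t (al j) n p * ip (et p) (B j (et n))) <=
    \sum_(1 <= p < n.+1) coupling n p * (`|S (et p)| * `|S (et n)|) by lra.
rewrite exchange_big/= -sumrN; apply: ler_sum_nat => p /andP[p1]; rewrite ltnS => pn.
have /andP[_ nN] := n1N.
have p1N : (1 <= p <= N)%N by rewrite p1 (leq_trans pn nN).
have Ap := dom_et p1N.
rewrite /coupling -mulrA mulr_suml mulr_sumr -sumrN; apply: ler_sum => j _.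
have w0 : 0 <= cell_weight t (al j) n p.
  by apply: (cell_weight_ge0 tl (al0 j)) => //; rewrite p1.
rewrite -(self_adjoint_sym (B_sa j)); [|exact: B_dom..].
rewrite -mulrN mulrCA ler_wpM2l// mulrA; apply: le_trans (B_energy j Ap Aet).
by rewrite -normrN ler_norm.
Qed.

Lemma nodal_error_le (lam d : R) :
  2 * kappa <= lam ->
  (forall n, (2 <= n < N)%N -> tau t n <= tau t n.+1) ->
  (forall n, (1 <= n <= N)%N -> tau t n <= d) ->
  (forall n, (1 <= n <= N)%N -> kappa * tau t n <= 2^-1) ->
  CB * \sum_(j < m) (omega1 (al j) (2 * d) + expR (- lam * d) * omega1 (al j) T) <= 1 ->
  forall n, (n <= N)%N ->
    `|e n| <= 4 * expR (lam * T) * \sum_(1 <= i < N.+1) residual i.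
Proof.
move=> klam kinc taud ktau small n nN.
have lam0 : 0 <= lam by apply: le_trans klam; rewrite mulr_ge0.
have [N1 t0 tN tinc] := tl.
have tau0 i : (1 <= i <= N)%N -> 0 <= tau t i by move=> /(tau_gt0 tl)/ltW.
pose K i p := coupling i p.
have K0 i p : (1 <= p <= i)%N -> (i <= N)%N -> 0 <= K i p.
  move=> pi iN; rewrite /K /coupling mulr_ge0// sumr_ge0// => j _.
  exact: (cell_weight_ge0 tl (al0 j)).
(* Rows and columns at once: [F] maps the summation index to the pair of cell indices. *)
have Ksum (r : seq nat) (F : nat -> nat * nat) (w : nat -> R) x : 0 <= x ->
    (forall j, \sum_(i <- r) cell_weight t (al j) (F i).1 (F i).2 * w i <=
      x * (omega1 (al j) (2 * d) + expR (- lam * d) * omega1 (al j) T)) ->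
    \sum_(i <- r) K (F i).1 (F i).2 * w i <= x.
  move=> x0 h; apply: (@le_trans _ _ (x * (CB * \sum_(j < m)
      (omega1 (al j) (2 * d) + expR (- lam * d) * omega1 (al j) T)))); last first.
    by rewrite ler_piMr.
  have -> : \sum_(i <- r) K (F i).1 (F i).2 * w i =
      CB * \sum_(j < m) \sum_(i <- r) cell_weight t (al j) (F i).1 (F i).2 * w i.
    rewrite exchange_big mulr_sumr; apply: eq_bigr => i _.
    by rewrite /K /coupling -mulrA mulr_suml.
  rewrite mulrCA ler_wpM2l// mulr_sumr; apply: ler_sum => j _; exact: h.
have rowK i : (1 <= i <= N)%N ->
    \sum_(1 <= p < i.+1) K i p * expR (- lam * (t i - t p)) <= tau t i.
  move=> iN; apply: (Ksum _ (fun p => (i, p))) => [|j]; first exact: tau0.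
  exact: (cell_weight_row_sum tl (al0 j) lam0 taud).
have colK p : (1 <= p <= N)%N ->
    \sum_(p <= i < N.+1) K i p * expR (- lam * (t i - t p)) <= tau t p.
  move=> pN; apply: (Ksum _ (fun i => (i, p))) => [|j]; first exact: tau0.
  exact: (cell_weight_col_weighted_sum tl (al0 j) lam0 taud).
(* [weighted_energy] asks for nonnegative residuals at every index, whereas [residual] is known to
   be nonnegative only on the mesh. *)
have rE : \sum_(1 <= i < N.+1) residual i = \sum_(1 <= i < N.+1) `|residual i|.
  by apply: eq_big_nat => i iN; rewrite ger0_norm// residual_ge0.
rewrite rE -tN.
apply: (weighted_energy (K := K) (E := fun i => `|e i|) (a := fun i => `|S (et i)|)
  (r := fun i => `|residual i|) kappa0 klam t0 tinc kinc ktau K0 rowK colK) nN.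
- by move=> i; exact: normr_ge0.
- by move=> i; exact: normr_ge0.
- by rewrite nodal_error0 normr0.
- move=> _; have h1 : (1 <= 1 <= N)%N by [].
  have := energy_step h1; rewrite big_nat1 /vstage/= nodal_error0 subr0 ip_norm.
  by rewrite (ger0_norm (residual_ge0 h1)).
move=> i i2N; have i1N : (1 <= i <= N)%N.
  by case/andP: i2N => i2 ->; rewrite (ltnW i2).
have := energy_step i1N; rewrite (ger0_norm (residual_ge0 i1N)).
have etE : et i = 2^-1 *: (e i + e i.-1).
  by rewrite /vstage leqNgt; case/andP: i2N => ->.
have -> : ip (e i - e i.-1) (et i) = (`|e i| ^+ 2 - `|e i.-1| ^+ 2) / 2.
  rewrite etE; move: (e i) (e i.-1) => x y.
  by rewrite ipZr ipBl !ipDr !ip_norm (ipC ip y); field.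
have n1 : `|et i| <= (`|e i| + `|e i.-1|) / 2.
  rewrite etE normrZ gtr0_norm ?invr_gt0// mulrC ler_wpM2r ?invr_ge0//.
  exact: ler_normD.
have n2 : `|et i| ^+ 2 <= (`|e i| ^+ 2 + `|e i.-1| ^+ 2) / 2.
  have h0 : 0 <= (`|e i| + `|e i.-1|) / 2 by exact: le_trans n1.
  apply: (@le_trans _ _ (((`|e i| + `|e i.-1|) / 2) ^+ 2)).
    by rewrite ler_pXn2r ?nnegrE.
  have := sqr_ge0 (`|e i| - `|e i.-1|); lra.
move=> /le_trans; apply.
rewrite -!addrA lerD2l; apply: lerD.
  by rewrite ler_wpM2l// mulr_ge0// tau0.
by rewrite ler_wpM2l// residual_ge0.
Qed.

Let paired_slope j n psi : (n <= N)%N -> dom A psi ->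
  ip (B j (vslope t vn n)) psi = slope t (fun i => ip (v (t i)) (B j psi)) n.
Proof.
move=> nN Apsi; rewrite (self_adjoint_sym (B_sa j)); last 2 first.
- by apply: B_dom; exact: dom_vslope.
- exact: B_dom.
exact: ip_vslope.
Qed.

Let paired_reg j psi : dom A psi ->
  weakly_singular T alpha (CB * `|psi| * Cu) (fun s => ip (v s) (B j psi))
    (fun s => ip (derive1 v s) (B j psi))
    (fun s => ip (derive1 (derive1 v) s) (B j psi)).
Proof.
move=> Apsi; apply: paired_weakly_singular.
  exact: mulr_ge0.
exact: graph_bound_B.
Qed.

Let psi_const0 (psi : H) : 0 <= CB * `|psi| * Cu.
Proof. by rewrite !mulr_ge0. Qed.

(** Scalar mean value estimates with constants proportional to the norm of [psi], for [psi] in the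
    dense domain of [A], amount to a bound in norm. *)
Lemma norm_slope_le j n : (2 <= n <= N)%N ->
  `|B j (vslope t vn n)| <= CB * Cu * t n.-1 `^ (alpha - 1).
Proof.
move=> n2N; have /andP[_ nN] := n2N; have [Adense _] := A_sa.
apply: (norm_le_dense ip_norm Adense); first by rewrite !mulr_ge0// powR_ge0.
move=> psi Apsi; rewrite paired_slope//; apply: le_trans (ler_norm _) _.
apply: le_trans (slope_le tl a1 (psi_const0 psi) (paired_reg j Apsi) n2N) _.
by rewrite le_eqVlt; apply/orP; left; apply/eqP; ring.
Qed.

Lemma norm_slope_diff_le j n : (3 <= n <= N)%N ->
  `|B j (vslope t vn n) - B j (vslope t vn n.-1)| <=
    CB * Cu * t n.-2 `^ (alpha - 2) * (tau t n + tau t n.-1).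
Proof.
move=> n3N; have /andP[n3 nN] := n3N; have [Adense _] := A_sa.
have nN' : (n.-1 <= N)%N by exact: leq_trans (leq_pred _) nN.
have n1N : (1 <= n <= N)%N by rewrite (leq_trans _ n3).
have n2N : (2 <= n <= N)%N by rewrite (leq_trans _ n3).
have tn0 := ltW (tau_gt0 tl n1N).
have tp0 := ltW (tau_gt0 tl (level_pred n2N)).
apply: (norm_le_dense ip_norm Adense).
  by apply: mulr_ge0; [rewrite !mulr_ge0// powR_ge0|exact: addr_ge0].
move=> psi Apsi; rewrite ipBl !paired_slope//; apply: le_trans (ler_norm _) _.
apply: le_trans (slope_diff_le tl a1 (psi_const0 psi) (paired_reg j Apsi) n3N) _.
by rewrite le_eqVlt; apply/orP; left; apply/eqP; ring.
Qed.

Lemma residual_sum_le (gamma cgam k Om Cd : R) :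
  graded_mesh gamma Cgam cgam k N t -> 0 < k ->
  (forall j, al j < 1) -> (forall j, omega1 (al j) T <= Om) ->
  \sum_(1 <= n < N.+1) `|tau t n *: gh n - bochner `[t n.-1, t n] g| <=
    Cd * mesh_error alpha gamma k N t ->
  \sum_(1 <= n < N.+1) residual n <=
    (Cd + (Cu * (1 + kappa * M) + m%:R * Om * (CB * Cu))
            * (alpha^-1 + Cgam `^ (2 - alpha) * Cgam ^+ 2)
     + m%:R * (4 * Om * (CB * Cu * moment_constant alpha gamma Cgam)))
    * mesh_error alpha gamma k N t.
Proof.
move=> gm k0 al1 OmT Cdle.
have isum := interp_error_sum tl gm a0 C0 k0.
have me0 : 0 <= mesh_error alpha gamma k N t by exact: (mesh_error_ge0 _ _ _ tl).
set me := mesh_error _ _ _ _ _ in me0 isum Cdle *.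
set IC := alpha^-1 + _ in isum *.
have CBCu : 0 <= CB * Cu by exact: mulr_ge0.
have sum_const (F : 'I_m -> R) c : (forall j, F j <= c) -> \sum_(j < m) F j <= m%:R * c.
  move=> Fc; apply: le_trans (ler_sum _ (fun j _ => Fc j)) _.
  by rewrite sumr_const card_ord mulr_natl.
have h2 : \sum_(1 <= n < N.+1)
    Cu * (1 + kappa * M) * (interp_error alpha Cgam t n * tau t n) <=
    Cu * (1 + kappa * M) * (IC * me).
  by rewrite -mulr_sumr ler_wpM2l// mulr_ge0// addr_ge0// mulr_ge0.
have h3 : \sum_(1 <= n < N.+1) \sum_(j < m) \sum_(1 <= p < n.+1)
    CB * Cu * (interp_error alpha Cgam t p * cell_weight t (al j) n p) <=
    m%:R * (CB * Cu * (Om * (IC * me))).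
  rewrite exchange_big/=; apply: sum_const => j.
  (* Summed over [n] first, the weights of cell [p] contribute at most tau_p times [Om], so the
     memory error reduces to the sum already bounded by [isum]. *)
  rewrite (exchange_triangular (fun n p =>
    CB * Cu * (interp_error alpha Cgam t p * cell_weight t (al j) n p))).
  under eq_bigr do rewrite -mulr_sumr -mulr_sumr.
  rewrite -mulr_sumr ler_wpM2l//.
  have Om0 : 0 <= Om by apply: le_trans (OmT j); exact: omega1_ge0.
  apply: le_trans (ler_wpM2l Om0 isum); rewrite mulr_sumr.
  apply: ler_sum_nat => p pN.
  have i0 : 0 <= interp_error alpha Cgam t p by exact: (@interp_error_ge0 _ _ _ N).
  rewrite mulrCA ler_wpM2l//.
  apply: le_trans (cell_weight_col_sum tl (al0 j) pN) _.
  by rewrite mulrC ler_wpM2r// ltW// (tau_gt0 tl).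
have h4 : \sum_(1 <= n < N.+1) \sum_(j < m) `|moment_sum j n| <=
    m%:R * (4 * Om * (CB * Cu * moment_constant alpha gamma Cgam * me)).
  rewrite exchange_big/=; apply: sum_const => j.
  have z1 : B j (vslope t vn 1) = 0 by exact: linop0.
  apply: le_trans (moment_increment_sum tl gm a1 C0 k0 (al0 j) (al1 j) CBCu z1
    (@norm_slope_le j) (@norm_slope_diff_le j)) _.
  rewrite ler_wpM2r ?ler_wpM2l//.
  by apply: mulr_ge0 => //; apply: mulr_ge0 => //; exact: moment_constant_ge0.
rewrite /residual !big_split/=.
apply: le_trans (lerD (lerD (lerD Cdle h2) h3) h4) _.
by rewrite le_eqVlt; apply/orP; left; apply/eqP; ring.
Qed.

End Scheme.

Lemma integral_itv_le_cst (R : realType) (h : R -> R) (a b c : R) : a <= b ->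
  (forall s, a <= s <= b -> 0 <= h s <= c) ->
  (\int[@lebesgue_measure R]_(s in `[a, b]) (h s)%:E <= (c * (b - a))%:E)%E.
Proof.
move=> ab hc; apply: (@le_trans _ _ (\int[@lebesgue_measure R]_(s in `[a, b]) c%:E)%E).
  apply: ge0_le_integral_nonmeasurable => s /=; rewrite in_itv/= lee_fin => /hc/andP[//].
rewrite integral_cst//= lebesgue_measure_itv/=; case: ifPn => [_|].
  by rewrite -EFinB -EFinM.
rewrite lte_fin -leNgt => ba; have -> : a = b by apply/le_anti; rewrite ab ba.
by rewrite subrr mulr0 mule0.
Qed.

(** * Errors from the approximation of the data *)

Section DataError.
Context {R : realType} {H : completeNormedModType R}.
Variables (T alpha gamma Cgam cgam k Cq Cg : R) (N : nat) (t : nat -> R).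
Variables (g : R -> H) (gh : nat -> H).
Hypotheses (tl : time_levels T N t) (gm : graded_mesh gamma Cgam cgam k N t).
Hypotheses (a0 : 0 < alpha) (a1 : alpha < 1) (C0 : 0 < Cgam) (k0 : 0 < k).
Hypotheses (Cq0 : 0 <= Cq) (Cg0 : 0 <= Cg).
Hypothesis g_reg : data_regularity T g (fun s => Cg * s `^ alpha).
Hypothesis g_approx : data_approximation Cq N t g gh.

Lemma data_error_sum :
  \sum_(1 <= n < N.+1) `|tau t n *: gh n - bochner `[t n.-1, t n] g| <=
  (Cq * Cg + Cq * Cg * (Cgam `^ (2 - alpha) * Cgam ^+ 2)) * mesh_error alpha gamma k N t.
Proof.
have [_ ap1 ap2] := g_approx; have [_ reg] := g_reg.
have [N1 t0 tN _] := tl.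
have CC : 0 <= Cq * Cg by exact: mulr_ge0.
have level_le n : (n <= N)%N -> t n <= T.
  by move=> nN; rewrite -tN (time_level_le tl)// nN leqnn.
apply: (le_mesh_error tl) => //.
- by rewrite !mulr_ge0// ?powR_ge0// ltW.
- have t1 : 0 < t 1%N by rewrite (time_level_gt0 tl).
  rewrite -lee_fin; apply: le_trans ap1 _.
  have -> : (Cq * Cg * t 1%N `^ (alpha + 1))%:E =
      (Cq%:E * (Cg * t 1%N `^ alpha * (t 1%N - t 0%N))%:E)%E.
    rewrite -EFinM t0 subr0 powRD ?(gt_eqF t1) ?implybT// powRr1 ?(ltW t1)//.
    by congr (_%:E); ring.
  apply: lee_wpmul2l; first by rewrite lee_fin.
  apply: integral_itv_le_cst; first by rewrite t0 ltW.
  move=> s; rewrite t0 => /andP[s0 s1]; rewrite mulr_ge0//=.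
  (* The regularity of the data holds for positive times only; at 0 the factor [s] makes the
     integrand vanish. *)
  move: s0; rewrite le_eqVlt => /predU1P[<-|s0].
    by rewrite mul0r mulr_ge0// powR_ge0.
  have sT : 0 < s <= T by rewrite s0 (le_trans s1)// level_le.
  have := reg s sT => h; apply: (@le_trans _ _ (Cg * s `^ alpha)).
    by apply: le_trans h; rewrite lerDl mulr_ge0// sqr_ge0.
  by rewrite ler_wpM2l// ge0_ler_powR ?nnegrE ?(ltW a0) ?(ltW s0) ?(ltW t1).
move=> n n2N; have /andP[n2 nN] := n2N.
have n1N : (1 <= n <= N)%N by rewrite (ltnW n2).
have p1N : (1 <= n.-1 <= N)%N.
  by rewrite (leq_trans (leq_pred _) nN) andbT; case: n n2 {n2N nN n1N} => [|[]].
have tp := time_level_gt0 tl p1N; have tn := tau_gt0 tl n1N.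
have tle : t n.-1 <= t n by rewrite -subr_ge0 ltW.
have al2 : 0 <= 2 - alpha by rewrite subr_ge0 ltW// (lt_trans a1)// ltr1n.
rewrite -lee_fin; apply: le_trans (ap2 n n2N) _.
apply: (@le_trans _ _ ((Cq * tau t n ^+ 2) *
    (Cg * t n.-1 `^ (alpha - 2) * (t n - t n.-1)))%:E).
  rewrite [leRHS]EFinM; apply: lee_wpmul2l; first by rewrite lee_fin mulr_ge0// sqr_ge0.
  apply: integral_itv_le_cst => // s /andP[s1 s2]; rewrite normr_ge0/=.
  have s0 : 0 < s by exact: lt_le_trans s1.
  have sT : 0 < s <= T by rewrite s0 (le_trans s2)// level_le.
  have := reg s sT => h.
  have s20 : 0 < s ^+ 2 by rewrite exprn_gt0.
  apply: (@le_trans _ _ (Cg * s `^ (alpha - 2))).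
    rewrite -(ler_pM2l s20).
    have -> : s ^+ 2 * (Cg * s `^ (alpha - 2)) = Cg * s `^ alpha.
      rewrite mulrCA -powR_mulrn ?(ltW s0)// -powRD ?(gt_eqF s0) ?implybT//.
      by congr (_ * _ `^ _); ring.
    by apply: le_trans h; rewrite lerDr mulr_ge0// ltW.
  rewrite ler_wpM2l// -opprB !powRN lef_pV2 ?posrE ?powR_gt0//.
  by rewrite ge0_ler_powR ?nnegrE ?(ltW s0) ?(ltW tp).
rewrite lee_fin -/(tau t n).
have p2 := pow_level_pred tl C0 (graded_ratio gm) n2N al2; rewrite opprB in p2.
have cube := tau_cube_le alpha tl gm C0 k0 n1N.
set Y := k ^+ 2 * _ in cube *.
apply: (@le_trans _ _ (Cq * Cg * Cgam `^ (2 - alpha) * (tau t n ^+ 3 * t n `^ (alpha - 2)))).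
  have -> : Cq * tau t n ^+ 2 * (Cg * t n.-1 `^ (alpha - 2) * tau t n) =
      Cq * Cg * tau t n ^+ 3 * t n.-1 `^ (alpha - 2) by ring.
  have -> : Cq * Cg * Cgam `^ (2 - alpha) * (tau t n ^+ 3 * t n `^ (alpha - 2)) =
      Cq * Cg * tau t n ^+ 3 * (Cgam `^ (2 - alpha) * t n `^ (alpha - 2)) by ring.
  by rewrite ler_wpM2l// mulr_ge0// exprn_ge0// ltW.
have c0 : 0 <= Cq * Cg * Cgam `^ (2 - alpha) by rewrite mulr_ge0// powR_ge0.
apply: le_trans (ler_wpM2l c0 cube) _.
by rewrite le_eqVlt; apply/orP; left; apply/eqP; ring.
Qed.

End DataError.

(** * Kernel bounds uniform in the exponent and the choice of parameters *)

Section KernelBounds.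
Context {R : realType}.
Implicit Types a alpha z T : R.

Let kernel_const_le alpha a : 0 < alpha -> alpha <= a < 1 ->
  (Gamma a)^-1 / a <= expR 1 / alpha.
Proof.
move=> a0 /andP[aa a1]; have ap : 0 < a by exact: lt_le_trans aa.
apply: ler_pM => //; first by rewrite invr_ge0 Gamma_ge0.
- by rewrite invr_ge0 ltW.
- exact: invGamma_le.
- by rewrite lef_pV2.
Qed.

Lemma omega1_le_uniform alpha a T : 0 < alpha -> alpha <= a < 1 ->
  omega1 a T <= expR 1 / alpha * Num.max 1 T.
Proof.
move=> a0 aa; have /andP[aa1 a1] := aa; have ap : 0 < a by exact: lt_le_trans aa1.
have m1 : 1 <= Num.max 1 T by rewrite le_max lexx.
apply: le_trans (omega1_le ap (ltW a1) _ m1) _; first by rewrite le_max lexx orbT.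
rewrite ler_wpM2r ?kernel_const_le//; exact: le_trans m1.
Qed.

Lemma omega1_le_powR alpha a z : 0 < alpha -> alpha <= a < 1 -> 0 < z <= 1 ->
  omega1 a z <= expR 1 / alpha * z `^ alpha.
Proof.
move=> a0 aa /andP[z0 z1]; have /andP[aa1 a1] := aa.
rewrite /omega1 pos_powE ?(ltW z0)//; apply: ler_pM.
- by rewrite divr_ge0 ?invr_ge0 ?Gamma_ge0// (le_trans (ltW a0)).
- exact: powR_ge0.
- exact: kernel_const_le.
- by apply: ger_powR => //; rewrite z0.
Qed.

(** The order of choice matters: [d] is taken so small that the near part is at most 1/2, then [lam]
    so large, depending on [d], that the far part is too. *)
Lemma coupling_parameters (alpha T kappa c : R) : 0 < alpha -> 0 <= kappa -> 0 <= c ->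
  exists lam d, [/\ 0 < d, 2 * kappa <= lam & forall a, alpha <= a < 1 ->
    c * (omega1 a (2 * d) + expR (- lam * d) * omega1 a T) <= 1].
Proof.
move=> a0 kappa0 c0; pose G := expR 1 / alpha; pose Om := G * Num.max 1 T.
have G0 : 0 <= G by rewrite divr_ge0 ?expR_ge0// ltW.
have m0 : 0 <= Num.max 1 T by rewrite le_max ler01.
have Om0 : 0 <= Om by exact: mulr_ge0.
(* Chosen so that c G q is at most 1/2; the added 1 keeps [q] in ]0, 1] even when c G is 0. *)
pose q := (2 * (c * G) + 1)^-1.
have cG0 : 0 <= c * G by exact: mulr_ge0.
have den : 0 < 2 * (c * G) + 1 by rewrite ltr_wpDl// mulr_ge0.
have q0 : 0 < q by rewrite invr_gt0.
have q1 : q <= 1 by rewrite invf_le1// lerDr mulr_ge0.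
pose z := q `^ alpha^-1.
have z0 : 0 < z by exact: powR_gt0.
have z1 : z <= 1.
  have ai0 : 0 <= alpha^-1 by rewrite invr_ge0 ltW.
  have : q `^ alpha^-1 <= 1 `^ alpha^-1 by rewrite ge0_ler_powR ?nnegrE ?(ltW q0).
  by rewrite powR1.
have zq : z `^ alpha = q by rewrite /z -powRrM mulVf ?gt_eqF// powRr1// ltW.
pose d := z / 2; have d0 : 0 < d by rewrite divr_gt0.
have d2 : 2 * d = z by rewrite /d; field.
have cO : 0 <= c * Om by exact: mulr_ge0.
(* The second term gives lam d >= 2 c Om, and the exponential exceeds its linear part. *)
pose lam := 2 * kappa + 2 * (c * Om) / d.
exists lam, d; split=> //.
  by rewrite lerDl divr_ge0 ?(ltW d0)// mulr_ge0.
move=> a aa; rewrite d2 mulrDr.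
have h1 : c * omega1 a z <= 2^-1.
  apply: (@le_trans _ _ (c * (G * q))).
    by rewrite ler_wpM2l// -zq omega1_le_powR// z0.
  rewrite mulrA /q ler_pdivrMr//; lra.
have h2 : c * (expR (- lam * d) * omega1 a T) <= 2^-1.
  have e1 : 2 * (c * Om) <= expR (lam * d).
    apply: le_trans (expR_ge1Dx _).
    have -> : lam * d = 2 * (kappa * d) + 2 * (c * Om) by rewrite /lam; field; exact: lt0r_neq0.
    have : 0 <= kappa * d by rewrite mulr_ge0// ltW.
    lra.
  rewrite mulNr expRN mulrCA mulrC ler_pdivrMr ?expR_gt0//.
  apply: (@le_trans _ _ (c * Om)); last by lra.
  by rewrite ler_wpM2l// omega1_le_uniform.
have := lerD h1 h2; lra.
Qed.

End KernelBounds.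

Lemma bigmax_nat_le (R : realType) (F : nat -> R) (m n : nat) (x : R) : 0 <= x ->
  (forall i, (m <= i < n)%N -> F i <= x) -> \big[Num.max/0]_(m <= i < n) F i <= x.
Proof.
move=> x0 Fx; rewrite big_nat; apply: (big_ind (fun y => y <= x)) => //.
by move=> y z yx zx; rewrite ge_max yx.
Qed.

Theorem theorem6 (R : realType) (H : completeNormedModType R)
    (ip : {dot H for idfun}) (A S : linop H) (m : nat)
    (T kappa gamma alpha Cgam cgam CB Cq Cu Cg : R)
    (H_hilbert : hilbert_norm ip)
    (A_sa : self_adjoint ip A) (A_pos : positive_definite ip A)
    (A_inv : has_compact_inverse A) (S_sqrt : is_sqrt_op ip S A)
    (m_ge1 : (1 <= m)%N) (T_gt0 : 0 < T) (kappa_ge0 : 0 <= kappa)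
    (gamma_ge1 : 1 <= gamma)
    (Cgam_gt0 : 0 < Cgam) (cgam_gt0 : 0 < cgam)
    (CB_gt0 : 0 < CB) (Cq_gt0 : 0 < Cq) (Cu_gt0 : 0 < Cu) (Cg_gt0 : 0 < Cg) :
  exists C k0 : R, [/\ 0 < C, 0 < k0 &
    forall (B : 'I_m -> linop H) (al : 'I_m -> R) (f u : R -> H) (u0 : H),
    let v (s : R) := expR (kappa * s) *: u s in
    let g (s : R) := expR (kappa * s) *: f s in
    (forall j, [/\ self_adjoint ip (B j), dom A `<=` dom (B j) &
                   form_bound ip A S (B j) CB]) ->
    (forall j, 0 < al j < 1) -> is_min al alpha ->
    exact_solution A B al kappa f u0 u ->
    solution_regularity A T v (fun s => Cu * s `^ (alpha - 1)) ->
    solution_regularity A T u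
      (fun s => Cu * expR (- kappa * s) * s `^ (alpha - 1)) ->
    data_regularity T g (fun s => Cg * s `^ alpha) ->
    forall (k : R) (N : nat) (t : nat -> R) (gh V : nat -> H),
    0 < k <= k0 ->
    time_levels T N t ->
    graded_mesh gamma Cgam cgam k N t ->
    data_approximation Cq N t g gh ->
    discrete_solution A B al kappa N t gh u0 V ->
    let U (n : nat) := expR (- kappa * t n) *: V n in
    \big[Num.max/0]_(1 <= n < N.+1) `|V n - v (t n)|
      <= C * Xi k alpha gamma (t 1%N) (t N) /\
    \big[Num.max/0]_(1 <= n < N.+1) `|U n - u (t n)|
      <= C * Xi k alpha gamma (t 1%N) (t N)].
Proof.
(* Outside ]0, 1[ the number [alpha] cannot be one of the exponents, so any constants will do. *)
have [alpha01|alpha_out] := boolP (0 < alpha < 1); last first.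
  exists 1, 1; split=> // B al f u u0 v g _ al01 [_ [j jE]].
  by move: alpha_out; rewrite -jE al01.
have /andP[a0 a1] := alpha01.
have [M M0 A_bound] := inverse_bounded A_inv.
have [C1 [k1 [C10 k10 sumXi]]] :=
  graded_sum_le_Xi T_gt0 a0 gamma_ge1 Cgam_gt0 cgam_gt0.
have m0 : 0 < m%:R :> R by rewrite ltr0n.
(* With the factor [m] each of the m kernels takes at most a share 1/m of the admissible total. *)
have c0 : 0 <= CB * m%:R by rewrite mulr_ge0// ltW.
have [lam [d [d0 klam couple]]] := coupling_parameters T a0 kappa_ge0 c0.
pose Om := expR 1 / alpha * Num.max 1 T.
have Om0 : 0 <= Om.
  by rewrite mulr_ge0 ?le_max ?ler01// divr_ge0 ?expR_ge0// ltW.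
pose Cd := Cq * Cg + Cq * Cg * (Cgam `^ (2 - alpha) * Cgam ^+ 2).
pose CR := Cd + (Cu * (1 + kappa * M) + m%:R * Om * (CB * Cu))
              * (alpha^-1 + Cgam `^ (2 - alpha) * Cgam ^+ 2)
     + m%:R * (4 * Om * (CB * Cu * moment_constant alpha gamma Cgam)).
have G0 : 0 <= Cgam `^ (2 - alpha) * Cgam ^+ 2 by rewrite mulr_ge0 ?powR_ge0 ?sqr_ge0.
have CR0 : 0 < CR.
  have Cd0 : 0 < Cd by rewrite ltr_pwDl ?mulr_gt0// mulr_ge0// mulr_ge0// ltW.
  have mc0 := moment_constant_ge0 alpha gamma Cgam_gt0.
  have CBCu : 0 <= CB * Cu by rewrite mulr_ge0// ltW.
  rewrite /CR -addrA ltr_pwDl// addr_ge0//; last first.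
    by apply: mulr_ge0; [exact: ltW|apply: mulr_ge0; [exact: mulr_ge0|exact: mulr_ge0]].
  apply: mulr_ge0; last by rewrite addr_ge0// invr_ge0 ltW.
  apply: addr_ge0; last by apply: mulr_ge0 => //; apply: mulr_ge0 => //; exact: ltW.
  by rewrite mulr_ge0 ?(ltW Cu_gt0)// addr_ge0// mulr_ge0// ltW.
(* Since every step is at most Cgam k, the two entries give tau_n <= d and kappa tau_n <= 1/2;
   [kappa + 1] covers kappa = 0. *)
pose k2 := Num.min (d / Cgam) (2 * (kappa + 1) * Cgam)^-1.
have k20 : 0 < k2.
  by rewrite lt_min divr_gt0//= invr_gt0 !mulr_gt0// ltr_wpDl.
have E0 : 0 < 4 * expR (lam * T) by rewrite mulr_gt0// expR_gt0.
exists (4 * expR (lam * T) * (CR * C1)), (Num.min k1 k2); split.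
- by rewrite !mulr_gt0// expR_gt0.
- by rewrite lt_min k10.
move=> B al f u u0 v g hB al01 [al_ge _] sol v_reg _ g_reg k N t gh V.
rewrite le_min => /andP[k0 /andP[kk1 kk2]] tl gm g_approx scheme U.
have al0 j : 0 < al j by have /andP[] := al01 j.
have al1 j : al j < 1 by have /andP[] := al01 j.
have B_sa j : self_adjoint ip (B j) by case: (hB j).
have B_dom j : dom A `<=` dom (B j) by case: (hB j).
have B_form j : form_bound ip A S (B j) CB by case: (hB j).
have B_le j w phi : dom A w -> `|ip (B j w) phi| <= CB * `|A w| * `|phi|.
  exact: (form_bound_graph phi S_sqrt (B_form j)).
have B_energy j w phi : dom A w -> dom A phi ->
    `|ip (B j w) phi| <= CB * `|S w| * `|S phi|.
  exact: (form_bound_energy S_sqrt (B_form j)).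
have g_diff : twice_derivable T g by case: g_reg.
have g_int n : (1 <= n <= N)%N -> bochner_integrable `[t n.-1, t n] g.
  by case: g_approx => h _ _; exact: h.
have tau_le n : (1 <= n <= N)%N -> tau t n <= Cgam * k.
  case: gm => h _ _ _ /h/le_trans; apply.
  by rewrite ler_piMr ?mulr_ge0 ?(ltW Cgam_gt0) ?(ltW k0)// ge_min lexx.
have Cgk : Cgam * k <= Cgam * k2 by rewrite ler_wpM2l// ltW.
have tau_d n : (1 <= n <= N)%N -> tau t n <= d.
  move=> nN; apply: le_trans (tau_le n nN) _; apply: le_trans Cgk _.
  by rewrite mulrC -ler_pdivlMr// /k2 ge_min lexx.
have tau_kappa n : (1 <= n <= N)%N -> kappa * tau t n <= 2^-1.
  move=> nN; have h : tau t n <= (2 * (kappa + 1))^-1.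
    apply: le_trans (tau_le n nN) _; apply: le_trans Cgk _.
    by rewrite mulrC -ler_pdivlMr// -invfM /k2 ge_min lexx orbT.
  apply: le_trans (ler_wpM2l kappa_ge0 h) _.
  have kp : 0 < 2 * (kappa + 1) by rewrite mulr_gt0// ltr_wpDl.
  by rewrite ler_pdivrMr//; lra.
have small : CB * \sum_(j < m)
    (omega1 (al j) (2 * d) + expR (- lam * d) * omega1 (al j) T) <= 1.
  rewrite mulr_sumr; apply: (@le_trans _ _ (\sum_(j < m) m%:R^-1)).
    apply: ler_sum => j _; rewrite -(ler_pM2l m0) mulfV ?gt_eqF// mulrA [m%:R * _]mulrC.
    by apply: couple; rewrite al_ge al1.
  by rewrite sumr_const card_ord -[leLHS]mulr_natl mulfV// gt_eqF.
have err := nodal_error_le H_hilbert A_sa (ltW M0) (ltW CB_gt0) (ltW Cu_gt0) A_bound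
  B_sa B_dom B_le sol v_reg g_diff kappa_ge0 a0 a1 al0 Cgam_gt0 tl (graded_ratio gm)
  g_int scheme S_sqrt B_energy klam (tau_mono gm) tau_d tau_kappa small.
have dat := data_error_sum tl gm a0 a1 Cgam_gt0 k0 (ltW Cq_gt0) (ltW Cg_gt0) g_reg g_approx.
have OmT j : omega1 (al j) T <= Om by apply: omega1_le_uniform; rewrite ?al_ge ?al1.
have res := residual_sum_le H_hilbert A_sa (ltW M0) (ltW CB_gt0) (ltW Cu_gt0)
  B_sa B_dom B_le sol v_reg kappa_ge0 a0 a1 al0 Cgam_gt0 tl gm k0 al1 OmT dat.
have xi := sumXi k N t _ tl gm; rewrite k0 kk1 in xi; have {}xi := xi isT.
have main n : (n <= N)%N -> `|V n - v (t n)| <=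
    4 * expR (lam * T) * (CR * C1) * Xi k alpha gamma (t 1%N) (t N).
  move=> nN; apply: le_trans (err n nN) _; rewrite -[leRHS]mulrA ler_wpM2l ?(ltW E0)//.
  by apply: le_trans res _; rewrite -[leRHS]mulrA ler_wpM2l ?(ltW CR0).
(* The maximum starts from 0, so the bound must be nonnegative; the estimate at level 0 provides
   this. *)
have Xi0 : 0 <= 4 * expR (lam * T) * (CR * C1) * Xi k alpha gamma (t 1%N) (t N).
  exact: le_trans (main 0%N (leq0n N)).
split; apply: bigmax_nat_le => // n /andP[n1 nN]; first exact: main.
(* The error of [U] is that of [V] damped by exp(- kappa t_n), which is at most 1. *)
apply: le_trans (main n nN).
have -> : U n - u (t n) = expR (- kappa * t n) *: (V n - v (t n)).
  by rewrite /U /v scalerBr scalerA -expRD mulNr addNr expR0 scale1r.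
rewrite normrZ gtr0_norm ?expR_gt0// ler_piMl// -expR0 ler_expR mulNr oppr_le0.
by rewrite mulr_ge0// (time_level_ge0 tl).
Qed.
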